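(* Let $d\in\{1,2,3\}$, $\lambda>0$, and let $\rho\in(0,1)$ satisfy $F(\rho)=0$. Let $\delta>0$ and $t>0$, let $A_0\subset\{(z_1,\dots,z_d)\in\mathbb{Z}^d:z_j<0\text{ for all }j\}$ be a nonempty finite set, and let $\varphi:\mathbb{T}^d\to\mathbb{R}$ be a smooth function. Let $\{\eta(s)\}_{s\ge0}$ be the reaction-diffusion process on $\mathbb{T}_n^d$ with generator $L_n$, and let $\mathbb{P}_{\nu_\rho}$ be its law when started from $\nu_\rho$. Then $$\lim_{n\to\infty}\mathbb{P}_{\nu_\rho}\left(\left|\int_0^t\sum_{x\in\mathbb{T}_n^d}n^{-d/2}\varphi\left(\tfrac{x}{n}\right)\overline\eta_{A_0+x}(s)\,\overline\eta_x(s)\,ds\right|>\delta\right)=0.$$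
   Context: $\mathbb{T}_n^d=\mathbb{Z}^d/n\mathbb{Z}^d$, $\mathbb{T}^d=\mathbb{R}^d/\mathbb{Z}^d$, and $e_1,\dots,e_d$ are the canonical unit vectors. For $\eta\in\{0,1\}^{\mathbb{T}_n^d}$, $\eta^{x,y}$ exchanges the values $\eta_x,\eta_y$ and $\eta^x$ replaces $\eta_x$ by $1-\eta_x$. Set $c_x(\eta)=\eta_x+(1-\eta_x)\left(1+\lambda\sum_{j=1}^d\eta_{x-e_j}\eta_{x+e_j}\right)$. The reaction-diffusion process is the Markov chain on $\{0,1\}^{\mathbb{T}_n^d}$ with generator $$L_nf(\eta)=n^2\sum_{x\in\mathbb{T}_n^d}\sum_{j=1}^d[f(\eta^{x,x+e_j})-f(\eta)]+\sum_{x\in\mathbb{T}_n^d}c_x(\eta)[f(\eta^x)-f(\eta)].$$ $\nu_\rho$ is the Bernoulli product measure of density $\rho$ and $F(m)=(1-m)(1+\lambda dm^2)-m$. Write $\overline\eta_x=\eta_x-\rho$ and, for a finite set $A$, $\overline\eta_A=\prod_{x\in A}(\eta_x-\rho)$; sites are read modulo $n$. *)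

(* Defs.v *)
From HB Require Import structures.
From mathcomp Require Import all_boot all_order all_algebra finmap.
From mathcomp Require Import all_classical all_reals all_analysis.

Set Implicit Arguments.
Unset Strict Implicit.
Unset Printing Implicit Defensive.

Import Order.TTheory GRing.Theory Num.Theory.
Import numFieldNormedType.Exports.

Local Open Scope classical_set_scope.
Local Open Scope ring_scope.

(* The tori are indexed by [n : nat] and have side length [n.+1], so that the
   coordinates live in the cyclic group ['I_n.+1] for every [n] (['Z_n] would be
   wrong for side length 1). *)
Definition torus (d n : nat) := 'rV['I_n.+1]_d.

Definition config (d n : nat) := {ffun torus d n -> bool}.

Section Lattice.
Variables d n : nat.
Implicit Types (x y : torus d n) (z : 'rV[int]_d) (eta : config d n).

(* Reduction modulo n.+1 of a point of Z^d. *)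
Definition site z : torus d n := map_mx (fun k : int => (Zp1 : 'I_n.+1) *~ k) z.

Definition unit_site (j : 'I_d) : torus d n := site (delta_mx 0 j).

Definition exchange eta x y : config d n :=
  [ffun u => if u == x then eta y else if u == y then eta x else eta u].

Definition flip eta x : config d n :=
  [ffun u => if u == x then ~~ eta u else eta u].

End Lattice.

Section ReactionDiffusion.
Variables (R : realType) (d n : nat).
Implicit Types (x : torus d n) (eta : config d n).

Definition occ eta x : R := (eta x)%:R.

Definition flip_rate (lambda : R) x eta : R :=
  occ eta x + (1 - occ eta x) *
    (1 + lambda * \sum_(j < d) occ eta (x - unit_site n j) *
                               occ eta (x + unit_site n j)).

Definition generator (lambda : R) (f : config d n -> R) (eta : config d n) : R :=
  (n.+1)%:R ^+ 2 *
    (\sum_(x : torus d n) \sum_(j < d)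
       (f (exchange eta x (x + unit_site n j)) - f eta))
  + \sum_(x : torus d n) flip_rate lambda x eta * (f (flip eta x) - f eta).

Definition bernoulli_product (rho : R) (eta : config d n) : R :=
  \prod_(x : torus d n) (if eta x then rho else 1 - rho).

Definition centered (rho : R) eta x : R := occ eta x - rho.

(* The product over A + x, with A a finite subset of Z^d and the sites of A + x
   read modulo n.+1. *)
Definition centered_prod (rho : R) (A : {fset 'rV[int]_d}) eta x : R :=
  \prod_(z <- A) centered rho eta (site n z + x).

(* The point x / (n.+1) of the torus R^d / Z^d, as its representative in
   [0, 1[^d. *)
Definition macro_point x : 'rV[R]_d :=
  \row_j ((x 0 j : nat)%:R / (n.+1)%:R).

End ReactionDiffusion.

Definition reaction_drift (R : realType) (d : nat) (lambda m : R) : R :=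
  (1 - m) * (1 + lambda * d%:R * m ^+ 2) - m.

Section MarkovChain.
Variables (R : realType) (S : finType).

(* e^{u L} f, as the exponential series; L is meant to be linear, so that the
   series converges because S is finite. *)
Definition semigroup (L : (S -> R) -> S -> R) (u : R) (f : S -> R) (a : S) : R :=
  limn (series (fun k => u ^+ k / k`!%:R * iter k L f a)).

Definition transition (L : (S -> R) -> S -> R) (u : R) (a b : S) : R :=
  semigroup L u (fun c => (c == b)%:R) a.

(* [X] is a (cadlag) continuous-time Markov chain on [S] under [P], with
   generator [L] and initial distribution [mu]. Only times s >= 0 matter. *)
Record is_markov_chain (L : (S -> R) -> S -> R) (mu : S -> R)
    (disp : measure_display) (Omega : measurableType disp)
    (P : probability Omega R) (X : R -> Omega -> S) : Prop := IsMarkovChain {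
  markov_measurable : forall s a, 0 <= s -> measurable [set w | X s w = a];
  (* S is discrete: limits in S are eventual equalities *)
  markov_right_cont : forall w s, 0 <= s ->
    \forall u \near s^'+, X u w = X s w;
  markov_left_lim : forall w s, 0 < s ->
    exists a, \forall u \near s^'-, X u w = a;
  markov_init : forall a, P [set w | X 0 w = a] = (mu a)%:E;
  (* P(past, X_s = a, X_{s+u} = b) = P(past, X_s = a) p_u(a, b), where the past
     lists finitely many times up to s with the states visited then *)
  markov_property : forall (past : seq (R * S)) (s u : R) (a b : S),
    0 <= s -> 0 <= u -> (forall p, p \in past -> 0 <= p.1 <= s) ->
    P [set w | [/\ forall p, p \in past -> X p.1 w = p.2,
                   X s w = a & X (s + u) w = b]] =
    (P [set w | (forall p, p \in past -> X p.1 w = p.2) /\ X s w = a]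
     * (transition L u a b)%:E)%E
}.

End MarkovChain.

Section TorusFunctions.
Variables (R : realType) (d : nat).

Fixpoint Ck (k : nat) (f : 'rV[R]_d -> R) : Prop :=
  if k is k'.+1 then
    continuous f /\
    forall j : 'I_d,
      (forall x, derivable f x (delta_mx 0 j)) /\
      Ck k' (fun x => 'D_(delta_mx 0 j) f x)
  else continuous f.

(* Smooth functions on R^d / Z^d, as Z^d-periodic C^infinity functions on R^d. *)
Definition smooth_torus (f : 'rV[R]_d -> R) : Prop :=
  (forall k, Ck k f) /\
  (forall (x : 'rV[R]_d) (z : 'rV[int]_d),
     f (x + map_mx (fun k : int => k%:~R) z) = f x).

End TorusFunctions.

(* Main.v *)
Require Import Defs.
From HB Require Import structures.
From mathcomp Require Import all_boot all_order all_algebra finmap.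
From mathcomp Require Import all_classical all_reals all_analysis.
From mathcomp Require Import perm measurable_realfun.
From mathcomp Require Import ring lra zify.

Set Implicit Arguments.
Unset Strict Implicit.
Unset Printing Implicit Defensive.

Import Order.TTheory GRing.Theory Num.Theory.
Import numFieldNormedType.Exports.

Local Open Scope classical_set_scope.
Local Open Scope ring_scope.

(** Write N for the side n.+1 of the torus, nu for the Bernoulli measure, L for the
    generator, V for the sum under the time integral and a = N^(d/2), so that
    a V is a sum over the sites z of a bounded product of centered occupation
    numbers times the centered occupation number at z.

    Quadratic forms. Two facts turn bounds on <u, L u> in L^2 (nu) into bounds
    on the process. If f is the density of a law mu with respect to nu and
    g = sqrt f, the relative entropy H (mu) grows at a rate at most 2 <g, L g>
    ([entropy_step], [law_at_entropy]). If <u, L u> + <U u, u> <= 0 for all u,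
    the exponential of the time integral of U has bounded expectation (the
    Feynman-Kac estimate [tilted_mass]). Here <u, L u> is not nonpositive, as
    nu is not invariant: it is at most - (N^2 / 2) times the Dirichlet form of
    the exchanges plus one half of <Psi u, u>, where Psi is the adjoint of the
    reaction applied to 1 ([generator_form]). Now F (rho) = 0 says exactly that
    Psi has no term with a single centered variable ([flip_defect_local]).
    Hence Psi has the same structure as a V: a sum over z of a mean-zero local
    product, with all its sites behind z, times the centered occupation number
    at z.

    Replacement. In such a sum the local products can be replaced by their
    averages over boxes of sides l_0, .., l_(d-1). An Abel summation in one
    direction at a time produces gradients of the occupation numbers, which a
    small part of the Dirichlet form absorbs at the price of squares of linear
    combinations of local products ([abel_average], [gradient_bound],
    [one_pass]). A second pass transfers an average to the other factor
    ([two_passes]). The outcome is an explicit R >= 0, a sum of squares of linear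
    combinations of local products, with <u, L u> +- a <V u, u> <= <R u, u> for
    all u ([form_inequality]).

    Size of R. Linear combinations of local products are sub-Gaussian under nu
    ([lincomb_mgf]), and independent when they live on disjoint windows. Splitting
    the windows into colour classes of disjoint windows, the entropy inequality
    gives E_mu R <= K (H (mu) + N^d / m) for every law mu, where m = l_0 .. l_(d-1)
    ([local_remainder_entropy]). Gronwall's lemma then keeps the entropy of the
    process below a constant times N^d / m on [0, t], so that the time integral
    of R has an expectation of this order. Feynman-Kac with U = +- a V - R bounds
    by e^(1 - a delta / 2) the probability that the integral of +- a V - R
    exceeds a delta / 2; and by Markov's inequality the integral of R exceeds
    a delta / 2 with a probability of order N^d / (m a) = N^(d/2) / m
    ([grid_bound]). Feynman-Kac alone would not do: R is not small uniformly in
    the configuration, and the entropy bound is what controls it.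

    Scales. The squares from direction k have coefficients of total size
    l_k / (l_0 .. l_(k-1)), and m times this must be at most N^2. The choice
    l_k = q^(2^(4-d+k)) makes all these ratios equal to l_0; with q^9 of order N
    one has m l_0 = q^16 <= N^2, and m = q^(16 - 2^(4-d)) is at least of order
    q^(1/2) N^(d/2) because d <= 3 ([volume_scales]).

    Time is discretized with a step h = t / M. The law at the times of the grid is
    a product of matrices I + h L + O(h^2), and all the estimates above become
    inequalities between finite sums; the right-continuity of the paths allows
    M to tend to infinity ([chain_time_integral_tail]). *)

(** * Relative entropy and one step of a Markov chain *)

Section Entropy.
Variables (R : realType) (S : finType) (nu : S -> R).
Hypothesis nu_gt0 : forall a, 0 < nu a.
Hypothesis nu_sum1 : \sum_a nu a = 1.

Definition is_dist (mu : S -> R) := (forall a, 0 <= mu a) /\ \sum_a mu a = 1.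

Definition entropy (mu : S -> R) : R := \sum_a mu a * ln (mu a / nu a).

Definition push (p : S -> S -> R) (mu : S -> R) (b : S) : R :=
  \sum_a mu a * p a b.

(** The adjoint of [p] in L^2 (nu): it maps the density of a law to the density of
    the law one step later. *)
Definition adj (p : S -> S -> R) (u : S -> R) (b : S) : R :=
  (\sum_a nu a * u a * p a b) / nu b.

Lemma ln_le_subr1 (x : R) : 0 < x -> ln x <= x - 1.
Proof.
move=> x0; have -> : x = 1 + (x - 1) by ring.
apply: le_trans (le_ln1Dx _) _; lra.
Qed.

Lemma jensen_sqr (x : S -> R) : (\sum_a nu a * x a) ^+ 2 <= \sum_a nu a * x a ^+ 2.
Proof.
have [m mE] : exists m, m = \sum_a nu a * x a by eexists.
have : 0 <= \sum_a nu a * (x a - m) ^+ 2.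
  by apply: sumr_ge0 => a _; rewrite mulr_ge0 ?sqr_ge0 ?ltW.
have -> : \sum_a nu a * (x a - m) ^+ 2 =
    \sum_a nu a * x a ^+ 2 - 2 * m * (\sum_a nu a * x a) + m ^+ 2 * \sum_a nu a.
  rewrite !mulr_sumr -sumrB -big_split /=; apply: eq_bigr => a _; ring.
rewrite nu_sum1 -mE; nra.
Qed.

(** Gibbs variational inequality: ln x <= x - 1 is applied to the ratio between the
    density of the tilted measure exp (G) nu / Z and that of [mu]. *)
Lemma entropy_ineq (mu G : S -> R) : is_dist mu ->
  \sum_a mu a * G a <= entropy mu + ln (\sum_a nu a * expR (G a)).
Proof.
move=> [mu0 mu1]; set Z := \sum_a nu a * expR (G a).
have Z0 : 0 < Z.
  have [a _] : exists a : S, true.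
    case: (pickP (fun _ : S => true)) => [a _|h]; first by exists a.
    by move: nu_sum1; rewrite big_pred0 // => /esym/eqP; rewrite oner_eq0.
  rewrite /Z (bigD1 a) //= ltr_pwDl ?mulr_gt0 ?expR_gt0 //.
  by apply: sumr_ge0 => b _; rewrite mulr_ge0 ?expR_ge0 ?ltW.
suff : \sum_a (mu a - nu a * expR (G a) / Z) <=
    \sum_a (mu a * ln (mu a / nu a) + mu a * ln Z - mu a * G a).
  rewrite !sumrB big_split /= -!mulr_suml mu1 -/Z divff ?subrr ?gt_eqF //.
  by rewrite mul1r subr_ge0.
apply: ler_sum => a _.
have := mu0 a; rewrite le_eqVlt => /orP[/eqP <-|mua].
  by rewrite !mul0r sub0r addr0 subr0 lerNl oppr0 divr_ge0 ?mulr_ge0 ?expR_ge0 ?ltW.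
set x := nu a * expR (G a) / (mu a * Z).
have x0 : 0 < x by rewrite divr_gt0 ?mulr_gt0 ?expR_gt0.
have := ln_le_subr1 x0.
have -> : ln x = - ln (mu a / nu a) + G a - ln Z.
  have e0 := expR_gt0 (G a).
  rewrite /x !ln_div ?posrE ?mulr_gt0 // !lnM ?posrE // expRK; ring.
move=> h; have -> : nu a * expR (G a) / Z = mu a * x.
  by rewrite /x; field; rewrite !gt_eqF.
have := ler_wpM2l (mu0 a) h; lra.
Qed.

(** With g and g' the square roots of the densities before and after the step,
    ln (f' / f) = 2 ln (g' / g) <= 2 (g' / g - 1) on each transition, so that the
    entropy increases by at most 2 <p^* g, g'> - 2, and
    2 <p^* g, g'> <= |p^* g|^2 + |g'|^2 with |g'|^2 = 1. *)
Lemma entropy_step (p : S -> S -> R) (mu : S -> R) :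
  (forall a b, 0 <= p a b) -> (forall a, \sum_b p a b = 1) -> is_dist mu ->
  entropy (push p mu) <= entropy mu +
    (\sum_b nu b * adj p (fun a => Num.sqrt (mu a / nu a)) b ^+ 2 - 1).
Proof.
move=> p0 p1 [mu0 mu1].
set g := fun a => Num.sqrt (mu a / nu a).
set mu' := push p mu; set g' := fun a => Num.sqrt (mu' a / nu a).
have mu'0 a : 0 <= mu' a by apply: sumr_ge0 => b _; rewrite mulr_ge0.
have g2 a : mu a = nu a * g a ^+ 2.
  rewrite sqr_sqrtr ?divr_ge0 ?(ltW (nu_gt0 _)) // mulrC divfK // gt_eqF //.
have g'2 a : mu' a = nu a * g' a ^+ 2.
  rewrite sqr_sqrtr ?divr_ge0 ?(ltW (nu_gt0 _)) // mulrC divfK // gt_eqF //.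
have sg'2 : \sum_b nu b * g' b ^+ 2 = 1.
  under eq_bigr do rewrite -g'2.
  rewrite exchange_big /= -mu1; apply: eq_bigr => a _.
  by rewrite -mulr_sumr p1 mulr1.
(* both entropies as sums over the transitions a -> b, to compare them termwise *)
have e1 : entropy mu' = \sum_a \sum_b mu a * p a b * ln (mu' b / nu b).
  rewrite exchange_big /=; apply: eq_bigr => b _; rewrite -mulr_suml //.
have e2 : entropy mu = \sum_a \sum_b mu a * p a b * ln (mu a / nu a).
  apply: eq_bigr => a _; rewrite -mulr_suml -mulr_sumr p1 mulr1 //.
have main : entropy mu' - entropy mu <=
    \sum_a \sum_b (2 * (nu a * g a * p a b * g' b) - 2 * (mu a * p a b)).
  rewrite e1 e2 -sumrB; apply: ler_sum => a _; rewrite -sumrB; apply: ler_sum => b _.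
  have := mu0 a; rewrite le_eqVlt => /orP[/eqP mua0|mua].
    by rewrite /g -mua0 !mul0r sqrtr0 !(mul0r, mulr0).
  have := p0 a b; rewrite le_eqVlt => /orP[/eqP pab0|pab].
    by rewrite -pab0 !(mul0r, mulr0).
  have mu'b : 0 < mu' b.
    rewrite /mu' /push (bigD1 a) //= ltr_pwDl ?mulr_gt0 //.
    by apply: sumr_ge0 => c _; rewrite mulr_ge0.
  have ga : 0 < g a by rewrite sqrtr_gt0 divr_gt0.
  have gb : 0 < g' b by rewrite sqrtr_gt0 divr_gt0.
  have -> : mu' b / nu b = g' b ^+ 2 by rewrite sqr_sqrtr ?divr_ge0 // ltW.
  have -> : mu a / nu a = g a ^+ 2 by rewrite sqr_sqrtr ?divr_ge0 // ltW.
  rewrite !lnXn // g2.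
  have := ln_le_subr1 (divr_gt0 gb ga); rewrite ln_div ?posrE // => h.
  have cc : 0 <= 2 * (nu a * g a ^+ 2 * p a b).
    by rewrite mulr_ge0 ?ler0n // !mulr_ge0 ?sqr_ge0 // ltW.
  have := ler_wpM2l cc h.
  have -> : 2 * (nu a * g a ^+ 2 * p a b) * (g' b / g a - 1) =
     2 * (nu a * g a * p a b * g' b) - 2 * (nu a * g a ^+ 2 * p a b).
    by field; rewrite gt_eqF.
  rewrite !mulr2n; lra.
rewrite -lerBlDl; apply: le_trans main _.
under eq_bigr do rewrite sumrB.
rewrite sumrB.
have -> : \sum_a \sum_b 2 * (mu a * p a b) = 2.
  under eq_bigr do rewrite -mulr_sumr -mulr_sumr p1 mulr1.
  by rewrite -mulr_sumr mu1 mulr1.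
have -> : \sum_a \sum_b 2 * (nu a * g a * p a b * g' b) =
          \sum_b nu b * (2 * adj p g b * g' b).
  rewrite exchange_big /=; apply: eq_bigr => b _.
  rewrite -mulr_sumr -mulr_suml /adj; field; rewrite gt_eqF //.
have : \sum_b nu b * (2 * adj p g b * g' b) <=
   \sum_b (nu b * adj p g b ^+ 2 + nu b * g' b ^+ 2).
  apply: ler_sum => b _; rewrite -[X in _ <= X]mulrDr; apply: ler_wpM2l; first exact: ltW.
  have := sqr_ge0 (adj p g b - g' b); nra.
rewrite big_split /= sg'2; lra.
Qed.

Lemma adj_bound (r : S -> S -> R) (C : R) : 0 <= C ->
  (forall a b, `|r a b| <= C) -> forall u,
  \sum_b nu b * adj r u b ^+ 2 <= (\sum_b C ^+ 2 / nu b) * \sum_a nu a * u a ^+ 2.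
Proof.
move=> C0 rC u; rewrite mulr_suml; apply: ler_sum => b _.
rewrite /adj expr_div_n.
have h : (\sum_a nu a * u a * r a b) ^+ 2 <= C ^+ 2 * \sum_a nu a * u a ^+ 2.
  under eq_bigr do rewrite -mulrA.
  apply: le_trans (jensen_sqr _) _; rewrite mulr_sumr; apply: ler_sum => a _.
  have -> : nu a * (u a * r a b) ^+ 2 = nu a * u a ^+ 2 * r a b ^+ 2 by ring.
  rewrite [C ^+ 2 * _]mulrC; apply: ler_wpM2l; first by rewrite mulr_ge0 ?sqr_ge0 // ltW.
  have /ler_normlP[h1 h2] := rC a b; nra.
have nb := nu_gt0 b.
have -> : nu b * ((\sum_a nu a * u a * r a b) ^+ 2 / nu b ^+ 2) =
   (\sum_a nu a * u a * r a b) ^+ 2 / nu b by field; rewrite gt_eqF.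
by rewrite [X in _ <= X]mulrAC ler_wpM2r // invr_ge0 ltW.
Qed.

(** For a family of matrices k_h = I + h q + O(h^2) this is the expansion
    |k_h^* u|^2 <= |u|^2 + 2 h <u, q^* u> + O(h^2) |u|^2. It reduces the effect of a
    small time step to the quadratic form of [q]; it serves both the transition
    matrices and their Feynman-Kac perturbations. *)
Lemma adj_expand (k : R -> S -> S -> R) (q : S -> S -> R) (C : R) :
  (forall (h : R) a b, 0 <= h <= 1 -> `|k h a b - (a == b)%:R - h * q a b| <= C * h ^+ 2) ->
  exists2 C', 0 <= C' & forall (h : R) u, 0 <= h <= 1 ->
   \sum_b nu b * adj (k h) u b ^+ 2 <=
    (1 + C' * h ^+ 2) * (\sum_a nu a * u a ^+ 2)
     + 2 * h * \sum_b nu b * u b * adj q u b.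
Proof.
move=> hk.
pose Q : R := \sum_a \sum_b `|q a b|.
have Q0 : 0 <= Q by do 2!apply: sumr_ge0 => ? _.
have qQ a b : `|q a b| <= Q.
  rewrite /Q (bigD1 a) //= (bigD1 b) //= -addrA lerDl addr_ge0 //.
    by apply: sumr_ge0.
  by do 2!apply: sumr_ge0 => ? _.
pose D : R := 1 + 2 * (\sum_b Q ^+ 2 / nu b) + 3 * (\sum_b `|C| ^+ 2 / nu b).
have s0 (x : R) : 0 <= \sum_b x ^+ 2 / nu b.
  by apply: sumr_ge0 => b _; rewrite divr_ge0 ?sqr_ge0 ?(ltW (nu_gt0 _)).
exists D; first by rewrite /D !addr_ge0 ?mulr_ge0.
move=> h u h01.
have h0 : 0 <= h by case/andP: h01.
have h1 : h <= 1 by case/andP: h01.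
pose r a b := if h == 0 then 0 else (k h a b - (a == b)%:R - h * q a b) / h ^+ 2.
have hr a b : k h a b = (a == b)%:R + h * q a b + h ^+ 2 * r a b.
  rewrite /r; case: (h =P 0) => [e|/eqP hn].
    have := hk h a b h01; rewrite e expr0n /= mulr0 normr_le0 => /eqP.
    rewrite !mul0r subr0 !addr0 => /eqP; by rewrite subr_eq0 => /eqP.
  by field.
have rC a b : `|r a b| <= `|C|.
  rewrite /r; case: (h =P 0) => [e|/eqP hn]; first by rewrite normr0.
  rewrite normrM normfV (ger0_norm (sqr_ge0 _)) ler_pdivrMr ?exprn_gt0 ?lt_def ?hn//.
  apply: le_trans (hk _ _ _ h01) _.
  by rewrite ler_wpM2r ?sqr_ge0 // ler_norm.
have ad b : adj (k h) u b = u b + h * adj q u b + h ^+ 2 * adj r u b.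
  rewrite /adj.
  have -> : \sum_a nu a * u a * k h a b =
     nu b * u b + h * (\sum_a nu a * u a * q a b) + h ^+ 2 * (\sum_a nu a * u a * r a b).
    rewrite !mulr_sumr (bigD1 b) //= [X in _ = _ + X + _](bigD1 b) //=
      [X in _ = _ + _ + X](bigD1 b) //= hr eqxx (_ : true%:R = 1 :> R) //.
    have -> : \sum_(i | i != b) nu i * u i * k h i b =
       \sum_(i | i != b) h * (nu i * u i * q i b) +
       \sum_(i | i != b) h ^+ 2 * (nu i * u i * r i b).
      rewrite -big_split; apply: eq_bigr => i ib; rewrite hr (negbTE ib) /=; ring.
    ring.
  by field; rewrite gt_eqF.
have step b : nu b * adj (k h) u b ^+ 2 <=
   nu b * u b ^+ 2 + 2 * h * (nu b * u b * adj q u b) +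
   h ^+ 2 * (nu b * u b ^+ 2 + 2 * (nu b * adj q u b ^+ 2) + 3 * (nu b * adj r u b ^+ 2)).
  rewrite ad; set x := u b; set v := adj q u b; set w := adj r u b.
  have -> : nu b * x ^+ 2 + 2 * h * (nu b * x * v) +
     h ^+ 2 * (nu b * x ^+ 2 + 2 * (nu b * v ^+ 2) + 3 * (nu b * w ^+ 2))
    = nu b * (x ^+ 2 + 2 * h * (x * v) + h ^+ 2 * (x ^+ 2 + 2 * v ^+ 2 + 3 * w ^+ 2)) by ring.
  rewrite ler_wpM2l ?(ltW (nu_gt0 _)) //.
  have -> : (x + h * v + h ^+ 2 * w) ^+ 2 = x ^+ 2 + 2 * h * (x * v) +
     h ^+ 2 * (v ^+ 2 + 2 * x * w + 2 * h * (v * w) + h ^+ 2 * w ^+ 2) by ring.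
  rewrite lerD2l ler_wpM2l ?sqr_ge0 //.
  have e1 : 2 * x * w <= x ^+ 2 + w ^+ 2 by have := sqr_ge0 (x - w); nra.
  have e2 : 2 * h * (v * w) <= v ^+ 2 + w ^+ 2.
    have e3 : h * (2 * (v * w)) <= h * (v ^+ 2 + w ^+ 2).
      by rewrite ler_wpM2l //; have := sqr_ge0 (v - w); nra.
    have : h * (v ^+ 2 + w ^+ 2) <= v ^+ 2 + w ^+ 2.
      by rewrite ler_piMl // addr_ge0 ?sqr_ge0.
    move: e3; lra.
  have e3 : h ^+ 2 * w ^+ 2 <= w ^+ 2 by rewrite ler_piMl ?sqr_ge0 // exprn_ile1.
  lra.
apply: le_trans (ler_sum _ (fun b _ => step b)) _.
rewrite !big_split /= -!mulr_sumr !big_split /= -!mulr_sumr.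
have b1 := adj_bound Q0 qQ u.
have b2 := adj_bound (normr_ge0 C) rC u.
set U := \sum_a nu a * u a ^+ 2 in b1 b2 *.
have b3 := ler_wpM2l (sqr_ge0 h) (lerD (lerD (lexx U) (ler_wpM2l (ler0n R 2) b1))
  (ler_wpM2l (ler0n R 3) b2)).
rewrite addrAC lerD2r [X in _ <= X]mulrDl mul1r lerD2l; apply: le_trans b3 _.
by rewrite /D le_eqVlt; apply/orP; left; apply/eqP; ring.
Qed.

End Entropy.

(** * Independence and exponential moments under Bernoulli measures *)

Section Bernoulli.
Variables (R : realType) (T : finType) (rho : R).
Hypothesis rho01 : 0 < rho < 1.
Implicit Types (eta : {ffun T -> bool}) (F G : {ffun T -> bool} -> R).

Let w (b : bool) : R := if b then rho else 1 - rho.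

Definition bern eta : R := \prod_(x : T) (if eta x then rho else 1 - rho).

Definition expect F : R := \sum_eta bern eta * F eta.

Definition upd eta x b : {ffun T -> bool} := [ffun u => if u == x then b else eta u].

Definition site_avg x F eta : R := rho * F (upd eta x true) + (1 - rho) * F (upd eta x false).

Definition indep F x := forall eta b, F (upd eta x b) = F eta.

Let w_gt0 b : 0 < w b.
Proof. by have [r0 r1] := andP rho01; case: b; rewrite /w; lra. Qed.

Lemma bern_gt0 eta : 0 < bern eta.
Proof. by apply: prodr_gt0 => x _; apply: w_gt0. Qed.

Lemma expect_ge0 F : (forall eta, 0 <= F eta) -> 0 <= expect F.
Proof. by move=> F0; apply: sumr_ge0 => eta _; rewrite mulr_ge0 // ltW ?bern_gt0. Qed.

Lemma ler_expect F G : (forall eta, F eta <= G eta) -> expect F <= expect G.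
Proof. by move=> FG; apply: ler_sum => eta _; rewrite ler_wpM2l // ltW ?bern_gt0. Qed.

Lemma eq_expect F G : (forall eta, F eta = G eta) -> expect F = expect G.
Proof. by move=> FG; apply: eq_bigr => eta _; rewrite FG. Qed.

Lemma expectZ c F : expect (fun eta => c * F eta) = c * expect F.
Proof. by rewrite /expect mulr_sumr; apply: eq_bigr => eta _; rewrite mulrCA. Qed.

Lemma expectD F G : expect (fun eta => F eta + G eta) = expect F + expect G.
Proof. by rewrite /expect -big_split; apply: eq_bigr => eta _; rewrite mulrDr. Qed.

Lemma expect_sum (I : Type) (s : seq I) (F : I -> {ffun T -> bool} -> R) :
  expect (fun eta => \sum_(i <- s) F i eta) = \sum_(i <- s) expect (F i).
Proof. by rewrite /expect exchange_big; apply: eq_bigr => eta _; rewrite mulr_sumr. Qed.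

Lemma updK eta x b : upd (upd eta x b) x (eta x) = eta.
Proof. by apply/ffunP => u; rewrite !ffunE; case: eqP => [->|]. Qed.

Lemma upd_upd eta x b c : upd (upd eta x b) x c = upd eta x c.
Proof. by apply/ffunP => u; rewrite !ffunE; case: eqP. Qed.

Lemma bern_upd eta x b : bern eta * w b = bern (upd eta x b) * w (eta x).
Proof.
rewrite /bern (bigD1 x) //= [X in _ = X * _](bigD1 x) //= ffunE eqxx -/(w b) -/(w (eta x)).
rewrite [X in _ = _ * X * _](eq_bigr (fun u => if eta u then rho else 1 - rho)); first ring.
by move=> u /negbTE ux; rewrite ffunE ux.
Qed.

(** Resampling one site preserves the measure. All independence arguments below
    are iterations of this identity: sites are integrated one at a time. *)
Lemma expect_avg x F : expect (site_avg x F) = expect F.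
Proof.
(* swapping the value at x with an independent fresh value is an involution *)
pose f (p : {ffun T -> bool} * bool) := (upd p.1 x p.2, p.1 x).
have fK : involutive f.
  by case=> eta b; rewrite /f /= updK ffunE eqxx.
transitivity (\sum_(p : {ffun T -> bool} * bool) bern p.1 * w p.2 * F (upd p.1 x p.2)).
  rewrite -(pair_bigA _ (fun eta b => bern eta * w b * F (upd eta x b))) /=.
  by apply: eq_bigr => eta _; rewrite big_bool /site_avg /w /=; ring.
rewrite (reindex_inj (inv_inj fK)) /=.
transitivity (\sum_(p : {ffun T -> bool} * bool) bern p.1 * w p.2 * F p.1).
  by apply: eq_bigr => -[eta b] _ /=; rewrite updK -bern_upd.
rewrite -(pair_bigA _ (fun eta b => bern eta * w b * F eta)) /=.
by apply: eq_bigr => eta _; rewrite big_bool /w /=; ring.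
Qed.

Lemma bern_sum1 : \sum_eta bern eta = 1.
Proof.
transitivity (\prod_(x : T) \sum_(b : bool) w b).
  by rewrite bigA_distr_bigA.
by rewrite big1 // => x _; rewrite big_bool /w /=; ring.
Qed.

Lemma expect1 : expect (fun=> 1) = 1.
Proof. by rewrite /expect; under eq_bigr do rewrite mulr1; exact: bern_sum1. Qed.

Lemma expect_cst c : expect (fun=> c) = c.
Proof.
rewrite -[RHS]mulr1 -expect1 -expectZ; apply: eq_expect => eta; by rewrite mulr1.
Qed.

Lemma site_avg_indepl x F G eta : indep F x ->
  site_avg x (fun e => F e * G e) eta = F eta * site_avg x G eta.
Proof. by move=> iF; rewrite /site_avg !iF; ring. Qed.

Lemma indep_site_avg x y F : indep F x -> indep (site_avg y F) x.
Proof.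
move=> iF eta b; rewrite /site_avg.
have e c : F (upd (upd eta x b) y c) = F (upd eta y c).
  case: (eqVneq x y) => [<-|xy]; first by rewrite upd_upd.
  rewrite -(iF (upd eta y c) b); congr F; apply/ffunP => u; rewrite !ffunE.
  by case: (eqVneq u y) => [->|//]; rewrite eq_sym (negbTE xy).
by rewrite !e.
Qed.

Lemma indep_self_avg x F : indep (site_avg x F) x.
Proof. by move=> eta b; rewrite /site_avg !upd_upd. Qed.

Lemma indep_cst F : (forall x, indep F x) -> forall eta eta', F eta = F eta'.
Proof.
move=> iF eta eta'.
pose mix (s : seq T) : {ffun T -> bool} := [ffun u => if u \in s then eta' u else eta u].
have key s : F (mix s) = F eta.
  elim: s => [|x s <-]; first by congr F; apply/ffunP => u; rewrite ffunE.
  rewrite -(iF x (mix s) (eta' x)); congr F; apply/ffunP => u; rewrite !ffunE inE.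
  by case: eqP => [->|].
rewrite -(key (enum T)); congr F; apply/ffunP => u; by rewrite ffunE mem_enum.
Qed.

(** Averaging over the sites of [F], one at a time, turns [F] into its expectation, and
    each of these averages commutes with the multiplication by [G]. *)
Lemma expect_indepM (s : seq T) F G :
  (forall x, x \notin s -> indep F x) -> (forall x, x \in s -> indep G x) ->
  expect (fun eta => F eta * G eta) = expect F * expect G.
Proof.
elim: s F => [|x s IH] F iF iG.
  have c := indep_cst (fun x => iF x isT).
  pose e0 : {ffun T -> bool} := [ffun=> true].
  rewrite (eq_expect (G := fun eta => F e0 * G eta)); last by move=> eta; rewrite (c eta e0).
  by rewrite expectZ (eq_expect (c ^~ e0)) expect_cst.
rewrite -(expect_avg x) -(expect_avg x F) -(IH (site_avg x F)).
- apply: eq_expect => eta; rewrite mulrC -site_avg_indepl; last by apply: iG; rewrite mem_head.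
  by rewrite /site_avg; ring.
- move=> y ys; case: (eqVneq y x) => [->|yx]; first exact: indep_self_avg.
  by apply: indep_site_avg; apply: iF; rewrite inE negb_or yx.
- by move=> y ys; apply: iG; rewrite inE ys orbT.
Qed.

Lemma expect_prod_windows (I : eqType) (zs : seq I) (F : I -> {ffun T -> bool} -> R)
    (W : I -> pred T) (C : R) :
  uniq zs -> (forall i eta, 0 <= F i eta) ->
  (forall i x, ~~ W i x -> indep (F i) x) ->
  (forall i j x, i \in zs -> j \in zs -> i != j -> W i x -> ~~ W j x) ->
  (forall i, expect (F i) <= C) ->
  expect (fun eta => \prod_(i <- zs) F i eta) <= C ^+ size zs.
Proof.
move=> uz F0 iF dW FC.
have C0 i : 0 <= expect (F i) by apply: expect_ge0 => eta; apply: F0.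
elim: zs uz dW => [_ _|z zs IH /= /andP[zn uz] dW].
  by rewrite expr0 (eq_expect (G := fun=> 1)) ?expect1 // => eta; rewrite big_nil.
rewrite (eq_expect (G := fun eta => F z eta * \prod_(i <- zs) F i eta)); last first.
  by move=> eta; rewrite big_cons.
rewrite (@expect_indepM (enum (W z))) ?exprS.
- apply: ler_pM; rewrite ?C0 //.
    by apply: expect_ge0 => eta; apply: prodr_ge0 => i _; apply: F0.
  apply: IH => // i j x iz jz; apply: dW; rewrite inE ?iz ?jz orbT //.
- by move=> x; rewrite mem_enum => xW; apply: iF.
- move=> x; rewrite mem_enum => xW eta b; apply: eq_big_seq => i iz; apply: iF.
  apply: (dW z i) => //; rewrite ?mem_head //; first by rewrite inE iz orbT.
  by apply: contraNneq zn => ->.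
Qed.

(** A centered Bernoulli variable is sub-Gaussian. For small y the bound
    exp (x) <= 1 + x + 2 x^2 is averaged, the linear terms cancelling; for
    large y each exponent is already below 2 y^2. *)
Lemma two_point_mgf (y : R) :
  rho * expR ((1 - rho) * y) + (1 - rho) * expR (- rho * y) <= expR (2 * y ^+ 2).
Proof.
have [r0 r1] := andP rho01.
case: (lerP `|y| (1 / 2)) => [/ler_normlP[y1 y2]|y1].
  have ex (x : R) : x <= 1 / 2 -> expR x <= 1 + x + 2 * x ^+ 2.
    move=> x2; have e1 : 0 < 1 - x by lra.
    have e2 := expR_ge1Dx (- x).
    have e3 : expR x * (1 - x) <= 1.
      have := ler_wpM2l (expR_ge0 x) e2; rewrite -expRD subrr expR0; lra.
    rewrite -(ler_pM2r e1); apply: le_trans e3 _.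
    have -> : (1 + x + 2 * x ^+ 2) * (1 - x) = 1 + x ^+ 2 * (1 - 2 * x) by ring.
    by rewrite lerDl mulr_ge0 ?sqr_ge0 //; lra.
  have h1 : (1 - rho) * y <= 1 / 2 by nra.
  have h2 : - rho * y <= 1 / 2 by nra.
  have := ler_wpM2l (ltW r0) (ex _ h1).
  have r1' : 0 <= 1 - rho by lra.
  have := ler_wpM2l r1' (ex _ h2).
  have := expR_ge1Dx (2 * y ^+ 2).
  have : 0 <= y ^+ 2 by apply: sqr_ge0.
  have : 0 <= rho * (1 - rho) * y ^+ 2 by apply: mulr_ge0; [apply: mulr_ge0; lra|exact: sqr_ge0].
  have -> : rho * (1 + (1 - rho) * y + 2 * ((1 - rho) * y) ^+ 2) =
     rho + rho * (1 - rho) * y + 2 * (1 - rho) * (rho * (1 - rho) * y ^+ 2) by ring.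
  have -> : (1 - rho) * (1 + - rho * y + 2 * (- rho * y) ^+ 2) =
     (1 - rho) - rho * (1 - rho) * y + 2 * rho * (rho * (1 - rho) * y ^+ 2) by ring.
  set q := y ^+ 2; set p := rho * (1 - rho) => pq q0.
  have : p * q <= q by rewrite ler_piMl //; rewrite /p; nra.
  have -> : 2 * (1 - rho) * (p * q) = 2 * (p * q) - 2 * rho * (p * q) by ring.
  lra.
have a0 : 0 <= `|y| by [].
have ay := ler_norm y; have ay2 : - y <= `|y| by rewrite -normrN ler_norm.
have q : `|y| <= 2 * y ^+ 2 by rewrite -[y ^+ 2]real_normK ?num_real //; nra.
have e1 : expR ((1 - rho) * y) <= expR (2 * y ^+ 2) by rewrite ler_expR; nra.
have e2 : expR (- rho * y) <= expR (2 * y ^+ 2) by rewrite ler_expR; nra.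
have := ler_wpM2l (ltW r0) e1.
have r1' : 0 <= 1 - rho by lra.
have := ler_wpM2l r1' e2; lra.
Qed.

Section SubGaussian.
Variables (I : eqType) (X Y : I -> {ffun T -> bool} -> R) (u : I -> T) (B : I -> R).
Hypothesis XE : forall i eta, X i eta = ((eta (u i))%:R - rho) * Y i eta.
Hypothesis Y_indep : forall i, indep (Y i) (u i).
Hypothesis Y_bound : forall i eta, `|Y i eta| <= B i.

(** Each variable has a pivot site that the later variables of the list ignore. This
    replaces independence: the products of occupation numbers that occur below
    overlap, but a suitable ordering is triangular. *)
Fixpoint triangular (s : seq I) : Prop :=
  if s is i :: s' then (forall j, j \in s' -> indep (X j) (u i)) /\ triangular s' else True.

(** Integrating the pivot of the first variable, with all other sites fixed, costs
    the factor exp (2 B^2) of [two_point_mgf] and leaves the later variables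
    untouched. *)
Lemma triangular_mgf s : triangular s ->
  expect (fun eta => expR (\sum_(i <- s) X i eta)) <= expR (2 * \sum_(i <- s) B i ^+ 2).
Proof.
elim: s => [_|i s IH /= [ti ts]].
  rewrite big_nil mulr0 expR0 (eq_expect (G := fun=> 1)) ?expect1 //.
  by move=> eta; rewrite big_nil expR0.
rewrite big_cons mulrDr expRD.
pose Q eta := expR (\sum_(j <- s) X j eta).
rewrite (eq_expect (G := fun eta => Q eta * expR (X i eta))); last first.
  by move=> eta; rewrite big_cons expRD mulrC.
rewrite -(expect_avg (u i)).
apply: (@le_trans _ _ (expect (fun eta => expR (2 * B i ^+ 2) * Q eta))); last first.
  by rewrite expectZ ler_wpM2l ?expR_ge0 // IH.
apply: ler_expect => eta; rewrite site_avg_indepl; last first.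
  by move=> e b; congr expR; apply: eq_big_seq => j js; apply: ti.
rewrite mulrC ler_wpM2r ?expR_ge0 // /site_avg !XE !Y_indep !ffunE eqxx.
have := two_point_mgf (Y i eta); rewrite (_ : true%:R = 1 :> R) // (_ : false%:R = 0 :> R) //.
rewrite sub0r => /le_trans; apply; rewrite ler_expR ler_wpM2l //.
by rewrite -[_ ^+ 2]real_normK ?num_real // lerXn2r ?nnegrE //; apply: le_trans (Y_bound i eta).
Qed.

End SubGaussian.

Definition sq_exp_cst : R := 2 * expR 1 / (1 - expR (- (1 / 2))).

Lemma exp_half_lt1 : expR (- (1 / 2)) < 1 :> R.
Proof. by rewrite expR_lt1; lra. Qed.

Lemma geometric_le (x : R) n : 0 <= x < 1 -> \sum_(k < n) x ^+ k <= 1 / (1 - x).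
Proof.
move=> /andP[x0 x1]; rewrite ler_pdivlMr ?subr_gt0 //.
have -> : (\sum_(k < n) x ^+ k) * (1 - x) = 1 - x ^+ n.
  elim: n => [|n IH]; first by rewrite big_ord0 expr0; ring.
  by rewrite big_ord_recr /= mulrDl IH exprS; ring.
by rewrite gerBl exprn_ge0.
Qed.

Lemma sq_exp_cst_ge1 : 1 <= sq_exp_cst.
Proof.
have h := exp_half_lt1; have h0 := expR_gt0 (- (1 / 2) : R).
rewrite /sq_exp_cst ler_pdivlMr ?subr_gt0 //.
have := expR_ge1Dx (1 : R); lra.
Qed.

(** Exponential integrability of the square of a sub-Gaussian variable. Without
    Gaussian integrals: if k is the integer part of u >= 0, then
    u^2 <= 1 - k^2 + 2 k u, so exp (u^2) is at most e times the sum over k of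
    exp (- k^2) exp (2 k u), and the sub-Gaussian bound makes the expectation of the
    k-th term summable. *)
Lemma expect_exp_sqr (Z : {ffun T -> bool} -> R) (K : R) : 0 < K ->
  (forall s, expect (fun eta => expR (s * Z eta)) <= expR (K * s ^+ 2)) ->
  expect (fun eta => expR (Z eta ^+ 2 / (8 * K))) <= sq_exp_cst.
Proof.
move=> K0 HZ.
(* with this scale exp (2 k th Z) has expectation at most exp (k^2 / 2) *)
pose th := Num.sqrt (1 / (8 * K)).
have th0 : 0 < th by rewrite sqrtr_gt0 divr_gt0 ?mulr_gt0.
have th2 : th ^+ 2 = 1 / (8 * K) by rewrite sqr_sqrtr // divr_ge0 ?mulr_ge0 // ltW.
pose N := (Num.truncn (\sum_eta th * `|Z eta|)).+1.
have term k : expect (fun eta => expR (2 * k%:R * th * Z eta) + expR (- (2 * k%:R * th) * Z eta))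
     <= 2 * expR (k%:R ^+ 2 / 2).
  rewrite expectD.
  have e s : s ^+ 2 = 4 * k%:R ^+ 2 * th ^+ 2 ->
      expect (fun eta => expR (s * Z eta)) <= expR (k%:R ^+ 2 / 2).
    move=> se; apply: le_trans (HZ s) _; rewrite se th2 ler_expR le_eqVlt.
    by apply/orP; left; apply/eqP; field; rewrite gt_eqF.
  have := e (2 * k%:R * th) ltac:(ring); have := e (- (2 * k%:R * th)) ltac:(ring); lra.
apply: (@le_trans _ _ (expect (fun eta => \sum_(k < N) (expR 1 * expR (- k%:R ^+ 2)) *
   (expR (2 * k%:R * th * Z eta) + expR (- (2 * k%:R * th) * Z eta))))).
  apply: ler_expect => eta; pose u := th * `|Z eta|.
  have u0 : 0 <= u by rewrite mulr_ge0 // ltW.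
  have /andP[k1 k2] := truncn_itv u0; set k := Num.truncn u in k1 k2.
  have kN : (k < N)%N.
    rewrite -(ltr_nat R); apply: le_lt_trans k1 _; apply: le_lt_trans (truncnS_gt _).
    rewrite /u (bigD1 eta) //= lerDl sumr_ge0 // => e _.
    by rewrite mulr_ge0 // ltW.
  have -> : Z eta ^+ 2 / (8 * K) = u ^+ 2.
    by rewrite /u exprMn th2 real_normK ?num_real //; field; rewrite gt_eqF.
  rewrite (bigD1 (Ordinal kN)) //=.
  have pos (j : 'I_N) : 0 <= expR 1 * expR (- j%:R ^+ 2) *
     (expR (2 * j%:R * th * Z eta) + expR (- (2 * j%:R * th) * Z eta)).
    by rewrite mulr_ge0 ?addr_ge0 ?mulr_ge0 ?expR_ge0.
  apply: (@le_trans _ _ (expR 1 * expR (- k%:R ^+ 2) *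
     (expR (2 * k%:R * th * Z eta) + expR (- (2 * k%:R * th) * Z eta)))); last first.
    by rewrite lerDl sumr_ge0 // => j _; apply: pos.
  have ue : u ^+ 2 <= 1 - k%:R ^+ 2 + 2 * k%:R * u.
    move: k2; rewrite -natr1 => k2; have : (u - k%:R) ^+ 2 <= 1 by nra.
    by rewrite sqrrB; lra.
  apply: (@le_trans _ _ (expR (1 - k%:R ^+ 2 + 2 * k%:R * u))); first by rewrite ler_expR.
  rewrite !expRD ler_wpM2l ?mulr_ge0 ?expR_ge0 //.
  case: (lerP 0 (Z eta)) => z0.
    have -> : 2 * k%:R * u = 2 * k%:R * th * Z eta by rewrite /u ger0_norm //; ring.
    by rewrite lerDl expR_ge0.
  have -> : 2 * k%:R * u = - (2 * k%:R * th) * Z eta by rewrite /u ltr0_norm //; ring.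
  by rewrite lerDr expR_ge0.
rewrite expect_sum.
apply: (@le_trans _ _ (\sum_(k < N) 2 * expR 1 * expR (- (1 / 2)) ^+ k)).
  apply: ler_sum => k _; rewrite expectZ.
  have c0 : 0 <= expR 1 * expR (- k%:R ^+ 2) :> R by rewrite mulr_ge0 ?expR_ge0.
  apply: le_trans (ler_wpM2l c0 (term k)) _.
  have -> : expR 1 * expR (- k%:R ^+ 2) * (2 * expR (k%:R ^+ 2 / 2)) =
     2 * expR 1 * expR (- (k%:R ^+ 2 / 2)) :> R.
    have -> : - (k%:R ^+ 2 / 2) = - k%:R ^+ 2 + k%:R ^+ 2 / 2 :> R by field.
    by rewrite expRD; ring.
  rewrite ler_wpM2l ?mulr_ge0 ?expR_ge0 // -expRM_natl ler_expR.
  have : (k%:R : R) <= k%:R ^+ 2.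
    by rewrite -natrX ler_nat; case: (k : nat) => // m; rewrite expnS expn1 leq_pmulr.
  lra.
rewrite -mulr_sumr /sq_exp_cst; apply: ler_wpM2l; first by rewrite mulr_ge0 ?expR_ge0.
rewrite -[leRHS]div1r; apply: geometric_le.
by rewrite expR_ge0 exp_half_lt1.
Qed.

End Bernoulli.

(** * Sums of squares of variables living on windows *)

Section ColoredSquares.
Variables (R : realType) (T : finType) (rho : R).
Hypothesis rho01 : 0 < rho < 1.
Variables (I Cl : finType) (col : I -> Cl) (W : I -> pred T).
Variables (Z : I -> {ffun T -> bool} -> R) (K : R).
Hypothesis K_gt0 : 0 < K.
Hypothesis Z_mgf : forall i s,
  expect rho (fun eta => expR (s * Z i eta)) <= expR (K * s ^+ 2).
Hypothesis Z_indep : forall i x, ~~ W i x -> indep (Z i) x.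
Hypothesis W_disj : forall i j x, col i = col j -> i != j -> W i x -> ~~ W j x.

(** The entropy inequality applied to the sum of all squares would need the joint
    exponential moment of dependent variables. Within one colour class the variables
    are independent and the moment factorizes; the price is that the entropy is
    counted once per colour. *)
Lemma colored_squares_entropy (mu : {ffun T -> bool} -> R) : is_dist mu ->
  \sum_eta mu eta * (\sum_i Z i eta ^+ 2) <=
  8 * K * (#|Cl|%:R * entropy (@bern R T rho) mu + #|I|%:R * ln (sq_exp_cst R)).
Proof.
move=> dmu.
have C1 : 1 <= sq_exp_cst R by apply: sq_exp_cst_ge1.
have K8 : 0 < 8 * K by rewrite mulr_gt0.
pose cls c := [seq i <- enum I | col i == c].
have one c : \sum_eta mu eta * (\sum_(i <- cls c) Z i eta ^+ 2) <=
    8 * K * (entropy (@bern R T rho) mu + (size (cls c))%:R * ln (sq_exp_cst R)).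
  pose F i eta := expR (Z i eta ^+ 2 / (8 * K)).
  have e1 := @expect_prod_windows _ _ rho rho01 I (cls c) F W (sq_exp_cst R).
  have {}e1 : expect rho (fun eta => \prod_(i <- cls c) F i eta) <= sq_exp_cst R ^+ size (cls c).
    apply: e1.
    - by rewrite filter_uniq // enum_uniq.
    - by move=> i eta; apply: expR_ge0.
    - by move=> i x iW eta b; rewrite /F Z_indep.
    - move=> i j x; rewrite !mem_filter => /andP[/eqP ci _] /andP[/eqP cj _].
      by apply: W_disj; rewrite ci cj.
    - by move=> i; apply: expect_exp_sqr => // s; apply: Z_mgf.
  have := entropy_ineq (bern_gt0 rho01) (bern_sum1 T rho)
    (fun eta => \sum_(i <- cls c) Z i eta ^+ 2 / (8 * K)) dmu.
  have -> : \sum_eta bern rho eta * expR (\sum_(i <- cls c) Z i eta ^+ 2 / (8 * K)) =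
     expect rho (fun eta => \prod_(i <- cls c) F i eta).
    by apply: eq_bigr => eta _; rewrite expR_sum.
  have e2 : ln (expect rho (fun eta => \prod_(i <- cls c) F i eta)) <=
     (size (cls c))%:R * ln (sq_exp_cst R).
    rewrite mulr_natl -lnXn ?(lt_le_trans ltr01) //.
    rewrite ler_ln ?posrE ?exprn_gt0 ?(lt_le_trans ltr01) //.
    have lo : expect rho (fun _ : {ffun T -> bool} => 1) <=
        expect rho (fun eta => \prod_(i <- cls c) F i eta).
      apply: ler_expect => // eta; rewrite -expR_sum -[leLHS]expR0 ler_expR.
      by apply: sumr_ge0 => i _; rewrite divr_ge0 ?sqr_ge0 // ltW.
    by apply: le_trans lo; rewrite expect1.
  have -> : \sum_a mu a * (\sum_(i <- cls c) Z i a ^+ 2 / (8 * K)) =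
     (\sum_a mu a * (\sum_(i <- cls c) Z i a ^+ 2)) / (8 * K).
    by rewrite mulr_suml; apply: eq_bigr => a _; rewrite -mulr_suml mulrA.
  rewrite ler_pdivrMr // => /le_trans; apply.
  by rewrite [X in _ <= X]mulrC ler_wpM2r ?(ltW K8) // lerD2l.
have -> : \sum_eta mu eta * (\sum_i Z i eta ^+ 2) =
   \sum_c \sum_eta mu eta * (\sum_(i <- cls c) Z i eta ^+ 2).
  rewrite exchange_big /=; apply: eq_bigr => eta _; rewrite -mulr_sumr; congr (_ * _).
  under [RHS]eq_bigr do rewrite big_filter big_enum_cond /=.
  rewrite (partition_big col xpredT) //=.
apply: le_trans (ler_sum _ (fun c _ => one c)) _.
rewrite -mulr_sumr ler_wpM2l ?(ltW K8) // big_split /= sumr_const cardT -cardE.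
rewrite -[_ *+ #|Cl|]mulr_natl lerD2l -mulr_suml ler_wpM2r ?ln_ge0 //.
rewrite -natr_sum ler_nat.
have -> : (\sum_c size (cls c) = \sum_(i : I) 1)%N.
  rewrite (partition_big col xpredT) //=; apply: eq_bigr => c _.
  by rewrite -sum1_size /cls big_filter big_enum_cond.
by rewrite sum1_card.
Qed.

End ColoredSquares.

(** * Averages over boxes along the coordinate directions *)

Section Lattice.
Variables (d n : nat).
Implicit Types (z v : 'rV[int]_d) (x : torus d n).

Lemma siteD z v : site n (z + v) = site n z + site n v.
Proof. by apply/matrixP => i j; rewrite !mxE mulrzDr. Qed.

Lemma siteN z : site n (- z) = - site n z.
Proof. by apply/matrixP => i j; rewrite !mxE mulrNz. Qed.

Lemma siteB z v : site n (z - v) = site n z - site n v.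
Proof. by rewrite siteD siteN. Qed.

Lemma site0 : site n (0 : 'rV[int]_d) = 0.
Proof. by apply/matrixP => i j; rewrite !mxE mulr0z. Qed.

Lemma siteMn z i : site n (z *+ i) = site n z *+ i.
Proof. by elim: i => [|i IH]; rewrite ?site0 // !mulrS siteD IH. Qed.

Lemma Zp1_mulz_eq0 (k : int) : (Zp1 : 'I_n.+1) *~ k = 0 -> (n.+1 %| `|k|)%N.
Proof.
have nat_case m : (Zp1 : 'I_n.+1) *+ m = 0 -> (n.+1 %| m)%N.
  by rewrite Zp_mulrn => /(congr1 val) /=; rewrite modnMml mul1n => /eqP.
case: k => m; first by rewrite -pmulrn; apply: nat_case.
by rewrite NegzE mulrNz => /eqP; rewrite oppr_eq0 -pmulrn => /eqP /nat_case.
Qed.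

Lemma site_small_eq0 z : (forall j, `|z 0 j| < n.+1)%R -> site n z = 0 -> z = 0.
Proof.
move=> zn /matrixP sz; apply/matrixP => i j; rewrite ord1 mxE.
have := sz 0 j; rewrite !mxE => /Zp1_mulz_eq0 dv.
have := zn j; case: (posnP `|z 0%R j|%N) => [/eqP|z0 zj]; first by rewrite absz_eq0 => /eqP.
have := dvdn_leq z0 dv; lia.
Qed.

End Lattice.

(** Abel summation along one direction [u]: the difference between [G] and its
    average over [l] translates is a discrete derivative in direction [u], which is
    moved onto [c]. *)
Lemma abel_average (R : realFieldType) (T : finZmodType) (u : T) (l : nat) (G c : T -> R) :
  (0 < l)%N ->
  \sum_z G z * c z =
  \sum_z (\sum_(i < l) G (z - u *+ i) / l%:R) * c z +
  \sum_z (\sum_(i < l) (1 - i.+1%:R / l%:R) * G (z - u *+ i)) * (c z - c (z + u)).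
Proof.
move=> l0; have lR : l%:R != 0 :> R by rewrite pnatr_eq0 -lt0n.
pose h z := \sum_(i < l) (1 - i.+1%:R / l%:R) * G (z - u *+ i).
have -> : \sum_z h z * (c z - c (z + u)) = \sum_z (h z - h (z - u)) * c z.
  under eq_bigr do rewrite mulrBr; under [RHS]eq_bigr do rewrite mulrBl.
  rewrite !sumrB; congr (_ - _).
  rewrite [RHS](reindex_inj (addIr u)) /=; apply: eq_bigr => z _; by rewrite addrK.
rewrite -big_split /=; apply: eq_bigr => z _; rewrite -mulrDl; congr (_ * _).
pose g i := G (z - u *+ i).
have key m : \sum_(i < m) (1 - i.+1%:R / l%:R) * (g i - g i.+1) =
   g 0%N - \sum_(i < m) g i / l%:R - (1 - m%:R / l%:R) * g m.
  elim: m => [|m IH]; first by rewrite !big_ord0; ring.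
  by rewrite !big_ord_recr /= IH -natr1; ring.
have -> : h z - h (z - u) = \sum_(i < l) (1 - i.+1%:R / l%:R) * (g i - g i.+1).
  rewrite /h -sumrB; apply: eq_bigr => i _; rewrite mulrBr /g.
  by congr (_ - _ * G _); rewrite [u *+ i.+1]mulrS opprD addrA.
by rewrite key /g mulr0n subr0 divff // subrr mul0r subr0 addrC subrK.
Qed.

Section LinComb.
Variables (R : realFieldType) (d n : nat).
Implicit Types (s : seq (R * 'rV[int]_d)) (G c : torus d n -> R).

(** Translation-invariant linear combinations are lists of pairs (coefficient, offset),
    so that sums of coefficients, sums of their squares and ranges of offsets follow
    by induction on their construction. *)
Definition lincomb s G (z : torus d n) : R := \sum_(p <- s) p.1 * G (z - site n p.2).

Lemma lincombC s s' G z : lincomb s (lincomb s' G) z = lincomb s' (lincomb s G) z.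
Proof.
rewrite /lincomb; under eq_bigr do rewrite mulr_sumr.
rewrite exchange_big /=; apply: eq_bigr => p _; rewrite mulr_sumr.
apply: eq_bigr => q _; rewrite mulrCA; congr (_ * (_ * G _)).
by rewrite addrAC.
Qed.

Lemma lincomb_adj s G c : \sum_z lincomb s G z * c z =
  \sum_z G z * lincomb [seq (p.1, - p.2) | p <- s] c z.
Proof.
transitivity (\sum_(p <- s) \sum_z p.1 * G (z - site n p.2) * c z).
  by rewrite exchange_big /=; apply: eq_bigr => z _; rewrite mulr_suml.
transitivity (\sum_(p <- s) \sum_z G z * (p.1 * c (z - site n (- p.2)))).
  apply: eq_bigr => p _; rewrite (reindex_inj (addIr (site n p.2))) /=.
  by apply: eq_bigr => z _; rewrite addrK siteN opprK mulrA [_ * G z]mulrC.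
rewrite exchange_big /=; apply: eq_bigr => z _.
by rewrite /lincomb big_map mulr_sumr.
Qed.

(** Jensen's inequality: convolution with a probability is a contraction. *)
Lemma lincomb_contract s G : (forall p, p \in s -> 0 <= p.1) -> \sum_(p <- s) p.1 = 1 ->
  \sum_z lincomb s G z ^+ 2 <= \sum_z G z ^+ 2.
Proof.
move=> s0 s1.
apply: (@le_trans _ _ (\sum_z \sum_(p <- s) p.1 * G (z - site n p.2) ^+ 2)).
  apply: ler_sum => z _; rewrite /lincomb.
  have [m mE] : exists m, m = \sum_(p <- s) p.1 * G (z - site n p.2) by eexists.
  have : 0 <= \sum_(p <- s) p.1 * (G (z - site n p.2) - m) ^+ 2.
    rewrite big_seq; apply: sumr_ge0 => p ps; by rewrite mulr_ge0 ?sqr_ge0 // s0.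
  have -> : \sum_(p <- s) p.1 * (G (z - site n p.2) - m) ^+ 2 =
     \sum_(p <- s) p.1 * G (z - site n p.2) ^+ 2
     - 2 * m * (\sum_(p <- s) p.1 * G (z - site n p.2)) + m ^+ 2 * \sum_(p <- s) p.1.
    rewrite !mulr_sumr -sumrB -big_split /=; apply: eq_bigr => p _; ring.
  by rewrite s1 -mE; nra.
rewrite exchange_big /= -[X in _ <= X]mul1r -s1 mulr_suml; apply: ler_sum => p _.
rewrite -mulr_sumr (reindex_inj (addIr (site n p.2))) /=.
by under eq_bigr do rewrite addrK.
Qed.

Variable l : nat -> nat.

(** Directions are indexed by natural numbers, as the boxes are built by induction on
    the number of directions already averaged; [dir k] is zero for k >= d. *)
Definition dir (k : nat) : 'rV[int]_d := \row_j (j == k :> nat)%:R.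

Definition smear s k (w : nat -> R) : seq (R * 'rV[int]_d) :=
  [seq (p.1 * w i, p.2 + dir k *+ i) | p <- s, i <- iota 0 (l k)].

Definition avg_weight k (i : nat) : R := (l k)%:R^-1.
Definition shear_weight k (i : nat) : R := 1 - i.+1%:R / (l k)%:R.

(** [box k] is the uniform average over [0, l 0[ x .. x [0, l (k-1)[. The list
    [shear_box k] is the cofactor of the gradient in direction k when [box k] is
    averaged in this direction too, with the weights of [abel_average]. *)
Fixpoint box (k : nat) : seq (R * 'rV[int]_d) :=
  if k is k'.+1 then smear (box k') k' (avg_weight k') else [:: (1, 0)].

Definition shear_box k := smear (box k) k (shear_weight k).

Lemma lincomb_smear s k w G z : lincomb (smear s k w) G z =
  \sum_(i < l k) w i * lincomb s G (z - site n (dir k) *+ i).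
Proof.
rewrite /lincomb /smear big_allpairs_dep /= exchange_big /= -(big_mkord xpredT
  (fun i => w i * \sum_(p <- s) p.1 * G (z - site n (dir k) *+ i - site n p.2))).
rewrite /index_iota subn0; apply: eq_bigr => i _; rewrite mulr_sumr.
apply: eq_bigr => p _; rewrite mulrCA -mulrA; congr (_ * (_ * G _)).
by rewrite siteD siteMn opprD addrA addrAC.
Qed.

Lemma lincomb_step k s G c : (0 < l k)%N ->
  \sum_z lincomb s G z * c z = \sum_z lincomb (smear s k (avg_weight k)) G z * c z +
  \sum_z lincomb (smear s k (shear_weight k)) G z * (c z - c (z + site n (dir k))).
Proof.
move=> lk; rewrite (abel_average (site n (dir k)) _ _ lk); congr (_ + _).
  apply: eq_bigr => z _; rewrite lincomb_smear; congr (_ * _).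
  by apply: eq_bigr => i _; rewrite mulrC.
by apply: eq_bigr => z _; rewrite lincomb_smear.
Qed.

Definition lprod k : nat := \prod_(i < k) l i.

Hypothesis l_gt0 : forall k, (0 < l k)%N.

Lemma lprod_gt0 k : (0 < lprod k)%N.
Proof. by rewrite prodn_gt0. Qed.

Lemma smear_sum s k w : \sum_(p <- smear s k w) p.1 =
  (\sum_(p <- s) p.1) * \sum_(i < l k) w i.
Proof.
rewrite /smear big_allpairs_dep /= mulr_suml; apply: eq_bigr => p _.
by rewrite mulr_sumr -(big_mkord xpredT (fun i => p.1 * w i)) /index_iota subn0.
Qed.

Lemma smear_sqr_sum s k w : \sum_(p <- smear s k w) p.1 ^+ 2 =
  (\sum_(p <- s) p.1 ^+ 2) * \sum_(i < l k) w i ^+ 2.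
Proof.
rewrite /smear big_allpairs_dep /= mulr_suml; apply: eq_bigr => p _.
rewrite mulr_sumr -(big_mkord xpredT (fun i => p.1 ^+ 2 * w i ^+ 2)) /index_iota subn0.
by apply: eq_bigr => i _; rewrite exprMn.
Qed.

Lemma box_sum k : \sum_(p <- box k) p.1 = 1.
Proof.
elim: k => [|k IH] /=; first by rewrite big_seq1.
rewrite smear_sum IH mul1r /avg_weight sumr_const card_ord -[_ *+ l k]mulr_natl divff //.
by rewrite pnatr_eq0 -lt0n.
Qed.

Lemma box_ge0 k p : p \in box k -> 0 <= p.1.
Proof.
elim: k p => [|k IH] p /=; first by rewrite inE => /eqP -> /=.
by case/allpairsP => -[q i] /= [/IH q0 _ ->] /=; rewrite mulr_ge0 ?invr_ge0.
Qed.

Lemma box_sqr_sum k : \sum_(p <- box k) p.1 ^+ 2 = (lprod k)%:R^-1.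
Proof.
elim: k => [|k IH] /=.
  by rewrite big_seq1 expr1n /lprod big_ord0 invr1.
rewrite smear_sqr_sum IH /lprod big_ord_recr /= natrM invfM; congr (_ * _).
rewrite /avg_weight sumr_const card_ord -[_ *+ l k]mulr_natl.
by field; rewrite pnatr_eq0 -lt0n.
Qed.

(** These ratios determine the price of the replacement, hence the choice of the
    sides. *)
Lemma shear_box_sqr_sum k : \sum_(p <- shear_box k) p.1 ^+ 2 <= (l k)%:R / (lprod k)%:R.
Proof.
rewrite smear_sqr_sum box_sqr_sum [X in _ <= X]mulrC ler_wpM2l ?invr_ge0 //.
apply: (@le_trans _ _ (\sum_(i < l k) 1)); last by rewrite sumr_const card_ord.
apply: ler_sum => i _; rewrite /shear_weight.
have h : i.+1%:R / (l k)%:R <= 1 :> R.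
  by rewrite ler_pdivrMr ?ltr0n // mul1r ler_nat ltn_ord.
have h0 : 0 <= i.+1%:R / (l k)%:R :> R by rewrite divr_ge0.
by rewrite exprn_ile1 //; lra.
Qed.

Definition in_box s := forall p, p \in s -> forall j : 'I_d, 0 <= p.2 0 j < (l j)%:Z.

Lemma box_supp k p : p \in box k -> forall j : 'I_d,
  0 <= p.2 0 j < (if (j < k)%N then l j else 1%N)%:Z.
Proof.
elim: k p => [|k IH] p /=; first by rewrite inE => /eqP -> j /=; rewrite mxE.
case/allpairsP => -[q i] /= [/IH hq]; rewrite mem_iota add0n /= => ik -> j /=.
have := hq j; rewrite !mxE mulmxnE !mxE ltnS (leq_eqVlt j).
case: eqP => [->|_] /=; last by rewrite mul0rn addr0.
by rewrite ltnn; lia.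
Qed.

Lemma smear_supp k (w : nat -> R) p : p \in smear (box k) k w -> forall j : 'I_d,
  0 <= p.2 0 j < (if (j < k.+1)%N then l j else 1%N)%:Z.
Proof.
case/allpairsP => -[q i] /= [/box_supp hq]; rewrite mem_iota add0n /= => ik -> j /=.
have := hq j; rewrite !mxE mulmxnE !mxE ltnS (leq_eqVlt j).
case: eqP => [->|_] /=; last by rewrite mul0rn addr0.
by rewrite ltnn; lia.
Qed.

Lemma box_in_box k : in_box (box k).
Proof.
move=> p /box_supp hp j; have := hp j; have := l_gt0 j; case: ifP => _; lia.
Qed.

Lemma shear_in_box k : in_box (shear_box k).
Proof.
move=> p /smear_supp hp j; have := hp j; have := l_gt0 j; case: ifP => _; lia.
Qed.

(** Distinctness of the offsets: the box has no extent yet in direction k, so that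
    coordinate k of an offset recovers the number of steps. *)
Lemma smear_uniq k (w : nat -> R) : (k < d)%N -> uniq [seq p.2 | p <- box k] ->
  uniq [seq p.2 | p <- smear (box k) k w].
Proof.
move=> kd ub.
have -> : [seq p.2 | p <- smear (box k) k w] =
   [seq y + dir k *+ i | y <- [seq p.2 | p <- box k], i <- iota 0 (l k)].
  by rewrite /smear map_allpairs allpairs_mapl.
rewrite allpairs_uniq ?iota_uniq // => -[y i] [y' i'] /=.
case/allpairsP => -[y0 i0] /= [/mapP[p pb ->] _ [-> ->]].
case/allpairsP => -[y1 i1] /= [/mapP[p' pb' ->] _ [-> ->]] e.
have := box_supp pb (Ordinal kd); have := box_supp pb' (Ordinal kd).
have := congr1 (fun M : 'rV[int]_d => M 0 (Ordinal kd)) e.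
rewrite !mxE !mulmxnE !mxE /= eqxx ltnn => h1 h2 h3.
have ii : i0 = i1 by lia.
by move: e; rewrite ii => /addIr ->.
Qed.

Lemma box_uniq k : (k <= d)%N -> uniq [seq p.2 | p <- box k].
Proof.
elim: k => [//|k IH] kd; apply: smear_uniq => //; apply: IH; exact: ltnW.
Qed.

Lemma shear_box_uniq k : (k < d)%N -> uniq [seq p.2 | p <- shear_box k].
Proof. by move=> kd; apply: smear_uniq => //; apply: box_uniq; exact: ltnW. Qed.

End LinComb.

(** * Replacement by averages at the cost of the exchange Dirichlet form *)

Section Exchange.
Variables (R : realType) (d n : nat) (rho : R).
Hypothesis rho01 : 0 < rho < 1.
Implicit Types (eta : config d n) (x y z : torus d n) (g h : config d n -> R).

Let E (F : config d n -> R) : R := expect rho F.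

Lemma exchangeE eta x y u : exchange eta x y u = eta (tperm x y u).
Proof.
rewrite ffunE; case: tpermP => [->|->|/eqP ux /eqP uy]; rewrite ?eqxx //.
  by case: eqP => [->|].
by rewrite (negbTE ux) (negbTE uy).
Qed.

Lemma exchangeK x y : involutive (fun eta : config d n => exchange eta x y).
Proof. by move=> eta; apply/ffunP => u; rewrite !exchangeE tpermK. Qed.

Lemma bern_exchange eta x y : bern rho (exchange eta x y) = bern rho eta.
Proof.
rewrite /bern [RHS](reindex_inj (@perm_inj _ (tperm x y))) /=.
by apply: eq_bigr => u _; rewrite exchangeE.
Qed.

Lemma expect_exchange F x y : E (fun eta => F (exchange eta x y)) = E F.
Proof.
rewrite /E /expect [RHS](reindex_inj (inv_inj (exchangeK x y))) /=.
by apply: eq_bigr => eta _; rewrite bern_exchange.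
Qed.

(** The exchange s of x and y preserves the measure and the factor h, and changes the
    sign of the gradient D. Hence E [h D g^2] = E [h D (g^2 - (g o s)^2)] / 2; the
    difference of squares factors as (g - g o s) (g + g o s), and the weighted
    arithmetic-geometric inequality separates the two factors. *)
Lemma gradient_bound (beta : R) g h x y : 0 < beta ->
  (forall eta, h (exchange eta x y) = h eta) ->
  E (fun eta => h eta * (centered rho eta x - centered rho eta y) * g eta ^+ 2) <=
  beta / 4 * E (fun eta => (g (exchange eta x y) - g eta) ^+ 2) +
  beta^-1 * E (fun eta => h eta ^+ 2 * g eta ^+ 2).
Proof.
move=> b0 hs.
pose s eta := exchange eta x y.
pose D eta := centered rho eta x - centered rho eta y.
have Ds eta : D (s eta) = - D eta.
  by rewrite /D /centered /occ !exchangeE tpermL tpermR; ring.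
have e1 : E (fun eta => h eta * D eta * g eta ^+ 2) =
    E (fun eta => h eta * D eta * (g eta ^+ 2 - g (s eta) ^+ 2) / 2).
  have e : E (fun eta => h eta * D eta * g eta ^+ 2) =
     E (fun eta => - (h eta * D eta * g (s eta) ^+ 2)).
    rewrite -(expect_exchange _ x y); apply: eq_expect => eta.
    by rewrite hs -/(s eta) Ds; ring.
  have : E (fun eta => h eta * D eta * (g eta ^+ 2 - g (s eta) ^+ 2) / 2) =
     2^-1 * (E (fun eta => h eta * D eta * g eta ^+ 2) +
     E (fun eta => - (h eta * D eta * g (s eta) ^+ 2))).
    rewrite /E -expectD -expectZ; apply: eq_expect => eta; ring.
  by rewrite -e => ->; field.
rewrite [leLHS]e1.
have D1 eta : D eta ^+ 2 <= 1.
  by rewrite /D /centered /occ; case: (eta x); case: (eta y); rewrite /=; nra.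
apply: (@le_trans _ _ (E (fun eta => beta / 4 * (g (s eta) - g eta) ^+ 2 +
   beta^-1 * (h eta ^+ 2 * g eta ^+ 2 / 2 + h (s eta) ^+ 2 * g (s eta) ^+ 2 / 2)))).
  apply: ler_expect => // eta; rewrite hs.
  set a := g eta; set b := g (s eta); set H := h eta; set Q := D eta.
  have bi : beta * beta^-1 = 1 by rewrite divff // gt_eqF.
  have bi0 : 0 < beta^-1 by rewrite invr_gt0.
  have y1 : H * Q * (a ^+ 2 - b ^+ 2) / 2 <=
      beta / 4 * (b - a) ^+ 2 + beta^-1 / 4 * (H ^+ 2 * Q ^+ 2 * (a + b) ^+ 2).
    have := sqr_ge0 (beta * (a - b) - H * Q * (a + b)).
    move=> /(ler_wpM2l (ltW bi0)); rewrite mulr0.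
    have -> : beta^-1 * (beta * (a - b) - H * Q * (a + b)) ^+ 2 =
       (beta * beta^-1) * beta * (a - b) ^+ 2
       - (beta * beta^-1) * 2 * (a - b) * (H * Q * (a + b))
       + beta^-1 * (H ^+ 2 * Q ^+ 2 * (a + b) ^+ 2) by ring.
    rewrite bi; lra.
  have y2 : H ^+ 2 * Q ^+ 2 * (a + b) ^+ 2 <= H ^+ 2 * (2 * a ^+ 2 + 2 * b ^+ 2).
    rewrite -mulrA ler_wpM2l ?sqr_ge0 //.
    apply: (@le_trans _ _ ((a + b) ^+ 2)); first by rewrite ler_piMl ?sqr_ge0 // D1.
    have := sqr_ge0 (a - b); nra.
  have := ler_wpM2l (ltW bi0) y2; lra.
rewrite /E expectD !expectZ expectD lerD2l ler_wpM2l ?invr_ge0 ?(ltW b0) //.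
have -> : expect rho (fun eta => h (s eta) ^+ 2 * g (s eta) ^+ 2 / 2) =
   expect rho (fun eta => h eta ^+ 2 * g eta ^+ 2 / 2).
  exact: (expect_exchange (fun eta => h eta ^+ 2 * g eta ^+ 2 / 2) x y).
rewrite -expectD le_eqVlt; apply/orP; left; apply/eqP; apply: eq_expect => eta; by field.
Qed.

Definition dirichlet (k : nat) g : R := \sum_z
  E (fun eta => (g (exchange eta z (z + site n (dir d k))) - g eta) ^+ 2).

Variable l : nat -> nat.
Hypothesis l_gt0 : forall k, (0 < l k)%N.
Variables (beta : R) (beta_gt0 : 0 < beta).

(** Abel summation in each direction in turn, followed by [gradient_bound]: the hypothesis
    is the condition of that lemma on the cofactors of the gradients. *)
Lemma one_pass (G : config d n -> torus d n -> R) g :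
  (forall k z eta, (k < d)%N ->
     lincomb (shear_box R d l k) (G (exchange eta z (z + site n (dir d k)))) z =
     lincomb (shear_box R d l k) (G eta) z) ->
  E (fun eta => (\sum_z G eta z * centered rho eta z) * g eta ^+ 2) <=
  E (fun eta => (\sum_z lincomb (box R d l d) (G eta) z * centered rho eta z) * g eta ^+ 2)
  + beta / 4 * (\sum_(k < d) dirichlet k g)
  + beta^-1 * E (fun eta => (\sum_(k < d) \sum_z lincomb (shear_box R d l k) (G eta) z ^+ 2)
                            * g eta ^+ 2).
Proof.
move=> inv.
have key k : (k <= d)%N ->
  E (fun eta => (\sum_z G eta z * centered rho eta z) * g eta ^+ 2) <=
  E (fun eta => (\sum_z lincomb (box R d l k) (G eta) z * centered rho eta z) * g eta ^+ 2)
  + beta / 4 * (\sum_(i < k) dirichlet i g)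
  + beta^-1 * E (fun eta => (\sum_(i < k) \sum_z lincomb (shear_box R d l i) (G eta) z ^+ 2)
                            * g eta ^+ 2).
  elim: k => [_|k IH kd].
    rewrite big_ord0 mulr0 addr0.
    rewrite (_ : E (fun eta => (\sum_(i < 0) _) * _) = 0); last first.
      rewrite /E (@eq_expect _ _ _ _ (fun=> 0)) ?expect_cst // => eta.
      by rewrite big_ord0 mul0r.
    rewrite mulr0 addr0 le_eqVlt; apply/orP; left; apply/eqP.
    apply: eq_expect => eta; congr (_ * _); apply: eq_bigr => z _; congr (_ * _).
    by rewrite /lincomb /= big_seq1 mul1r site0 subr0.
  apply: le_trans (IH (ltnW kd)) _.
  rewrite !big_ord_recr /=.
  have -> : E (fun eta => (\sum_(i < k.+1) \sum_z lincomb (shear_box R d l i) (G eta) z ^+ 2)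
                            * g eta ^+ 2) =
    E (fun eta => (\sum_(i < k) \sum_z lincomb (shear_box R d l i) (G eta) z ^+ 2)
                            * g eta ^+ 2) +
    \sum_z E (fun eta => lincomb (shear_box R d l k) (G eta) z ^+ 2 * g eta ^+ 2).
    rewrite /E -expect_sum -expectD; apply: eq_expect => eta.
    by rewrite big_ord_recr /= mulrDl [X in _ + X]mulr_suml.
  have -> : E (fun eta => (\sum_z lincomb (box R d l k) (G eta) z * centered rho eta z)
       * g eta ^+ 2) =
    E (fun eta => (\sum_z lincomb (box R d l k.+1) (G eta) z * centered rho eta z) * g eta ^+ 2)
    + \sum_z E (fun eta => lincomb (shear_box R d l k) (G eta) z *
       (centered rho eta z - centered rho eta (z + site n (dir d k))) * g eta ^+ 2).
    rewrite /E -expect_sum -expectD; apply: eq_expect => eta.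
    by rewrite (lincomb_step (box R d l k) _ _ (l_gt0 k)) mulrDl [X in _ + X]mulr_suml.
  have st : \sum_z E (fun eta => lincomb (shear_box R d l k) (G eta) z *
       (centered rho eta z - centered rho eta (z + site n (dir d k))) * g eta ^+ 2) <=
     beta / 4 * dirichlet k g + beta^-1 *
     \sum_z E (fun eta => lincomb (shear_box R d l k) (G eta) z ^+ 2 * g eta ^+ 2).
    rewrite /dirichlet !mulr_sumr -big_split /=; apply: ler_sum => z _.
    by apply: gradient_bound => // eta; apply: inv.
  move: st; set a1 := \sum_z _; set a2 := \sum_z _; lra.
exact: key.
Qed.

Definition neg_box : seq (R * 'rV[int]_d) := [seq (p.1, - p.2) | p <- box R d l d].

(** The price of two passes, followed by the two squares that bound the remaining
    product of averages. *)
Definition remainder (G : config d n -> torus d n -> R) (eta : config d n) : R :=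
  2 / beta * (\sum_(k < d) \sum_z lincomb (shear_box R d l k) (G eta) z ^+ 2)
  + (\sum_z lincomb (box R d l d) (G eta) z ^+ 2) / 2
  + (\sum_z lincomb neg_box (centered rho eta) z ^+ 2) / 2.

(** After one pass only one of the two factors is averaged. A second pass averages this
    factor again, and the second average is then moved to the other factor by
    duality, so that the sum is controlled by squares of averages. The second
    pass costs no more than the first, as averaging is a contraction. *)
Lemma two_passes (G : config d n -> torus d n -> R) g :
  (forall k z eta, (k < d)%N ->
     lincomb (shear_box R d l k) (G (exchange eta z (z + site n (dir d k)))) z =
     lincomb (shear_box R d l k) (G eta) z) ->
  (forall k z eta, (k < d)%N ->
     lincomb (shear_box R d l k) (lincomb (box R d l d)
        (G (exchange eta z (z + site n (dir d k))))) z =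
     lincomb (shear_box R d l k) (lincomb (box R d l d) (G eta)) z) ->
  E (fun eta => (\sum_z G eta z * centered rho eta z) * g eta ^+ 2) <=
  beta / 2 * (\sum_(k < d) dirichlet k g) + E (fun eta => remainder G eta * g eta ^+ 2).
Proof.
move=> inv1 inv2.
have p1 := one_pass g inv1.
have p2 := @one_pass (fun eta => lincomb (box R d l d) (G eta)) g inv2.
have bi0 : 0 <= beta^-1 by rewrite invr_ge0 ltW.
have c1 : E (fun eta => (\sum_(k < d) \sum_z
     lincomb (shear_box R d l k) (lincomb (box R d l d) (G eta)) z ^+ 2) * g eta ^+ 2) <=
   E (fun eta => (\sum_(k < d) \sum_z lincomb (shear_box R d l k) (G eta) z ^+ 2)
                            * g eta ^+ 2).
  apply: ler_expect => // eta; rewrite ler_wpM2r ?sqr_ge0 //; apply: ler_sum => k _.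
  under eq_bigr do rewrite lincombC.
  by apply: lincomb_contract; [exact: box_ge0|exact: box_sum].
have c2 : E (fun eta => (\sum_z lincomb (box R d l d) (lincomb (box R d l d) (G eta)) z
     * centered rho eta z) * g eta ^+ 2) <=
   E (fun eta => ((\sum_z lincomb (box R d l d) (G eta) z ^+ 2) / 2
  + (\sum_z lincomb neg_box (centered rho eta) z ^+ 2) / 2) * g eta ^+ 2).
  apply: ler_expect => // eta; rewrite ler_wpM2r ?sqr_ge0 // lincomb_adj -/neg_box.
  rewrite !mulr_suml -big_split /=; apply: ler_sum => z _.
  set a := lincomb _ _ z; set b := lincomb _ _ z.
  have := sqr_ge0 (a - b); nra.
have -> : E (fun eta => remainder G eta * g eta ^+ 2) =
  2 * beta^-1 * E (fun eta => (\sum_(k < d) \sum_z lincomb (shear_box R d l k) (G eta) z ^+ 2)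
                            * g eta ^+ 2) +
  E (fun eta => ((\sum_z lincomb (box R d l d) (G eta) z ^+ 2) / 2
  + (\sum_z lincomb neg_box (centered rho eta) z ^+ 2) / 2) * g eta ^+ 2).
  rewrite /E -expectZ -expectD; apply: eq_expect => eta; rewrite /remainder; ring.
have := ler_wpM2l bi0 c1; lra.
Qed.

End Exchange.

(** * Local products: ordering and colouring *)

Lemma digits_bound (N : nat) (f : nat -> int) (m : nat) :
  (forall j, (j < m)%N -> `|f j| < N%:Z) ->
  `|\sum_(j < m) f j * N%:Z ^+ j| < N%:Z ^+ m.
Proof.
elim: m => [|m IH] Hf; first by rewrite big_ord0 normr0 expr0.
rewrite big_ord_recr /=.
have := IH (fun j jm => Hf j (ltnW jm)).
have := Hf m (ltnSn m); set S := \sum_(_ < _) _; set x := f m.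
have : 0 <= N%:Z ^+ m by rewrite exprn_ge0.
rewrite exprS; set y := N%:Z ^+ m => y0 xN Sy.
apply: le_lt_trans (ler_normD _ _) _.
rewrite normrM (ger0_norm y0).
have : `|x| * y <= (N%:Z - 1) * y by rewrite ler_wpM2r //; lia.
rewrite mulrBl mul1r; lia.
Qed.

Lemma digits_eq0 (N : nat) (f : nat -> int) (m : nat) :
  (forall j, (j < m)%N -> `|f j| < N%:Z) ->
  \sum_(j < m) f j * N%:Z ^+ j = 0 -> forall j, (j < m)%N -> f j = 0.
Proof.
elim: m => [//|m IH] Hf; rewrite big_ord_recr /= => S0.
have Sb := digits_bound (fun j jm => Hf j (ltnW jm)).
have fm : f m = 0.
  apply/eqP; rewrite -normr_eq0 eq_le normr_ge0 andbT -ltzD1 add0r.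
  have y0 : 0 < N%:Z ^+ m by apply: le_lt_trans Sb.
  rewrite -(ltr_pM2r y0) mul1r; apply: le_lt_trans Sb.
  have -> : \sum_(i < m) f i * N%:Z ^+ i = - (f m * N%:Z ^+ m).
    by apply/eqP; rewrite -addr_eq0 S0.
  by rewrite normrN normrM (ger0_norm (ltW y0)).
move: S0; rewrite fm mul0r addr0 => S0 j; rewrite ltnS leq_eqVlt => /predU1P[->//|jm].
exact: (IH (fun j jm => Hf j (ltnW jm)) S0).
Qed.

Lemma seq_argmax (T : eqType) (f : T -> int) (s : seq T) : s != [::] ->
  exists2 x, x \in s & forall y, y \in s -> f y <= f x.
Proof.
elim: s => [//|x s IH] _; case: (eqVneq s [::]) => [->|/IH [y ys Hy]].
  by exists x; rewrite ?mem_head // => y; rewrite inE => /eqP ->.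
case: (lerP (f y) (f x)) => fxy.
  exists x; rewrite ?mem_head // => w; rewrite inE => /predU1P[->//|/Hy h].
  exact: le_trans h fxy.
exists y; first by rewrite inE ys orbT.
by move=> w; rewrite inE => /predU1P[->|/Hy//]; exact: ltW.
Qed.

(** A colouring of the cycle of length [N] with 2L colours in which points of equal colour
    are at distance at least [L] around the cycle. Period [L] does this up to the last
    multiple of [L]; the points beyond it receive colours of their own. *)
Definition color (N L i : nat) : nat :=
  if (i < N %/ L * L)%N then (i %% L)%N else (L + i %% L)%N.

Lemma color_lt N L i : (0 < L)%N -> (color N L i < 2 * L)%N.
Proof. by move=> L0; rewrite /color; have := ltn_pmod i L0; case: ifP => _; lia. Qed.

Lemma color_sep N L i i' : (0 < L)%N -> (i < N)%N -> (i' < N)%N -> (i < i')%N ->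
  color N L i = color N L i' -> (L <= i' - i)%N /\ (i' - i + L <= N)%N.
Proof.
move=> L0 iN i'N ii'; rewrite /color.
have e := divn_eq i L; have e' := divn_eq i' L; have eN := divn_eq N L.
have mi := ltn_pmod i L0; have mi' := ltn_pmod i' L0; have mN := ltn_pmod N L0.
move: e e' eN mi mi' mN.
set a := (i %/ L)%N; set b := (i %% L)%N; set a' := (i' %/ L)%N; set b' := (i' %% L)%N.
set q := (N %/ L)%N; set r := (N %% L)%N => e e' eN mi mi' mN.
case: ifP => c1; case: ifP => c2 bb.
- have aa : (a < a')%N by nia.
  have a'q : (a' < q)%N by nia.
  split; nia.
- lia.
- lia.
- have aq : (q <= a)%N by nia.
  have a'q : (a' <= q)%N by nia.
  nia.
Qed.

(** A common site of the windows of two points of equal colour would give, in some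
    coordinate, i <> i' and an offset [w] shorter than [L] with i - i' + w = 0 mod N. *)
Lemma color_clash (N L i i' : nat) (w D : int) : D = i%:Z - i'%:Z + w -> (0 < L)%N -> (L < N)%N ->
  (i < N)%N -> (i' < N)%N -> i <> i' -> color N L i = color N L i' ->
  `|w| < L%:Z -> (N %| `|D|)%N -> False.
Proof.
move=> DE L0 LN iN i'N ii cc wL.
have small (k : nat) : (N %| k)%N -> (k < 2 * N)%N -> k = 0%N \/ k = N.
  by move=> /dvdnP[[|[|m]] ->]; [left|right; rewrite mul1n|nia].
move=> dv; have kb : (`|D| < 2 * N)%N by lia.
have c12 := small _ dv kb.
case: (ltngtP i i') => [lt1|lt1|//].
  have [s1 s2] := color_sep L0 iN i'N lt1 cc; lia.
have [s1 s2] := color_sep L0 i'N iN lt1 (esym cc); lia.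
Qed.

Lemma order_squeeze (x y u w : int) : x - y = u - w -> x <= u -> w <= y -> y - w = 0.
Proof. lia. Qed.

Lemma window_dist (N m k : nat) (a a' p q : int) : `|a| <= k%:Z -> `|a'| <= k%:Z ->
  `|p| <= m%:Z -> `|q| <= m%:Z -> (2 * (m + k) + 1 < N)%N ->
  `|a - p - (a' - q)| < N%:Z.
Proof. lia. Qed.

Lemma window_diff (m k : nat) (a p : int) : `|a| <= k%:Z -> `|p| <= m%:Z ->
  `|a - p| <= (m + k)%:Z.
Proof. lia. Qed.

Lemma window_double (m : nat) (x : int) : x <= (m + m)%:Z -> x < (2 * m + 1)%:Z.
Proof. lia. Qed.

Section LocalProducts.
Variables (R : realType) (d n : nat) (rho : R).
Hypothesis rho01 : 0 < rho < 1.
Implicit Types (eta : config d n) (x z : torus d n) (v y : 'rV[int]_d).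

Definition local_prod (phi : torus d n -> R) (A : seq 'rV[int]_d) eta z : R :=
  phi z * \prod_(a <- A) centered rho eta (site n a + z).

Variables (l : nat -> nat) (r : nat).
Hypothesis l_gt0 : forall k, (0 < l k)%N.
Hypothesis fits : forall j : 'I_d, (2 * (l j + r) + 1 < n.+1)%N.

(* offsets are read as numbers in base n.+1: lf is injective on short vectors *)
Let lf v : int := \sum_(j < d) v 0 j * n.+1%:Z ^+ j.

Let lfB v y : lf (v - y) = lf v - lf y.
Proof. by rewrite /lf -sumrB; apply: eq_bigr => j _; rewrite !mxE mulrBl. Qed.

Let lf_eq0 v : (forall j, `|v 0 j| < n.+1%:Z) -> lf v = 0 -> v = 0.
Proof.
move=> vn v0; apply/rowP => j; rewrite mxE.
pose f k : int := if insub k is Some i then v 0 i else 0.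
have fE (i : 'I_d) : f i = v 0 i by rewrite /f valK.
rewrite -fE; apply: (@digits_eq0 n.+1 f d); last exact: ltn_ord.
  by move=> k kd; rewrite (fE (Ordinal kd)).
by transitivity (lf v) => //; apply: eq_bigr => i _; rewrite fE.
Qed.

Lemma cen_indep x w : x != w -> indep (fun eta => centered rho eta x) w.
Proof. by move=> /negbTE xw eta b; rewrite /centered /occ ffunE xw. Qed.

Lemma cen_norm eta x : `|centered rho eta x| <= 1.
Proof.
have [r0 r1] := andP rho01.
rewrite /centered /occ; case: (eta x); apply/ler_normlP; rewrite /=; split; lra.
Qed.

Section Mgf.
Variables (phi : torus d n -> R) (A : seq 'rV[int]_d) (B : R).
Hypothesis phi_bound : forall z, `|phi z| <= B.
Hypothesis A_uniq : uniq A.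
Hypothesis A_neq0 : A != [::].
Hypothesis A_bound : forall a, a \in A -> forall j, `|a 0 j| <= r%:Z.
Variable s : seq (R * 'rV[int]_d).
Hypothesis s_uniq : uniq [seq p.2 | p <- s].
Hypothesis s_bound : forall p, p \in s -> forall j : 'I_d, `|p.2 0 j| <= (l j)%:Z.

(** The translates of a local product overlap, but they form a triangular family. A linear
    functional lf with rapidly increasing coefficients orders the offsets totally; the
    pivot of a translate is its site with the largest value of lf, and the
    translates are listed so that the values of the pivots decrease. A translate then
    contains no pivot of the translates before it. *)
Lemma lincomb_mgf z t :
  expect rho (fun eta => expR (t * lincomb s (local_prod phi A eta) z)) <=
  expR (2 * B ^+ 2 * (\sum_(p <- s) p.1 ^+ 2) * t ^+ 2).
Proof.
have [a0 a0A a0max] := seq_argmax lf A_neq0.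
pose X (p : R * 'rV[int]_d) eta := t * (p.1 * local_prod phi A eta (z - site n p.2)).
pose Y (p : R * 'rV[int]_d) eta := t * p.1 * phi (z - site n p.2) *
   \prod_(a <- rem a0 A) centered rho eta (site n a + (z - site n p.2)).
pose u (p : R * 'rV[int]_d) := site n a0 + (z - site n p.2).
have XE p eta : X p eta = ((eta (u p))%:R - rho) * Y p eta.
  rewrite /X /Y /local_prod (big_rem a0) //= -/(u p) /centered /occ; ring.
(* the torus is large enough for equalities between sites to hold in Z^d *)
have sep a a' p q : a \in A -> a' \in A -> p \in s -> q \in s ->
    site n a + (z - site n p.2) = site n a' + (z - site n q.2) -> a - p.2 = a' - q.2.
  move=> aA a'A ps qs e; apply/eqP; rewrite -subr_eq0; apply/eqP.
  apply: (@site_small_eq0 d n).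
    move=> j; rewrite !mxE; apply: (window_dist (A_bound aA j) (A_bound a'A j)
      (s_bound ps j) (s_bound qs j)); exact: fits.
  have : site n (a - p.2) + z = site n (a' - q.2) + z.
    by move: e; rewrite !siteB !addrA [_ + z]addrAC [RHS in _ = RHS -> _]addrAC.
  by move/addIr => e'; rewrite siteB e' subrr.
have Yi p : p \in s -> indep (Y p) (u p).
  move=> ps eta b; congr (_ * _); apply: eq_big_seq => a; rewrite mem_rem_uniq // inE.
  move=> /andP[aa0 aA]; apply: cen_indep; apply: contraNneq aa0 => e.
  by have := sep _ _ _ _ aA a0A ps ps e; move/addIr => ->.
have Yb p eta : `|Y p eta| <= `|t * p.1| * B.
  rewrite /Y normrM -[leRHS]mulr1; apply: ler_pM => //.
    by rewrite normrM ler_wpM2l.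
  rewrite normr_prod.
  suff /andP[_ ->] : 0 <= \prod_(a <- rem a0 A)
      `|centered rho eta (site n a + (z - site n p.2))| <= 1 by [].
  elim/big_ind: _ => [|x y /andP[x0 x1] /andP[y0 y1]|a _]; first by rewrite ler01 lexx.
    by rewrite mulr_ge0 // mulr_ile1.
  by rewrite normr_ge0 cen_norm.
pose le_ (p q : R * 'rV[int]_d) := lf p.2 <= lf q.2.
pose s' := sort le_ s.
have ps' : perm_eq s' s by rewrite perm_sort.
have mems' p : (p \in s') = (p \in s) by apply: perm_mem.
have us' : uniq [seq p.2 | p <- s'] by rewrite (perm_uniq (perm_map _ ps')).
have tot : total le_ by move=> p q; apply: le_total.
have trs : transitive le_ by move=> p q w; apply: le_trans.
have so : sorted le_ s' by apply: sort_sorted.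
(* Y is independent of the pivot only for p in s, so X and Y are cut off outside s *)
pose X1 p eta := if p \in s then X p eta else 0.
pose Y1 p eta := if p \in s then Y p eta else 0.
have X1E p eta : X1 p eta = ((eta (u p))%:R - rho) * Y1 p eta.
  by rewrite /X1 /Y1; case: ifP => _; rewrite ?mulr0.
have Y1i p : indep (Y1 p) (u p).
  by move=> eta b; rewrite /Y1; case: ifP => // ps; apply: Yi.
have Y1b p eta : `|Y1 p eta| <= `|t * p.1| * B.
  rewrite /Y1; case: ifP => _ //; rewrite normr0 mulr_ge0 //.
  exact: le_trans (normr_ge0 _) (phi_bound 0).
have tri (w : seq (R * 'rV[int]_d)) : {subset w <= s} -> uniq [seq p.2 | p <- w] -> sorted le_ w ->
    triangular X1 u w.
  elim: w => [//|p w IH] sub /= /andP[pw uw] pa; split; last first.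
    apply: IH => //; last exact: path_sorted pa.
    by move=> q qw; apply: sub; rewrite inE qw orbT.
  move=> q qw; have qs : q \in s by apply: sub; rewrite inE qw orbT.
  have ps : p \in s by apply: sub; rewrite mem_head.
  have pq : le_ p q by apply: (allP (order_path_min trs pa)).
  have npq : q.2 != p.2 by apply: contraNneq pw => <-; apply: map_f.
  move=> eta b; rewrite /X1 qs /X /local_prod; congr (_ * (_ * (_ * _))).
  apply: eq_big_seq => a aA; apply: cen_indep; apply: contraNneq npq => e.
  have e1 := sep _ _ _ _ aA a0A qs ps e.
  have e2 : lf a - lf q.2 = lf a0 - lf p.2 by rewrite -!lfB e1.
  have e3 := a0max _ aA.
  have e4 : lf (q.2 - p.2) = 0 by rewrite lfB; apply: order_squeeze e2 e3 pq.
  rewrite -subr_eq0; apply/eqP; apply: lf_eq0 => // j; rewrite !mxE.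
  have z0 : `|0 : int| <= r%:Z by rewrite normr0.
  have := window_dist z0 z0 (s_bound ps j) (s_bound qs j) (fits j).
  by rewrite !sub0r opprK addrC.
have sub' : {subset s' <= s} by move=> p; rewrite mems'.
have {tri} m := triangular_mgf rho01 X1E Y1i Y1b (tri s' sub' us' so).
have -> : 2 * B ^+ 2 * (\sum_(p <- s) p.1 ^+ 2) * t ^+ 2 =
   2 * \sum_(p <- s') (`|t * p.1| * B) ^+ 2.
  rewrite (perm_big _ ps') /= -mulrA -mulrA; congr (_ * _).
  rewrite mulr_suml mulr_sumr; apply: eq_bigr => p _.
  by rewrite exprMn real_normK ?num_real //; ring.
apply: le_trans m; rewrite le_eqVlt; apply/orP; left; apply/eqP.
apply: eq_expect => eta; congr expR; rewrite (perm_big _ ps') /= /lincomb mulr_sumr.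
by apply: eq_big_seq => p ps; rewrite /X1 ps.
Qed.

Definition num_colors : nat := \prod_(j < d) (2 * (2 * (l j + r) + 1)).

(** The combination at z depends on a window around z of sides 2 (l j + r) + 1 at most;
    colouring each coordinate by [color] makes windows of equal colour disjoint. *)
Lemma window_squares (sg : R) (mu : config d n -> R) : 0 < sg -> 0 < B ->
  \sum_(p <- s) p.1 ^+ 2 <= sg -> is_dist mu ->
  \sum_eta mu eta * (\sum_z lincomb s (local_prod phi A eta) z ^+ 2) <=
  16 * B ^+ 2 * sg * (num_colors%:R * entropy (@bern R (torus d n) rho) mu
     + (n.+1 ^ d)%:R * ln (sq_exp_cst R)).
Proof.
move=> sg0 B0 ssg dmu.
pose L (j : 'I_d) := (2 * (l j + r) + 1)%N.
have L0 j : (0 < L j)%N by rewrite /L addn1.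
pose Cl := {dffun forall j : 'I_d, 'I_(2 * L j)}.
pose col (z : torus d n) : Cl :=
  [ffun j => Ordinal (color_lt n.+1 (z 0 j) (L0 j))] : Cl.
pose W (z : torus d n) : pred (torus d n) := fun x =>
  `[< exists2 v : 'rV[int]_d, (forall j : 'I_d, `|v 0 j| <= (l j + r)%:Z) & x = z + site n v >].
pose K := 2 * B ^+ 2 * sg.
have K0 : 0 < K by rewrite !mulr_gt0 ?exprn_gt0.
have cardCl : #|Cl| = num_colors.
  rewrite card_dep_ffun /num_colors foldrE big_map /=.
  rewrite big_enum /=; by apply: eq_bigr => j _; rewrite card_ord.
have cardT : #|torus d n| = (n.+1 ^ d)%N by rewrite card_mx card_ord mul1n.
have := @colored_squares_entropy R (torus d n) rho rho01 (torus d n) Cl col W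
  (fun z eta => lincomb s (local_prod phi A eta) z) K K0 _ _ _ mu dmu.
rewrite cardCl cardT.
have -> : 8 * K = 16 * B ^+ 2 * sg by rewrite /K; ring.
apply.
- move=> z t; apply: le_trans (lincomb_mgf z t) _; rewrite ler_expR ler_wpM2r ?sqr_ge0 //.
  by rewrite /K ler_wpM2l // mulr_ge0 ?sqr_ge0.
- move=> z x /asboolPn xW eta b; rewrite /lincomb; apply: eq_big_seq => p ps.
  congr (_ * (_ * _)); apply: eq_big_seq => a aA; apply: cen_indep.
  apply/eqP => e; apply: xW; exists (a - p.2).
    by move=> j; rewrite !mxE; apply: window_diff; [exact: A_bound|exact: s_bound].
  by rewrite -e siteB addrCA.
move=> z z' x cz zz' /asboolP[v vb xv]; apply/asboolPn => -[v' vb' xv'].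
have [j zj] : exists j, z 0 j != z' 0 j.
  apply/existsP; rewrite -negb_forall; apply: contraNN zz' => /forallP h.
  by apply/eqP/rowP => j; apply/eqP.
have cj : color n.+1 (L j) (z 0 j) = color n.+1 (L j) (z' 0 j).
  by have := congr1 (fun c : Cl => val (c j)) cz; rewrite !ffunE.
pose w : int := v 0 j - v' 0 j.
have wb : `|w| < (L j)%:Z.
  exact: window_double (window_diff (vb j) (vb' j)).
pose i := nat_of_ord (z 0 j).
pose i' := nat_of_ord (z' 0 j).
pose D : int := i%:Z - i'%:Z + w.
have dv : (n.+1 %| `|D|)%N.
  apply: Zp1_mulz_eq0.
  have e : z 0 j + Zp1 *~ v 0 j = z' 0 j + Zp1 *~ v' 0 j.
    have := congr1 (fun M : torus d n => M 0 j) (etrans (esym xv) xv').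
    by rewrite !mxE.
  have nE (k : 'I_n.+1) : (Zp1 : 'I_n.+1) *~ (nat_of_ord k)%:Z = k.
    rewrite -pmulrn Zp_mulrn; apply: val_inj; rewrite /= modnMml mul1n.
    by rewrite modn_small.
  rewrite /D mulrzDr mulrzBr !nE /w mulrzBr; apply/eqP.
  rewrite addrACA -opprD subr_eq0; apply/eqP; exact: e.
have nz : i <> i' by move=> h; case/negP: zj; apply/eqP/val_inj.
have lj : (L j < n.+1)%N by have := fits j; rewrite /L.
exact: (color_clash (erefl D) (L0 j) lj (ltn_ord _) (ltn_ord _) nz cj wb dv).
Qed.

End Mgf.

End LocalProducts.

(** * The replacement remainder and its mean *)

Lemma entropy_ge0 (R : realType) (S : finType) (nu mu : S -> R) :
  (forall a, 0 < nu a) -> \sum_a nu a = 1 -> is_dist mu -> 0 <= entropy nu mu.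
Proof.
move=> nu0 nu1 dmu; have := entropy_ineq nu0 nu1 (fun=> 0) dmu.
rewrite big1 => [|a _]; last by rewrite mulr0.
by under eq_bigr do rewrite expR0 mulr1; rewrite nu1 ln1 addr0.
Qed.

Lemma behind_arith (m r N : nat) (a y : int) (b : nat) : (b <= 1)%N ->
  - r%:Z <= a <= 0 -> 0 <= y <= (2 * m)%:Z -> (2 * (m + r) + 1 < N)%N ->
  `|a - y - b%:Z| < N%:Z.
Proof. lia. Qed.

Lemma box_abs (m : nat) (x : int) : 0 <= x < m%:Z -> `|x| <= m%:Z.
Proof. lia. Qed.

Lemma behind_abs (m : nat) (x : int) : - m%:Z <= x <= 0 -> `|x| <= m%:Z.
Proof. lia. Qed.

Lemma box_double (m : nat) (x y : int) : 0 <= x < m%:Z -> 0 <= y < m%:Z ->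
  0 <= x + y <= (2 * m)%:Z.
Proof. lia. Qed.

Lemma box_single (m : nat) (x : int) : 0 <= x < m%:Z -> 0 <= x <= (2 * m)%:Z.
Proof. lia. Qed.

Section Replacement.
Variables (R : realType) (d n : nat) (rho : R).
Implicit Types (eta : config d n) (z : torus d n) (g : config d n -> R).
Variables (l : nat -> nat) (r : nat).
Hypothesis l_gt0 : forall k, (0 < l k)%N.
Hypothesis fits : forall j : 'I_d, (2 * (l j + r) + 1 < n.+1)%N.

Section Behind.
Variables (phi : torus d n -> R) (A : seq 'rV[int]_d).
(* z - y + A stays behind z for y >= 0, so that averaging in the positive directions keeps
   the local products away from the bond between z and a neighbour ahead of it *)
Hypothesis A_behind : forall a, a \in A -> a != 0 /\ forall j, - r%:Z <= a 0 j <= 0.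

Let behind (y : 'rV[int]_d) a k (b : nat) : a \in A -> (k < d)%N -> (b <= 1)%N ->
  (forall j : 'I_d, 0 <= y 0 j <= (2 * l j)%:Z) ->
  site n (a - y) <> site n (dir d k *+ b).
Proof.
move=> aA kd b1 yb e; have [a0 ab] := A_behind aA.
have v0 : a - y - dir d k *+ b = 0.
  apply: (@site_small_eq0 d n); last by rewrite siteB e subrr.
  move=> j; rewrite !mxE mulmxnE mxE.
  have -> : (j == k :> nat)%:R *+ b = ((j == k :> nat) * b)%:Z :> int.
    by rewrite -mulrnA natz.
  by apply: behind_arith (fits j); [case: eqP; rewrite ?mul1n|exact: ab|exact: yb].
have c j : a 0 j - y 0 j = ((j == k :> nat) * b)%:Z.
  have := congr1 (fun M : 'rV[int]_d => M 0 j) v0; rewrite !mxE mulmxnE mxE.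
  by rewrite -mulrnA natz => /eqP; rewrite subr_eq0 => /eqP.
case/negP: a0; apply/eqP/rowP => j; rewrite mxE.
have /andP[_ aj] := ab j; have /andP[yj _] := yb j.
have := c j; move: aj yj; move: (a 0 j) (y 0 j) (_ * b)%N => p q w; lia.
Qed.

Lemma local_prod_exchange (y : 'rV[int]_d) k z eta : (k < d)%N ->
  (forall j : 'I_d, 0 <= y 0 j <= (2 * l j)%:Z) ->
  local_prod rho phi A (exchange eta z (z + site n (dir d k))) (z - site n y) =
  local_prod rho phi A eta (z - site n y).
Proof.
move=> kd yb; congr (_ * _); apply: eq_big_seq => a aA.
rewrite /centered /occ ffunE addrCA -siteB.
case: eqP => [/eqP|_].
  rewrite -subr_eq0 addrAC subrr add0r => /eqP e.
  by case: (behind aA kd (leq0n 1) yb); rewrite mulr0n site0.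
case: eqP => [/addrI e|//].
by case: (behind aA kd (leqnn 1) yb); rewrite mulr1n.
Qed.

End Behind.

Hypothesis rho01 : 0 < rho < 1.

(** The first term counts colours per unit of volume, the second is the logarithm
    of the exponential moment of each window. *)
Definition color_cst : R := (2 * (2 * r + 3))%:R ^+ d + ln (sq_exp_cst R).

Let ln_cst_ge0 : 0 <= ln (sq_exp_cst R).
Proof. by rewrite ln_ge0 // sq_exp_cst_ge1. Qed.

Lemma color_cst_gt0 : 0 < color_cst.
Proof. by rewrite /color_cst ltr_pwDl // exprn_gt0 // ltr0n; lia. Qed.

Lemma num_colors_le : (num_colors d l r)%:R <= (2 * (2 * r + 3))%:R ^+ d * (lprod l d)%:R :> R.
Proof.
rewrite -natrX -natrM ler_nat /num_colors /lprod.
have -> : ((2 * (2 * r + 3)) ^ d = \prod_(j < d) (2 * (2 * r + 3)))%N.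
  by rewrite big_const_ord iter_muln_1.
rewrite -big_split /=; apply: leq_prod => j _.
have := l_gt0 j; nia.
Qed.

Let m : R := (lprod l d)%:R.
Let gap : R := n.+1%:R ^+ d / m.

Let m_gt0 : 0 < m.
Proof. by rewrite ltr0n lprod_gt0. Qed.

(** The number of colours is of order m and there are N^d windows: the entropy is counted
    m times and the windows contribute N^d = m (N^d / m). *)
Lemma squares_entropy phi (A : seq 'rV[int]_d) B (s : seq (R * 'rV[int]_d)) sg mu :
  (forall z, `|phi z| <= B) -> 0 < B -> uniq A -> A != [::] ->
  (forall a, a \in A -> forall j, `|a 0 j| <= r%:Z) ->
  uniq [seq p.2 | p <- s] ->
  (forall p, p \in s -> forall j : 'I_d, `|p.2 0 j| <= (l j)%:Z) ->
  0 < sg -> \sum_(p <- s) p.1 ^+ 2 <= sg -> is_dist mu ->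
  \sum_eta mu eta * (\sum_z lincomb s (local_prod rho phi A eta) z ^+ 2) <=
  16 * B ^+ 2 * (sg * m) * color_cst * (entropy (@bern R (torus d n) rho) mu + gap).
Proof.
move=> pb B0 uA A0 Ab us sb sg0 ssg dmu.
apply: le_trans (window_squares rho01 fits pb uA A0 Ab us sb sg0 B0 ssg dmu) _.
have H0 : 0 <= entropy (@bern R (torus d n) rho) mu.
  by apply: entropy_ge0 dmu; [exact: bern_gt0|exact: bern_sum1].
set H := entropy _ _ in H0 *.
have gap0 : 0 <= gap by rewrite /gap divr_ge0 ?exprn_ge0 ?(ltW m_gt0).
have -> : 16 * B ^+ 2 * (sg * m) * color_cst * (H + gap) =
  16 * B ^+ 2 * sg * (m * color_cst * (H + gap)) by ring.
apply: ler_wpM2l; first by rewrite !mulr_ge0 ?sqr_ge0 // ltW.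
have nc := ler_wpM2r H0 num_colors_le.
have e1 : (n.+1 ^ d)%:R = m * gap by rewrite natrX /gap; field; rewrite gt_eqF.
rewrite e1 /color_cst; set C := (_ ^+ d) in nc *; set q := ln _.
have C0 : 0 <= C by rewrite exprn_ge0.
have q0 : 0 <= q by exact: ln_cst_ge0.
have -> : m * (C + q) * (H + gap) = C * m * H + m * gap * q + (m * (C * gap) + m * (q * H)) by ring.
apply: le_trans (lerD nc (lexx _)) _.
rewrite lerDl; apply: addr_ge0; apply: mulr_ge0; rewrite ?(ltW m_gt0) //; exact: mulr_ge0.
Qed.

Variable eps : R.
Hypothesis eps_gt0 : 0 < eps.

Let beta : R := 2 * eps * n.+1%:R ^+ 2.

Let beta_gt0 : 0 < beta.
Proof. by rewrite !mulr_gt0 ?exprn_gt0. Qed.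

Definition local_remainder phi A : config d n -> R :=
  remainder rho l (2 * eps * n.+1%:R ^+ 2) (local_prod rho phi A).

Lemma local_remainder_ge0 phi A eta : 0 <= local_remainder phi A eta.
Proof.
rewrite /local_remainder /remainder -/beta !addr_ge0 //.
- rewrite mulr_ge0 ?divr_ge0 ?(ltW beta_gt0) //.
  by do 2!apply: sumr_ge0 => ? _; rewrite sqr_ge0.
- by rewrite divr_ge0 //; apply: sumr_ge0 => ? _; rewrite sqr_ge0.
- by rewrite divr_ge0 //; apply: sumr_ge0 => ? _; rewrite sqr_ge0.
Qed.

Section OneFamily.
Variables (phi : torus d n -> R) (A : seq 'rV[int]_d).
Hypothesis A_behind : forall a, a \in A -> a != 0 /\ forall j, - r%:Z <= a 0 j <= 0.

(** The parameter 2 eps N^2 in the remainder is the one for which the replacement consumes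
    eps N^2 times the Dirichlet form. *)
Lemma local_form_bound g :
  expect rho (fun eta => (\sum_z local_prod rho phi A eta z * centered rho eta z) * g eta ^+ 2)
  <= eps * n.+1%:R ^+ 2 * (\sum_(k < d) dirichlet rho k g)
     + expect rho (fun eta => local_remainder phi A eta * g eta ^+ 2).
Proof.
have -> : eps * n.+1%:R ^+ 2 = beta / 2 by rewrite /beta; field.
apply: two_passes => // k z eta kd; rewrite /lincomb; apply: eq_big_seq => p ps.
  congr (_ * _); apply: local_prod_exchange => // j.
  exact: box_single (shear_in_box l_gt0 ps j).
congr (_ * _); apply: eq_big_seq => p' ps'; congr (_ * _).
have -> : z - site n p.2 - site n p'.2 = z - site n (p.2 + p'.2).
  by rewrite siteD opprD addrA.
apply: local_prod_exchange => // j; rewrite mxE.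
exact: box_double (shear_in_box l_gt0 ps j) (box_in_box l_gt0 ps' j).
Qed.

Variable B : R.
Hypothesis phi_bound : forall z, `|phi z| <= B.
Hypothesis B_gt0 : 0 < B.
Hypothesis A_uniq : uniq A.
Hypothesis A_neq0 : A != [::].
Variable cost : nat.
Hypothesis cost_gt0 : (0 < cost)%N.
Hypothesis cost_shear : forall k, (k < d)%N -> (l k <= cost * lprod l k)%N.
Hypothesis cost_box : (cost * lprod l d <= n.+1 ^ 2)%N.

Definition remainder_cst : R := (16 * d%:R * B ^+ 2 / eps + 8 * B ^+ 2 + 8) * color_cst.

(** The averages have coefficients of square sum 1/m, which cancels the factor m. The
    squares from the Abel summations have square sum at most [cost], and are
    divided by N^2: hence the condition cost m <= N^2. *)
Lemma local_remainder_entropy mu : is_dist mu ->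
  \sum_eta mu eta * local_remainder phi A eta <=
  remainder_cst * (entropy (@bern R (torus d n) rho) mu + n.+1%:R ^+ d / (lprod l d)%:R).
Proof.
move=> dmu.
have Ab a : a \in A -> forall j, `|a 0 j| <= r%:Z.
  by move=> /A_behind[_ ab] j; apply: behind_abs.
have bb s : in_box l s -> forall p : R * 'rV[int]_d, p \in s ->
  forall j : 'I_d, `|p.2 0 j| <= (l j)%:Z.
  by move=> sb p ps j; apply: box_abs; apply: sb.
set H := entropy _ _.
have H0 : 0 <= H + gap.
  apply: addr_ge0; last by rewrite /gap divr_ge0 ?exprn_ge0 ?(ltW m_gt0).
  by apply: entropy_ge0 dmu; [exact: bern_gt0|exact: bern_sum1].
have im0 : 0 < m^-1 by rewrite invr_gt0.
have s1 := @squares_entropy phi A B (box R d l d) m^-1 mu phi_bound B_gt0 A_uniq A_neq0 Ab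
  (box_uniq R l (leqnn d)) (bb _ (box_in_box l_gt0 (k := d))) im0.
rewrite (box_sqr_sum R d l_gt0) in s1; have {}s1 := s1 (lexx _) dmu.
have s2 (k : 'I_d) := @squares_entropy phi A B (shear_box R d l k) cost%:R mu phi_bound B_gt0
  A_uniq A_neq0 Ab (shear_box_uniq R l (ltn_ord k)) (bb _ (shear_in_box l_gt0 (k := k))).
have cost0 : 0 < cost%:R :> R by rewrite ltr0n.
have ks (k : 'I_d) : \sum_(p <- shear_box R d l k) p.1 ^+ 2 <= cost%:R :> R.
  apply: le_trans (shear_box_sqr_sum R d l_gt0 k) _.
  rewrite ler_pdivrMr ?ltr0n ?lprod_gt0 // -natrM ler_nat; exact: cost_shear.
have {}s2 (k : 'I_d) := s2 k cost0 (ks k) dmu.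
(* the centered occupation number is itself a local product, with A = {0} *)
have s3 := @squares_entropy (fun=> 1) [:: 0] 1 (neg_box R d l) m^-1 mu.
have {}s3 : \sum_eta mu eta * (\sum_z lincomb (neg_box R d l) (centered rho eta) z ^+ 2) <=
    16 * color_cst * (H + gap).
  have -> : 16 * color_cst * (H + gap) = 16 * 1 ^+ 2 * (m^-1 * m) * color_cst * (H + gap).
    by rewrite mulVf ?gt_eqF // expr1n !mulr1.
  have -> : \sum_eta mu eta * (\sum_z lincomb (neg_box R d l) (centered rho eta) z ^+ 2) =
    \sum_eta mu eta * (\sum_z lincomb (neg_box R d l) (local_prod rho (fun=> 1) [:: 0] eta) z ^+ 2).
    apply: eq_bigr => eta _; congr (_ * _); apply: eq_bigr => z _; congr (_ ^+ 2).
    apply: eq_bigr => p _; congr (_ * _).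
    by rewrite /local_prod big_seq1 mul1r site0 add0r.
  apply: s3 => //.
  - by move=> z; rewrite normr1.
  - by move=> a; rewrite inE => /eqP -> j; rewrite mxE normr0.
  - have -> : [seq p.2 | p <- neg_box R d l] = map -%R [seq p.2 | p <- box R d l d].
      by rewrite /neg_box -!map_comp; apply: eq_map.
    rewrite map_inj_uniq; [exact: box_uniq|exact: oppr_inj].
  - move=> p /mapP[q qs ->] j /=; rewrite mxE normrN.
    exact: (bb _ (box_in_box l_gt0 (k := d))).
  - by rewrite /neg_box big_map /= box_sqr_sum.
have c0 := color_cst_gt0.
have expand : \sum_eta mu eta * local_remainder phi A eta =
   2 / beta * (\sum_(k < d) \sum_eta mu eta *
      (\sum_z lincomb (shear_box R d l k) (local_prod rho phi A eta) z ^+ 2))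
   + (\sum_eta mu eta * (\sum_z lincomb (box R d l d) (local_prod rho phi A eta) z ^+ 2)) / 2
   + (\sum_eta mu eta * (\sum_z lincomb (neg_box R d l) (centered rho eta) z ^+ 2)) / 2.
  rewrite exchange_big /= mulr_sumr !mulr_suml -!big_split /=; apply: eq_bigr => eta _.
  by rewrite /local_remainder /remainder -/beta -mulr_sumr; ring.
rewrite expand.
have t2 : 2 / beta * (\sum_(k < d) \sum_eta mu eta *
      (\sum_z lincomb (shear_box R d l k) (local_prod rho phi A eta) z ^+ 2)) <=
   16 * d%:R * B ^+ 2 / eps * color_cst * (H + gap).
  have nn : 0 < n.+1%:R ^+ 2 :> R by rewrite exprn_gt0.
  have cm : cost%:R * m <= n.+1%:R ^+ 2 by rewrite -natrM -natrX ler_nat.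
  have b2 : 0 <= 2 / beta by rewrite divr_ge0 // ltW.
  apply: (@le_trans _ _ (2 / beta * \sum_(k < d)
     (16 * B ^+ 2 * n.+1%:R ^+ 2 * color_cst * (H + gap)))).
    apply: ler_wpM2l => //; apply: ler_sum => k _; apply: le_trans (s2 k) _.
    apply: ler_wpM2r => //; apply: ler_wpM2r; first exact: ltW.
    by apply: ler_wpM2l => //; rewrite mulr_ge0 ?sqr_ge0.
  rewrite sumr_const card_ord -[_ *+ d]mulr_natl le_eqVlt; apply/orP; left; apply/eqP.
  by rewrite /beta; field; rewrite !gt_eqF.
have -> : remainder_cst * (H + n.+1%:R ^+ d / (lprod l d)%:R) =
  16 * d%:R * B ^+ 2 / eps * color_cst * (H + gap) +
  (8 * B ^+ 2 * color_cst * (H + gap)) + 8 * color_cst * (H + gap).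
  by rewrite /remainder_cst /gap /m; ring.
apply: lerD; first apply: lerD => //.
  have : 16 * B ^+ 2 * (m^-1 * m) * color_cst * (H + gap) =
     8 * B ^+ 2 * color_cst * (H + gap) * 2 by rewrite mulVf ?gt_eqF //; ring.
  by move=> e; rewrite ler_pdivrMr // -e.
by rewrite ler_pdivrMr //; lra.
Qed.

End OneFamily.

End Replacement.

(** * The quadratic form of the generator *)

Section GeneratorForm.
Variables (R : realType) (d n : nat) (lambda rho : R).
Hypothesis lambda_gt0 : 0 < lambda.
Hypothesis rho01 : 0 < rho < 1.
Hypothesis stationary : reaction_drift d lambda rho = 0.
Hypothesis n_gt0 : (0 < n)%N.
Implicit Types (eta : config d n) (x z : torus d n) (g : config d n -> R).

Lemma generator_matrix (f : config d n -> R) eta :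
  generator lambda f eta =
  \sum_b generator lambda (fun c => (c == b)%:R) eta * f b.
Proof.
have D (c c' : config d n) : f c - f c' = \sum_b ((c == b)%:R - (c' == b)%:R) * f b.
  have one (e : config d n) : \sum_b (e == b)%:R * f b = f e.
    rewrite (bigD1 e) //= eqxx mul1r big1 ?addr0 // => b /negbTE be.
    by rewrite eq_sym be mul0r.
  by under eq_bigr do rewrite mulrBl; rewrite sumrB !one.
rewrite /generator; under [RHS]eq_bigr do rewrite mulrDl.
rewrite big_split /=; congr (_ + _).
  under [RHS]eq_bigr do rewrite -mulrA mulr_suml.
  rewrite -[RHS]mulr_sumr; congr (_ * _); rewrite [RHS]exchange_big /=; apply: eq_bigr => x _.
  under [RHS]eq_bigr do rewrite mulr_suml.
  by rewrite [RHS]exchange_big /=; apply: eq_bigr => j _; apply: D.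
under [RHS]eq_bigr do rewrite mulr_suml.
rewrite [RHS]exchange_big /=; apply: eq_bigr => x _; rewrite D mulr_sumr.
by apply: eq_bigr => b _; rewrite mulrA.
Qed.

Lemma unit_site_dir (j : 'I_d) : unit_site n j = site n (dir d j).
Proof.
rewrite /unit_site; congr site; apply/rowP => i; rewrite !mxE /=.
by case: (i =P j) => [->|/eqP]; rewrite ?eqxx //= => /negbTE; rewrite -val_eqE => ->.
Qed.

Lemma unit_site_neq0 (j : 'I_d) : unit_site n j != 0.
Proof.
apply/eqP; rewrite unit_site_dir => e.
have dj i : `|(dir d j) 0 i| < n.+1%:Z by rewrite mxE; case: eqP => _ /=; lia.
have := congr1 (fun M : 'rV[int]_d => M 0 j) (site_small_eq0 dj e).
by rewrite !mxE eqxx.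
Qed.

(** The contribution of the flips at x to the adjoint of the reaction applied to 1. *)
Definition flip_defect eta x : R := centered rho eta x * (lambda / rho *
  \sum_(j < d) (occ R eta (x - unit_site n j) * occ R eta (x + unit_site n j) - rho ^+ 2)).

(** As a (b - a) <= (b^2 - a^2) / 2, the form is at most half the mean of
    c_x (g^2 o flip - g^2), with c_x the rate. Averaging over the occupation of x gives
    ((1 - rho) (1 + lambda s) - rho) (g1^2 - g0^2), with s the sum of the products of
    neighbours and g1, g0 the values of g with x occupied and empty; by F (rho) = 0 the
    first factor is (1 - rho) lambda (s - d rho^2). *)
Lemma flip_form x g :
  expect rho (fun eta => g eta * (flip_rate lambda x eta * (g (flip eta x) - g eta))) <=
  expect rho (fun eta => flip_defect eta x * g eta ^+ 2) / 2.
Proof.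
have [r0 r1] := andP rho01.
have rate0 eta : 0 <= flip_rate lambda x eta.
  have o (b : bool) : 0 <= (b%:R : R) <= 1 by case: b; rewrite /= ?ler01 lexx.
  rewrite /flip_rate /occ addr_ge0 ?mulr_ge0 ?subr_ge0 //; first by case/andP: (o (eta x)).
  by rewrite addr_ge0 // mulr_ge0 ?(ltW lambda_gt0) // sumr_ge0 // => j _; rewrite mulr_ge0.
apply: (@le_trans _ _ (expect rho (fun eta =>
   flip_rate lambda x eta * (g (flip eta x) ^+ 2 - g eta ^+ 2)) / 2)).
  rewrite [leRHS]mulrC -expectZ; apply: ler_expect => // eta.
  set a := g eta; set b := g (flip eta x); set c := flip_rate _ _ _.
  have -> : a * (c * (b - a)) = c * (a * (b - a)) by ring.
  have -> : 2^-1 * (c * (b ^+ 2 - a ^+ 2)) = c * ((b ^+ 2 - a ^+ 2) / 2) by field.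
  apply: ler_wpM2l; first exact: rate0.
  have := sqr_ge0 (a - b); nra.
rewrite ler_pM2r ?invr_gt0 // le_eqVlt; apply/orP; left; apply/eqP.
rewrite -(expect_avg rho x) -(expect_avg rho x (fun eta => flip_defect eta x * _)).
apply: eq_expect => eta; rewrite /site_avg.
set e1 := upd eta x true; set e0 := upd eta x false.
have f1 : flip e1 x = e0 by apply/ffunP => u; rewrite !ffunE; case: eqP.
have f0 : flip e0 x = e1 by apply/ffunP => u; rewrite !ffunE; case: eqP.
rewrite f1 f0.
have x1 : occ R e1 x = 1 by rewrite /occ ffunE eqxx.
have x0 : occ R e0 x = 0 by rewrite /occ ffunE eqxx.
have off b (j : 'I_d) : occ R (upd eta x b) (x - unit_site n j) = occ R eta (x - unit_site n j).
  rewrite /occ ffunE ifN // -subr_eq0 addrAC subrr add0r oppr_eq0; exact: unit_site_neq0.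
have ofp b (j : 'I_d) : occ R (upd eta x b) (x + unit_site n j) = occ R eta (x + unit_site n j).
  rewrite /occ ffunE ifN // -subr_eq0 addrAC subrr add0r; exact: unit_site_neq0.
rewrite /flip_defect /flip_rate /centered x1 x0.
have S b : \sum_(j < d) occ R (upd eta x b) (x - unit_site n j) *
     occ R (upd eta x b) (x + unit_site n j) =
   \sum_(j < d) occ R eta (x - unit_site n j) * occ R eta (x + unit_site n j).
  by apply: eq_bigr => j _; rewrite off ofp.
rewrite !sumrB !S; set s := \sum_(_ < _) _.
rewrite sumr_const card_ord -[_ *+ d]mulr_natl.
have F0 : (1 - rho) * (1 + lambda * (d%:R * rho ^+ 2)) = rho.
  move: stationary; rewrite /reaction_drift => /eqP; rewrite subr_eq0 => /eqP e.
  by rewrite -[RHS]e; ring.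
have rn : rho != 0 by rewrite gt_eqF.
have key : (1 - rho) * (1 + lambda * s) - rho =
   (1 - rho) * lambda * (s - d%:R * rho ^+ 2) by rewrite -[X in _ - X]F0; ring.
have -> : rho * ((1 + (1 - 1) * (1 + lambda * s)) * (g e0 ^+ 2 - g e1 ^+ 2)) +
   (1 - rho) * ((0 + (1 - 0) * (1 + lambda * s)) * (g e1 ^+ 2 - g e0 ^+ 2)) =
   ((1 - rho) * (1 + lambda * s) - rho) * (g e1 ^+ 2 - g e0 ^+ 2) by ring.
by rewrite key; field.
Qed.

Lemma generator_form g :
  expect rho (fun eta => g eta * generator lambda g eta) <=
  - (n.+1%:R ^+ 2 / 2) * (\sum_(k < d) dirichlet rho k g)
  + expect rho (fun eta => (\sum_x flip_defect eta x / 2) * g eta ^+ 2).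
Proof.
have -> : expect rho (fun eta => g eta * generator lambda g eta) =
  n.+1%:R ^+ 2 * (\sum_x \sum_(j < d)
     expect rho (fun eta => g eta * (g (exchange eta x (x + unit_site n j)) - g eta)))
  + \sum_x expect rho (fun eta => g eta * (flip_rate lambda x eta * (g (flip eta x) - g eta))).
  under [X in _ = _ * X + _]eq_bigr do rewrite -expect_sum.
  rewrite -!expect_sum -expectZ -expectD; apply: eq_expect => eta.
  rewrite /generator mulrDr mulrCA !mulr_sumr; congr (_ + _); apply: eq_bigr => x _.
  by rewrite !mulr_sumr; apply: eq_bigr => j _.
apply: lerD; last first.
  have -> : expect rho (fun eta => (\sum_x flip_defect eta x / 2) * g eta ^+ 2) =
    \sum_x expect rho (fun eta => flip_defect eta x * g eta ^+ 2) / 2.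
    rewrite -mulr_suml mulrC -expect_sum -expectZ; apply: eq_expect => eta.
    by rewrite -mulr_suml -mulr_suml; ring.
  by apply: ler_sum => x _; apply: flip_form.
rewrite le_eqVlt; apply/orP; left; apply/eqP.
have -> : - (n.+1%:R ^+ 2 / 2) * (\sum_(k < d) dirichlet rho k g) =
  n.+1%:R ^+ 2 * (- (2^-1) * \sum_(k < d) dirichlet rho k g) by ring.
congr (_ * _); rewrite exchange_big /= mulr_sumr; apply: eq_bigr => j _.
rewrite /dirichlet mulr_sumr; apply: eq_bigr => x _; rewrite -unit_site_dir.
set y := x + _.
have e : expect rho (fun eta => g (exchange eta x y) ^+ 2) = expect rho (fun eta => g eta ^+ 2).
  exact: (expect_exchange rho (fun eta => g eta ^+ 2)).
have -> : expect rho (fun eta => g eta * (g (exchange eta x y) - g eta)) =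
   - 2^-1 * expect rho (fun eta => (g (exchange eta x y) - g eta) ^+ 2) +
   2^-1 * (expect rho (fun eta => g (exchange eta x y) ^+ 2)
      + (-1) * expect rho (fun eta => g eta ^+ 2)).
  rewrite -!expectZ -!expectD -!expectZ -expectD; apply: eq_expect => eta; by field.
by rewrite e mulN1r subrr mulr0 addr0.
Qed.

(** With b, e the centered variables at the two neighbours of x in direction j,
    (b + rho) (e + rho) - rho^2 = b e + rho (b + e): after multiplication by the centered
    variable at x every term has two or three factors. The terms are recentered by
    translation at their foremost site, so that the other factors lie behind it. *)
Lemma flip_defect_local eta : \sum_x flip_defect eta x / 2 =
  \sum_(j < d)
   (\sum_z local_prod rho (fun=> lambda / (2 * rho)) [:: - dir d j; - (dir d j *+ 2)] eta z
        * centered rho eta z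
    + \sum_z local_prod rho (fun=> lambda) [:: - dir d j] eta z * centered rho eta z).
Proof.
have rn : rho != 0 by have [r0 r1] := andP rho01; rewrite gt_eqF.
pose c := centered rho eta; pose u (j : 'I_d) := unit_site n j.
transitivity (\sum_(j < d) \sum_x (lambda / (2 * rho) * (c (x - u j) * c (x + u j) * c x) +
   (lambda / 2 * (c x * c (x - u j)) + lambda / 2 * (c (x + u j) * c x)))).
  rewrite exchange_big /=; apply: eq_bigr => x _.
  transitivity (c x * (lambda / rho) / 2 * \sum_(j < d)
     (occ R eta (x - u j) * occ R eta (x + u j) - rho ^+ 2)).
    by rewrite /flip_defect -/(c x); ring.
  rewrite mulr_sumr; apply: eq_bigr => j _.
  rewrite /c /u /centered; set a := occ _ _ _; set b := occ _ _ _; set e := occ _ _ _.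
  by field.
apply: eq_bigr => j _; rewrite !big_split /=.
have s1 : \sum_z lambda / (2 * rho) * (c (z - u j) * c (z + u j) * c z) =
   \sum_z local_prod rho (fun=> lambda / (2 * rho)) [:: - dir d j; - (dir d j *+ 2)] eta z
        * centered rho eta z.
  rewrite [RHS](reindex_inj (addIr (u j))) /=; apply: eq_bigr => z _.
  rewrite /local_prod big_cons big_seq1 !siteN siteMn -unit_site_dir -/(u j) -/c.
  have -> : - u j + (z + u j) = z by rewrite addrC addrK.
  have -> : - (u j *+ 2) + (z + u j) = z - u j.
    by rewrite mulr2n opprD addrC addrA addrK.
  ring.
have s2 : \sum_z lambda / 2 * (c (z + u j) * c z) = \sum_z lambda / 2 * (c z * c (z - u j)).
  rewrite [RHS](reindex_inj (addIr (u j))) /=; apply: eq_bigr => z _; by rewrite addrK.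
rewrite s1 s2 -big_split /=; congr (_ + _); apply: eq_bigr => z _.
rewrite /local_prod big_seq1 siteN -unit_site_dir -/(u j) -/c [- u j + z]addrC.
by field.
Qed.

End GeneratorForm.

(** * Transition matrices and finite paths *)

Section Semigroup.
Variables (R : realType) (S : finType) (L : (S -> R) -> S -> R).
Hypothesis Lmat : forall f a, L f a = \sum_b L (fun c => (c == b)%:R) a * f b.

Lemma iter_generator_bound : exists2 K : R, 0 <= K &
  forall k f (F : R), (forall a, `|f a| <= F) -> forall a, `|iter k L f a| <= K ^+ k * F.
Proof.
pose q a b : R := L (fun c => (c == b)%:R) a.
pose K : R := \sum_a \sum_b `|q a b|.
have K0 : 0 <= K by do 2!apply: sumr_ge0 => ? _.
exists K => // k f F fF; elim: k => [|k IH] a /=; first by rewrite expr0 mul1r.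
rewrite Lmat; apply: le_trans (ler_norm_sum _ _ _) _.
apply: (@le_trans _ _ (\sum_b `|q a b| * (K ^+ k * F))).
  by apply: ler_sum => b _; rewrite normrM ler_wpM2l.
rewrite -mulr_suml exprS -mulrA ler_wpM2r //.
  by apply: le_trans (normr_ge0 _) (IH a).
rewrite -[leLHS]/(\sum_i `|q a i|) /K [leRHS](bigD1 a) //= lerDl; by do 2!apply: sumr_ge0 => ? _.
Qed.

(** The tail of the exponential series from the second term on is dominated by that of
    exp (u K), and u^k <= u^2 for k >= 2. *)
Lemma transition_expand : exists C : R, forall (u : R) a b, 0 <= u <= 1 ->
  `|transition L u a b - (a == b)%:R - u * L (fun c => (c == b)%:R) a| <= C * u ^+ 2.
Proof.
have [K K0 HK] := iter_generator_bound.
exists (expR K) => u a b /andP[u0 u1].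
set f := fun c : S => (c == b)%:R : R.
have f1 c : `|f c| <= 1 by rewrite /f; case: eqP; rewrite ?normr1 ?normr0.
pose v k : R := u ^+ k / k`!%:R * iter k L f a.
have vb k : `|v k| <= exp_coeff (u * K) k.
  rewrite /v normrM /exp_coeff /= exprMn ger0_norm ?divr_ge0 ?exprn_ge0 //.
  rewrite [leRHS]mulrAC ler_wpM2l ?divr_ge0 ?exprn_ge0 //.
  by apply: le_trans (HK k f 1 f1 a) _; rewrite mulr1.
have cv : cvgn (series v).
  apply: normed_cvg; apply: series_le_cvg (@is_cvg_series_exp_coeff R (u * K)) => n //=.
  exact: le_trans (normr_ge0 _) (vb n).
have part n : (2 <= n)%N -> `|series v n - v 0%N - v 1%N| <= expR K * u ^+ 2.
  move=> n2.
  have -> : series v n - v 0%N - v 1%N = \sum_(2 <= k < n) v k.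
    rewrite /series /= (@big_cat_nat _ _ _ 2) //= big_nat_recl // big_nat1; ring.
  apply: le_trans (ler_norm_sum _ _ _) _.
  apply: (@le_trans _ _ (\sum_(2 <= k < n) exp_coeff K k * u ^+ 2)).
    rewrite big_nat_cond [X in _ <= X]big_nat_cond; apply: ler_sum => k /andP[/andP[k2 _] _].
    apply: le_trans (vb k) _; rewrite /exp_coeff /= exprMn.
    rewrite [X in _ <= X]mulrC mulrA ler_wpM2r ?invr_ge0 // ler_wpM2r ?exprn_ge0 //.
    by apply: ler_wiXn2l.
  rewrite -mulr_suml ler_wpM2r ?sqr_ge0 //.
  apply: (@le_trans _ _ (series (exp_coeff K) n)).
    rewrite /series /= [X in _ <= X](@big_cat_nat _ _ _ 2) //= lerDr.
    by apply: sumr_ge0 => k _; apply: exp_coeff_ge0.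
  rewrite /expR; apply: (nondecreasing_cvgn_le _ _ n); last exact: is_cvg_series_exp_coeff.
  by apply: nondecreasing_series => k _ _; apply: exp_coeff_ge0.
have -> : (a == b)%:R = v 0%N by rewrite /v expr0 fact0 divr1 mul1r.
have -> : u * L (fun c => (c == b)%:R) a = v 1%N.
  by rewrite /v expr1 (_ : 1`! = 1)%N // divr1.
rewrite /transition /semigroup -/f -/v.
have cv2 : (fun n => `|series v n - v 0%N - v 1%N|) @ \oo -->
   `|limn (series v) - v 0%N - v 1%N|.
  by apply: cvg_norm; apply: cvgB; [apply: cvgB => //; apply: cvg_cst|apply: cvg_cst].
rewrite -(cvg_lim _ cv2) //; apply: limr_le; first by apply/cvg_ex; eexists; exact: cv2.
by near=> n; apply: part; near: n; exists 2%N.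
Unshelve. all: by end_near.
Qed.

End Semigroup.

Section PathLaw.
Variables (R : realType) (S : finType) (nu : S -> R) (p : S -> S -> R).

(** Sum over the words of length [k], that is the paths of the chain on a grid with the
    most recent state first. Recursion on the head makes the Markov property a
    rewriting rule. *)
Fixpoint word_sum (k : nat) (F : seq S -> R) : R :=
  if k is k'.+1 then \sum_b word_sum k' (fun s => F (b :: s)) else F [::].

Fixpoint path_law (s : seq S) : R :=
  match s with
  | [::] => 1
  | [:: a] => nu a
  | b :: ((a :: _) as s') => path_law s' * p a b
  end.

Lemma word_sumD k F G : word_sum k (fun s => F s + G s) = word_sum k F + word_sum k G.
Proof.
elim: k F G => [|k IH] F G //=; rewrite -big_split; apply: eq_bigr => b _; exact: IH.
Qed.

Lemma word_sumZ k c F : word_sum k (fun s => c * F s) = c * word_sum k F.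
Proof.
elim: k F => [|k IH] F //=; rewrite mulr_sumr; apply: eq_bigr => b _; exact: IH.
Qed.

Lemma eq_word_sum k F G : (forall s, size s = k -> F s = G s) -> word_sum k F = word_sum k G.
Proof.
elim: k F G => [|k IH] F G FG /=; first exact: FG.
by apply: eq_bigr => b _; apply: IH => s sk; apply: FG; rewrite /= sk.
Qed.

Lemma ler_word_sum k F G : (forall s, size s = k -> F s <= G s) -> word_sum k F <= word_sum k G.
Proof.
elim: k F G => [|k IH] F G FG /=; first exact: FG.
by apply: ler_sum => b _; apply: IH => s sk; apply: FG; rewrite /= sk.
Qed.

Lemma word_sum_sum (I : finType) k (F : I -> seq S -> R) :
  word_sum k (fun s => \sum_i F i s) = \sum_i word_sum k (F i).
Proof.
elim: k F => [|k IH] F //=; rewrite exchange_big; apply: eq_bigr => b _; exact: IH.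
Qed.

Hypothesis nu_ge0 : forall a, 0 <= nu a.
Hypothesis p_ge0 : forall a b, 0 <= p a b.

Lemma path_law_ge0 s : 0 <= path_law s.
Proof.
elim: s => [|b [|a s] IH] //=; exact: mulr_ge0.
Qed.

(** The last letter, which is the state at time 0, is skipped: functionals of a path are
    right-endpoint Riemann sums. *)
Fixpoint word_prod (w : S -> R) (s : seq S) : R :=
  match s with [::] | [:: _] => 1 | b :: s' => w b * word_prod w s' end.

Fixpoint word_add (w : S -> R) (s : seq S) : R :=
  match s with [::] | [:: _] => 0 | b :: s' => w b + word_add w s' end.

(** The discrete Feynman-Kac recursion: each transition is followed by a multiplication by
    [w]. *)
Definition weighted_law (w : S -> R) (k : nat) : S -> R :=
  iter k (fun m b => w b * \sum_a m a * p a b) nu.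

(** Summing over the oldest letters first turns the multiplicative path functional into
    the Feynman-Kac recursion. *)
Lemma word_sum_prod w k F :
  word_sum k.+1 (fun s => if s is b :: _ then path_law s * word_prod w s * F b else 0) =
  \sum_b weighted_law w k b * F b.
Proof.
elim: k F => [|k IH] F /=; first by apply: eq_bigr => b _; rewrite mulr1.
apply: eq_bigr => b _; rewrite -mulrA mulr_suml mulr_sumr.
have := IH (fun a => p a b * (F b * w b)); rewrite /= => e.
have -> : \sum_i w b * ((weighted_law w k i * p i b) * F b) =
   \sum_i weighted_law w k i * (p i b * (F b * w b)) by apply: eq_bigr => i _; ring.
rewrite -e; apply: eq_bigr => a _; apply: eq_word_sum => s _ /=; ring.
Qed.

Hypothesis nu_sum1 : \sum_a nu a = 1.
Hypothesis p_sum1 : forall a, \sum_b p a b = 1.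

Lemma push_dist mu : is_dist mu -> is_dist (push p mu).
Proof.
move=> [m0 m1]; split=> [b|].
  by apply: sumr_ge0 => a _; rewrite mulr_ge0.
rewrite /push exchange_big /= -m1; apply: eq_bigr => a _.
by rewrite -mulr_sumr p_sum1 mulr1.
Qed.

Definition law_at k := iter k (push p) nu.

Lemma law_at_dist k : is_dist (law_at k).
Proof. by elim: k => [|k IH] /=; [split|exact: push_dist]. Qed.

Lemma word_sum_last k F :
  word_sum k.+1 (fun s => if s is b :: _ then path_law s * F b else 0) =
  \sum_b law_at k b * F b.
Proof.
have wl j b : weighted_law (fun=> 1) j b = law_at j b.
  elim: j b => [|j IH] b //=; rewrite mul1r; apply: eq_bigr => a _.
  by rewrite -IH.
under [RHS]eq_bigr do rewrite -wl.
rewrite -word_sum_prod; apply: eq_word_sum => -[|b s] // _.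
have -> : word_prod (fun=> 1) (b :: s) = 1.
  by elim: s b => [|c s IH] b //=; rewrite mul1r; apply: IH.
by rewrite mulr1.
Qed.

Lemma word_sum_add w k :
  word_sum k.+1 (fun s => path_law s * word_add w s) =
  \sum_(i < k) \sum_b law_at i.+1 b * w b.
Proof.
elim: k => [|k IH]; first by rewrite /= big_ord0 big1 // => b _; rewrite mulr0.
rewrite big_ord_recr /= -IH /=.
rewrite -[X in _ = _ + X](word_sum_last k.+1 w) /=.
have -> : \sum_i word_sum k (fun s => path_law (i :: s) * word_add w (i :: s)) =
  \sum_b \sum_a word_sum k (fun s => path_law (a :: s) * p a b * word_add w (a :: s)).
  rewrite exchange_big /=; apply: eq_bigr => a _; rewrite -word_sum_sum.
  apply: eq_word_sum => s _.
  under eq_bigr do rewrite mulrAC.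
  by rewrite -mulr_sumr p_sum1 mulr1.
rewrite -big_split /=; apply: eq_bigr => b _; rewrite -big_split /=.
apply: eq_bigr => a _; rewrite -word_sumD; apply: eq_word_sum => s _ /=; ring.
Qed.

End PathLaw.

(** * The entropy and Feynman-Kac estimates on a time grid *)

Section Grid.
Variable R : realType.

Lemma expR_ge1 (x : R) : 0 <= x -> 1 <= expR x.
Proof. by move=> x0; rewrite -expR0 ler_expR. Qed.

Lemma expR_sub1_bound (x : R) : `|expR x - 1 - x| <= x ^+ 2 * expR `|x|.
Proof.
have h1 : 0 <= expR x - 1 - x by have := expR_ge1Dx x; lra.
rewrite ger0_norm //.
have h2 : expR x - 1 - x <= x * (expR x - 1).
  have := expR_ge1Dx (- x); have e0 := expR_gt0 x.
  move=> /(ler_wpM2r (ltW e0)); rewrite -expRD addNr expR0; nra.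
apply: le_trans h2 _.
case: (lerP 0 x) => [x0|/ltW x0].
  rewrite ger0_norm // expr2 -mulrA ler_wpM2l //.
  have := expR_ge1Dx (- x); have e0 := expR_gt0 x.
  move=> /(ler_wpM2r (ltW e0)); rewrite -expRD addNr expR0; nra.
have e1 : 1 <= expR `|x| by rewrite expR_ge1.
have e2 : x * (expR x - 1) <= x ^+ 2 by have := expR_ge1Dx x; nra.
by apply: le_trans e2 _; rewrite ler_peMr ?sqr_ge0.
Qed.

Lemma exp1D_le (x : R) n : 0 <= x -> (1 + x) ^+ n <= expR (x * n%:R).
Proof.
move=> x0; rewrite mulrC expRM_natl lerXn2r ?nnegrE ?expR_ge0 //.
  by rewrite addr_ge0.
exact: expR_ge1Dx.
Qed.

(** The error C h^2 of each step is absorbed by [g], which is fixed while h tends to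
    zero. *)
Lemma discrete_gronwall (H : nat -> R) (A g h C : R) :
  0 < A -> 0 <= h -> 0 <= C -> 0 <= g -> H 0%N = 0 ->
  (forall k, H k.+1 <= H k + h * A * (H k + g) + C * h ^+ 2) ->
  C * h <= A * g ->
  forall k, H k + g <= 2 * g * expR (h * A * k%:R).
Proof.
move=> A0 h0 C0 g0 H0 HS Chg k.
pose e := C * h / A.
have eg : e <= g by rewrite /e ler_pdivrMr //; move: Chg; rewrite mulrC [A * g]mulrC [h * C]mulrC.
have e0 : 0 <= e by rewrite divr_ge0 ?mulr_ge0 // ltW.
have Ce : C * h ^+ 2 = h * A * e by rewrite /e; field; rewrite gt_eqF.
have hA : 0 <= h * A by rewrite mulr_ge0 // ltW.
have main : H k + g + e <= (1 + h * A) ^+ k * (g + e).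
  elim: k => [|k IH]; first by rewrite H0 expr0 mul1r add0r.
  rewrite exprS -mulrA.
  apply: le_trans (ler_wpM2l _ IH); last by rewrite addr_ge0.
  have := HS k; rewrite Ce; lra.
have p1 := exp1D_le k hA.
have : (1 + h * A) ^+ k * (g + e) <= expR (h * A * k%:R) * (2 * g).
  by apply: ler_pM => //; rewrite ?exprn_ge0 ?addr_ge0 //; lra.
lra.
Qed.

Variables (S : finType) (L : (S -> R) -> S -> R) (nu V Rf : S -> R).
Variables (t delta a K g : R).
Hypothesis Lmat : forall f a, L f a = \sum_b L (fun c => (c == b)%:R) a * f b.
Hypothesis nu_gt0 : forall a, 0 < nu a.
Hypothesis nu_sum1 : \sum_a nu a = 1.
Hypothesis p_ge0 : forall (u : R) a b, 0 <= u -> 0 <= transition L u a b.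
Hypothesis p_sum1 : forall (u : R) a, 0 <= u -> \sum_b transition L u a b = 1.
Hypothesis t_gt0 : 0 < t.
Hypothesis delta_gt0 : 0 < delta.
Hypothesis a_gt0 : 0 < a.
Hypothesis K_gt0 : 0 < K.
Hypothesis g_gt0 : 0 < g.
Hypothesis Rf_ge0 : forall b, 0 <= Rf b.
Hypothesis form_bound : forall (s : bool) (u : S -> R),
  \sum_b nu b * u b * L u b + (-1) ^+ s * a * \sum_b nu b * V b * u b ^+ 2
    <= \sum_b nu b * Rf b * u b ^+ 2.
Hypothesis Rf_entropy : forall mu, is_dist mu ->
  \sum_b mu b * Rf b <= K * (entropy nu mu + g).

Let q a b := L (fun c => (c == b)%:R) a.

Lemma form_adj u : \sum_b nu b * u b * adj nu q u b = \sum_b nu b * u b * L u b.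
Proof.
have -> : \sum_b nu b * u b * adj nu q u b = \sum_b \sum_a nu a * u a * q a b * u b.
  apply: eq_bigr => b _; rewrite /adj -mulr_suml; field; rewrite gt_eqF //.
rewrite exchange_big /=; apply: eq_bigr => b _; rewrite Lmat mulr_sumr.
by apply: eq_bigr => c _; rewrite mulrA.
Qed.

(** Multiplying by exp (h U) after a step of length h adds the potential U to the
    generator at first order. *)
Lemma tilted_expand (U : S -> R) : exists C : R, forall (h : R) a b, 0 <= h <= 1 ->
  `|transition L h a b * expR (h * U b) - (a == b)%:R
     - h * (q a b + (a == b)%:R * U b)| <= C * h ^+ 2.
Proof.
have [C1 HC1] := transition_expand Lmat.
pose Q : R := \sum_a \sum_b `|q a b|.
pose W : R := \sum_b `|U b|.
have Q0 : 0 <= Q by do 2!apply: sumr_ge0 => ? _.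
have W0 : 0 <= W by apply: sumr_ge0 => ? _.
have qQ c b : `|q c b| <= Q.
  rewrite /Q (bigD1 c) //= (bigD1 b) //= -addrA lerDl addr_ge0 //.
    by apply: sumr_ge0.
  by do 2!apply: sumr_ge0 => ? _.
have UW b : `|U b| <= W by rewrite /W (bigD1 b) //= lerDl sumr_ge0.
exists (Q * W + `|C1| * expR W + W ^+ 2 * expR W * (1 + Q)) => h c b h01.
have [h0 h1] := andP h01.
pose r1 := transition L h c b - (c == b)%:R - h * q c b.
pose x := h * U b.
pose r2 := expR x - 1 - x.
have xW : `|x| <= h * W by rewrite normrM ger0_norm // ler_wpM2l.
have xW1 : `|x| <= W by apply: le_trans xW _; rewrite ler_piMl.
have r1b : `|r1| <= `|C1| * h ^+ 2.
  by apply: le_trans (HC1 _ _ _ h01) _; rewrite ler_wpM2r ?sqr_ge0 ?ler_norm.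
have r2b : `|r2| <= h ^+ 2 * (W ^+ 2 * expR W).
  apply: le_trans (expR_sub1_bound x) _.
  rewrite mulrA -exprMn ler_pM ?sqr_ge0 ?expR_ge0 ?ler_expR //.
  by rewrite -[x ^+ 2]real_normK ?num_real // lerXn2r ?nnegrE ?mulr_ge0.
have -> : transition L h c b * expR x - (c == b)%:R - h * (q c b + (c == b)%:R * U b)
  = h ^+ 2 * (q c b * U b) + r1 * expR x + r2 * ((c == b)%:R + h * q c b).
  by rewrite /r2 /r1 /x; ring.
apply: le_trans (ler_normD _ _) _.
have b3 : `|r2 * ((c == b)%:R + h * q c b)| <= h ^+ 2 * (W ^+ 2 * expR W) * (1 + Q).
  rewrite normrM ler_pM //; apply: le_trans (ler_normD _ _) _; apply: lerD.
    by case: (c == b); rewrite ?normr1 ?normr0.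
  by rewrite normrM ger0_norm //; apply: le_trans (qQ c b); rewrite ler_piMl.
have b1 : `|h ^+ 2 * (q c b * U b)| <= h ^+ 2 * (Q * W).
  by rewrite normrM ger0_norm ?sqr_ge0 // ler_wpM2l ?sqr_ge0 // normrM ler_pM.
have b2 : `|r1 * expR x| <= `|C1| * h ^+ 2 * expR W.
  rewrite normrM ler_pM // ger0_norm ?expR_ge0 // ler_expR.
  exact: le_trans (ler_norm _) xW1.
have := ler_normD (h ^+ 2 * (q c b * U b)) (r1 * expR x); lra.
Qed.

(** The total mass of the Feynman-Kac measure is the expectation of the exponential of
    the time sum of U. Its density u_k with respect to [nu] obeys u_(k+1) = k_h^* u_k,
    whose L^2 norm grows by at most 1 + O(h^2) per step when the form of L + U is
    nonpositive. Over t / h steps the norm stays bounded, and the mass is at most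
    (1 + |u|^2) / 2. *)
Lemma tilted_mass (U : S -> R) :
  (forall u, \sum_b nu b * u b * L u b + \sum_b nu b * U b * u b ^+ 2 <= 0) ->
  exists M0 : nat, forall M : nat, (M0 <= M)%N -> forall h, h = t / M%:R ->
   \sum_b weighted_law nu (transition L h) (fun b => expR (h * U b)) M b <= expR 1.
Proof.
move=> HU; have [C HC] := tilted_expand U.
have [C' C'0 HC'] := adj_expand nu_gt0 nu_sum1 HC.
(* M is large enough for h <= 1 and for the accumulated error M C' h^2 <= 1 *)
exists (Num.truncn (t + C' * t ^+ 2)).+1 => M MM h hE.
have M0 : (0 < M)%N by apply: leq_trans MM.
have M0R : 0 < M%:R :> R by rewrite ltr0n.
have MR : t + C' * t ^+ 2 <= M%:R.
  apply/ltW/(lt_le_trans (truncnS_gt _)); by rewrite ler_nat.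
have ct0 : 0 <= C' * t ^+ 2 by rewrite mulr_ge0 ?sqr_ge0.
have h0 : 0 <= h by rewrite hE divr_ge0 // ltW.
have h1 : h <= 1 by rewrite hE ler_pdivrMr // mul1r; lra.
have h01 : 0 <= h <= 1 by rewrite h0.
pose k_ c b := transition L h c b * expR (h * U b).
pose m := weighted_law nu (transition L h) (fun b => expR (h * U b)).
pose u j b := m j b / nu b.
have uS j b : u j.+1 b = adj nu k_ (u j) b.
  rewrite /u /m /adj /weighted_law iterS mulr_sumr; congr (_ / _).
  apply: eq_bigr => c _; rewrite /k_ -/(weighted_law _ _ _).
  by field; rewrite gt_eqF.
have nrm j : \sum_b nu b * u j b ^+ 2 <= (1 + C' * h ^+ 2) ^+ j.
  elim: j => [|j IH].
    rewrite expr0 -nu_sum1; apply: ler_sum => b _.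
    by rewrite /u /m /weighted_law /= divff ?gt_eqF // expr1n mulr1.
  under eq_bigr do rewrite uS.
  apply: le_trans (HC' h (u j) h01) _.
  have form : \sum_b nu b * u j b *
      adj nu (fun c b => q c b + (c == b)%:R * U b) (u j) b <= 0.
    apply: le_trans (HU (u j)); rewrite -form_adj -big_split /=.
    apply: ler_sum => b _; rewrite le_eqVlt; apply/orP; left; apply/eqP.
    have -> : adj nu (fun c b => q c b + (c == b)%:R * U b) (u j) b =
       adj nu q (u j) b + U b * u j b.
      rewrite /adj; under eq_bigr do rewrite mulrDr.
      rewrite big_split mulrDl /=; congr (_ + _).
      rewrite (bigD1 b) //= eqxx big1 ?addr0.
        by rewrite (_ : true%:R = 1 :> R) //; field; rewrite gt_eqF.
      by move=> c /negbTE ->; rewrite mul0r mulr0.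
    ring.
  have c0 : 0 <= 1 + C' * h ^+ 2 by rewrite addr_ge0 ?mulr_ge0 ?sqr_ge0.
  have := ler_wpM2l c0 IH; rewrite [_ ^+ j.+1]exprS.
  have : 2 * h * \sum_b nu b * u j b *
      adj nu (fun c b => q c b + (c == b)%:R * U b) (u j) b <= 0.
    by rewrite mulr_ge0_le0 // mulr_ge0.
  lra.
have nM : \sum_b nu b * u M b ^+ 2 <= expR 1.
  apply: le_trans (nrm M) _; apply: le_trans (exp1D_le _ _) _.
    by rewrite mulr_ge0 ?sqr_ge0.
  rewrite ler_expR.
  have -> : C' * h ^+ 2 * M%:R = C' * t ^+ 2 / M%:R by rewrite hE; field; rewrite gt_eqF.
  by rewrite ler_pdivrMr // mul1r; have := ltW t_gt0; lra.
have -> : \sum_b weighted_law nu (transition L h) (fun b0 : S => expR (h * U b0)) M b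
   = \sum_b nu b * u M b.
  by apply: eq_bigr => b _; rewrite /u /m; field; rewrite gt_eqF.
have e1 : 1 <= expR 1 :> R by rewrite expR_ge1.
have : \sum_b nu b * u M b <= \sum_b (nu b * u M b ^+ 2 / 2 + nu b / 2).
  apply: ler_sum => b _.
  have -> : nu b * u M b ^+ 2 / 2 + nu b / 2 = nu b * (u M b ^+ 2 / 2 + 1 / 2) by ring.
  by rewrite ler_wpM2l ?(ltW (nu_gt0 _)) //; have := sqr_ge0 (u M b - 1); lra.
rewrite big_split /= -!mulr_suml nu_sum1; lra.
Qed.

Lemma form_Rf u : \sum_b nu b * u b * L u b <= \sum_b nu b * Rf b * u b ^+ 2.
Proof. have := form_bound false u; have := form_bound true u; lra. Qed.

(** Along one step the entropy grows by at most 2 h <u, L u> + O(h^2) with u the square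
    root of the density. The form is at most <R u, u>, which is the mean of R under the current
    law and is bounded by the entropy itself, so Gronwall applies. The chain starts
    from [nu], with zero entropy. *)
Lemma law_at_entropy : exists M0 : nat, forall M : nat, (M0 <= M)%N ->
  forall h, h = t / M%:R -> forall k, (k <= M)%N ->
  entropy nu (law_at nu (transition L h) k) + g <= 2 * g * expR (2 * K * t).
Proof.
have [C HC] := transition_expand Lmat.
have HC0 (h : R) c b : 0 <= h <= 1 ->
  `|transition L h c b - (c == b)%:R - h * q c b| <= C * h ^+ 2 by apply: HC.
have [C' C'0 HC'] := adj_expand nu_gt0 nu_sum1 HC0.
(* M is large enough for h <= 1 and for C' h <= 2 K g, as Gronwall's lemma requires *)
exists (Num.truncn (t + C' * t / (2 * K * g))).+1 => M MM h hE.
have M0 : (0 < M)%N by apply: leq_trans MM.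
have M0R : 0 < M%:R :> R by rewrite ltr0n.
have MR : t + C' * t / (2 * K * g) <= M%:R.
  apply/ltW/(lt_le_trans (truncnS_gt _)); by rewrite ler_nat.
have kg : 0 < 2 * K * g by rewrite !mulr_gt0.
have ct0 : 0 <= C' * t / (2 * K * g) by rewrite !divr_ge0 ?mulr_ge0 // ltW.
have h0 : 0 <= h by rewrite hE divr_ge0 // ltW.
have h1 : h <= 1 by rewrite hE ler_pdivrMr // mul1r; lra.
have h01 : 0 <= h <= 1 by rewrite h0.
pose mu k := law_at nu (transition L h) k.
have dist k : is_dist (mu k).
  apply: law_at_dist => //; [by move=> b; apply: ltW|by move=> *; apply: p_ge0|].
  by move=> *; apply: p_sum1.
have Ch : C' * h <= 2 * K * g.
  have : C' * t / (2 * K * g) <= M%:R by have := ltW t_gt0; lra.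
  by rewrite ler_pdivrMr // => e; rewrite hE mulrA ler_pdivrMr // [_ * M%:R]mulrC.
have HS k : entropy nu (mu k.+1) <= entropy nu (mu k)
    + h * (2 * K) * (entropy nu (mu k) + g) + C' * h ^+ 2.
  have := @entropy_step _ _ nu nu_gt0 (transition L h) (mu k)
    (fun c b => p_ge0 c b h0) (fun c => p_sum1 c h0) (dist k).
  pose gk c := Num.sqrt (mu k c / nu c); rewrite -/gk.
  have e2 b : nu b * gk b ^+ 2 = mu k b.
    rewrite /gk sqr_sqrtr ?divr_ge0 ?(ltW (nu_gt0 _)) //; last by case: (dist k).
    by rewrite mulrC divfK // gt_eqF.
  have := HC' h gk h01.
  have -> : \sum_c nu c * gk c ^+ 2 = 1.
    by under eq_bigr do rewrite e2; case: (dist k).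
  rewrite form_adj.
  have := form_Rf gk.
  have -> : \sum_b nu b * Rf b * gk b ^+ 2 = \sum_b mu k b * Rf b.
    by apply: eq_bigr => b _; rewrite mulrAC e2.
  have := Rf_entropy (dist k) => r1 r2.
  have := ler_wpM2l h0 (le_trans r2 r1); rewrite /mu /law_at iterS; lra.
move=> k kM.
have H00 : entropy nu (mu 0%N) = 0.
  by rewrite /entropy big1 // => b _; rewrite /mu /law_at /= divff ?gt_eqF // ln1 mulr0.
have K2 : 0 < 2 * K by rewrite mulr_gt0.
have := @discrete_gronwall (fun k => entropy nu (mu k)) (2 * K) g h C'
  K2 h0 C'0 (ltW g_gt0) H00 HS Ch k.
move=> /le_trans; apply; rewrite ler_wpM2l ?mulr_ge0 ?(ltW g_gt0) // ler_expR.
rewrite mulrAC [X in _ <= X]mulrC ler_wpM2r ?(ltW K2) // hE mulrAC ler_pdivrMr //.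
by rewrite ler_wpM2l ?(ltW t_gt0) // ler_nat.
Qed.

(** If the time integral of V exceeds delta in absolute value, then either that of R is at
    least a delta / 2, or that of one of the potentials a V - R and - a V - R is. The
    mean of R is controlled by the entropy and the exponential moments of the
    potentials by Feynman-Kac. *)
Lemma grid_bound : exists M0 : nat, forall M : nat, (M0 <= M)%N -> (0 < M)%N ->
  forall h, h = t / M%:R ->
  word_sum M.+1 (fun s => path_law nu (transition L h) s *
     (delta < `|h * word_add V s|)%R%:R) <=
  2 * expR 1 * expR (- (a * delta / 2)) +
  4 * t * K * expR (2 * K * t) / delta * (g / a).
Proof.
pose U (s : bool) b := (-1) ^+ s * a * V b - Rf b.
have HU s u : \sum_b nu b * u b * L u b + \sum_b nu b * U s b * u b ^+ 2 <= 0.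
  have := form_bound s u; rewrite -subr_le0; apply: le_trans.
  rewrite -addrA lerD2l mulr_sumr -sumrB; apply: ler_sum => b _.
  by rewrite /U le_eqVlt; apply/orP; left; apply/eqP; ring.
have [M1 HM1] := tilted_mass (HU false).
have [M2 HM2] := tilted_mass (HU true).
have [M3 HM3] := law_at_entropy.
exists (M1 + M2 + M3)%N => M MM M0 h hE.
have M0R : 0 < M%:R :> R by rewrite ltr0n.
have h0 : 0 <= h by rewrite hE divr_ge0 // ltW.
set p := transition L h.
have p0 c b : 0 <= p c b by apply: p_ge0.
have p1 c : \sum_b p c b = 1 by apply: p_sum1.
have nu0 c : 0 <= nu c by apply: ltW.
set c := a * delta / 2.
have c0 : 0 < c by rewrite !mulr_gt0.
(* Markov's inequality for R and Chernoff bounds for the two potentials, path by path *)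
have split s : size s = M.+1 -> path_law nu p s * (delta < `|h * word_add V s|)%R%:R <=
   (h / c) * (path_law nu p s * word_add Rf s) +
   \sum_(e : bool) expR (- c) *
     (if s is b :: _ then path_law nu p s * word_prod (fun b => expR (h * U e b)) s * 1 else 0).
  case: s => [//|b0 s0] _; set s := b0 :: s0.
  have wp e : word_prod (fun b => expR (h * U e b)) s =
     expR (h * ((-1) ^+ e * a * word_add V s - word_add Rf s)).
    rewrite /s; elim: s0 b0 {s} => [|b1 s1 IH] b0 /=; first by rewrite mulr0 subr0 mulr0 expR0.
    by have /= -> := IH b1; rewrite -expRD /U; congr expR; ring.
  have wr : 0 <= word_add Rf s.
    rewrite /s; elim: s0 b0 {s wp} => [|b1 s1 IH] b0 //=.
    by rewrite addr_ge0 //; apply: IH.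
  have pl : 0 <= path_law nu p s by apply: path_law_ge0.
  rewrite big_bool !mulr1 !wp.
  have -> : h / c * (path_law nu p s * word_add Rf s) +
    (expR (- c) * (path_law nu p s *
       expR (h * ((-1) ^+ true * a * word_add V s - word_add Rf s))) +
     expR (- c) * (path_law nu p s *
       expR (h * ((-1) ^+ false * a * word_add V s - word_add Rf s)))) =
    path_law nu p s * (h / c * word_add Rf s +
     (expR (- c + h * ((-1) ^+ true * a * word_add V s - word_add Rf s)) +
      expR (- c + h * ((-1) ^+ false * a * word_add V s - word_add Rf s)))).
    by rewrite !expRD; ring.
  rewrite ler_wpM2l //.
  have x0 : 0 <= h / c * word_add Rf s by rewrite !mulr_ge0 ?invr_ge0 // ltW.
  set x1 := expR _; set x2 := expR _.
  have x10 : 0 < x1 by apply: expR_gt0.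
  have x20 : 0 < x2 by apply: expR_gt0.
  case: ltrP => [dl|_]; last by rewrite !addr_ge0 // ltW.
  rewrite (_ : true%:R = 1 :> R) //.
  case: (lerP c (h * word_add Rf s)) => [cR|Rc].
    have : 1 <= h / c * word_add Rf s by rewrite mulrAC ler_pdivlMr ?mul1r.
    lra.
  have ha : a * delta = 2 * c by rewrite /c; field.
  have := dl; rewrite -(ltr_pM2l a_gt0) ha.
  case: (lerP 0 (h * word_add V s)) => [v0|v0].
    rewrite ger0_norm // => dl2.
    have : 1 <= x2.
      apply: expR_ge1; rewrite expr0 mul1r mulrBr.
      have -> : h * (a * word_add V s) = a * (h * word_add V s) by ring.
      lra.
    lra.
  rewrite ltr0_norm // => dl2.
  have : 1 <= x1.
    apply: expR_ge1; rewrite expr1 mulrBr.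
    have -> : h * (-1 * a * word_add V s) = - (a * (h * word_add V s)) by ring.
    lra.
  lra.
apply: le_trans (ler_word_sum split) _.
rewrite word_sumD word_sumZ word_sum_add // word_sum_sum big_bool.
have t1 e : word_sum M.+1 (fun s => if s is b :: _ then
    path_law nu p s * word_prod (fun b => expR (h * U e b)) s * 1 else 0) <= expR 1.
  rewrite (word_sum_prod nu p (fun b => expR (h * U e b)) M (fun=> 1)).
  under eq_bigr do rewrite mulr1.
  case: e; [apply: HM2 => //|apply: HM1 => //]; lia.
have t2 : h / c * \sum_(i < M) \sum_b law_at nu p i.+1 b * Rf b <=
   4 * t * K * expR (2 * K * t) / delta * (g / a).
  apply: (@le_trans _ _ (h / c * \sum_(i < M) (K * (2 * g * expR (2 * K * t))))).
    apply: ler_wpM2l; first by rewrite divr_ge0 // ltW.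
    apply: ler_sum => i _.
    apply: le_trans (Rf_entropy (law_at_dist nu0 p0 nu_sum1 p1 i.+1)) _.
    apply: ler_wpM2l; first exact: ltW.
    have M3M : (M3 <= M)%N by apply: leq_trans MM; rewrite leq_addl.
    exact: HM3 M3M h hE i.+1 (ltn_ord i).
  rewrite sumr_const card_ord -mulr_natl /c hE le_eqVlt; apply/orP; left; apply/eqP.
  by field; rewrite !gt_eqF.
have t3 e : word_sum M.+1 (fun s => expR (- c) * (if s is b :: _ then
    path_law nu p s * word_prod (fun b => expR (h * U e b)) s * 1 else 0)) <=
    expR 1 * expR (- c).
  by rewrite word_sumZ [leRHS]mulrC ler_wpM2l ?expR_ge0.
apply: le_trans (lerD t2 (lerD (t3 true) (t3 false))) _.
lra.
Qed.

End Grid.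

(** * The law of a Markov chain observed on a grid *)

Section ChainLaw.
Variables (R : realType) (S : finType) (L : (S -> R) -> S -> R) (nu : S -> R).
Variables (disp : measure_display) (Omega : measurableType disp).
Variables (P : probability Omega R) (X : R -> Omega -> S).
Hypothesis nu_gt0 : forall a, 0 < nu a.
Hypothesis HX : is_markov_chain L nu P X.

Lemma prob_fin (A : set Omega) : measurable A -> P A = (fine (P A))%:E.
Proof. by move=> mA; rewrite fineK // fin_num_measure. Qed.

Lemma prob_split (A : set Omega) (s : R) : measurable A -> 0 <= s ->
  fine (P A) = \sum_b fine (P (A `&` [set w | X s w = b])).
Proof.
move=> mA s0.
have mX b : measurable [set w | X s w = b] by apply: markov_measurable HX _ _ s0.
have key (l : seq S) : uniq l -> measurable (A `&` [set w | X s w \in l]) /\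
   fine (P (A `&` [set w | X s w \in l])) = \sum_(b <- l) fine (P (A `&` [set w | X s w = b])).
  elim: l => [_|b l IH /= /andP[bl ul]].
    rewrite big_nil; have -> : A `&` [set w | X s w \in [::]] = set0.
      by apply/seteqP; split => w //= [].
    by rewrite measure0.
  have [ml el] := IH ul.
  have -> : A `&` [set w | X s w \in b :: l] =
     (A `&` [set w | X s w = b]) `|` (A `&` [set w | X s w \in l]).
    apply/seteqP; split => w /=.
      by rewrite inE => -[Aw /orP[/eqP|]]; [left|right].
    by rewrite inE => -[[Aw ->]|[Aw ->]]; rewrite ?eqxx ?orbT.
  have mb : measurable (A `&` [set w | X s w = b]) by apply: measurableI.
  split; first exact: measurableU.
  rewrite measureU //; last first.
    by apply/seteqP; split => w //= [[_ wb] [_ wl]]; move: bl; rewrite -wb wl.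
  by rewrite fineD ?fin_num_measure // el big_cons.
have [_ <-] := key (index_enum S) (index_enum_uniq S).
congr (fine (P _)); apply/seteqP; split => w /=; last by case.
by move=> Aw; split => //; rewrite mem_index_enum.
Qed.

Lemma chain_two (u : R) a b : 0 <= u ->
  P [set w | X 0 w = a /\ X u w = b] = (nu a * transition L u a b)%:E.
Proof.
move=> u0.
have := markov_property HX (past := [::]) (s := 0) (u := u) a b (lexx _) u0.
rewrite (_ : [set w | (forall p, p \in [::] -> X p.1 w = p.2) /\ X 0 w = a] =
   [set w | X 0 w = a]); last by apply/seteqP; split => w //= -[].
rewrite (markov_init HX) EFinM => <-; last by [].
congr (P _); apply/seteqP; split => w /=; rewrite add0r; first by case.
by case.
Qed.

(** That the matrices are stochastic is read off the law of the chain at times 0 and u, as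
    [nu] charges every state. *)
Lemma transition_ge0 (u : R) a b : 0 <= u -> 0 <= transition L u a b.
Proof.
move=> u0; suff : (0%:E <= (nu a * transition L u a b)%:E)%E.
  by rewrite lee_fin pmulr_rge0.
by rewrite -chain_two // measure_ge0.
Qed.

Lemma transition_sum1 (u : R) a : 0 <= u -> \sum_b transition L u a b = 1.
Proof.
move=> u0.
have m0 : measurable [set w | X 0 w = a] by apply: markov_measurable HX _ _ _.
have := prob_split m0 u0; rewrite (markov_init HX) /=.
under eq_bigr do rewrite -[_ `&` _]/[set w | X 0 w = a /\ X u w = _] chain_two //=.
rewrite -mulr_sumr => e; apply: (mulfI (lt0r_neq0 (nu_gt0 a))).
by rewrite -e mulr1.
Qed.

Variable h : R.
Hypothesis h_ge0 : 0 <= h.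

(** The most recent state comes first, as in [path_law]. *)
Fixpoint grid_path (k : nat) (w : Omega) : seq S :=
  if k is k'.+1 then X (k'%:R * h) w :: grid_path k' w else [::].

Fixpoint grid_past (s : seq S) : seq (R * S) :=
  if s is b :: s' then ((size s')%:R * h, b) :: grid_past s' else [::].

Lemma grid_pastP s w :
  (forall p, p \in grid_past s -> X p.1 w = p.2) <-> grid_path (size s) w = s.
Proof.
elim: s => [|b s IH] //=; split.
  move=> H; rewrite (H (_, b)) ?mem_head //; congr (_ :: _); apply/IH => p ps.
  by apply: H; rewrite inE ps orbT.
by case=> <- /IH H p; rewrite inE => /orP[/eqP ->//|]; apply: H.
Qed.

Lemma grid_past_bound s p : p \in grid_past s -> 0 <= p.1 <= (size s)%:R * h.
Proof.
elim: s => [|b s IH] //=; rewrite inE => /orP[/eqP ->/=|/IH /andP[-> /= H]].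
  by rewrite mulr_ge0 //= ler_wpM2r // ler_nat.
by apply: le_trans H _; rewrite ler_wpM2r // ler_nat.
Qed.

(** The Markov property with the full past on the grid, by induction on the length. *)
Lemma path_lawE s : P [set w | grid_path (size s) w = s] =
  (path_law nu (transition L h) s)%:E.
Proof.
elim: s => [|b [|a s] IH].
- rewrite (_ : [set w | _] = setT) ?probability_setT //.
  by apply/seteqP; split.
- rewrite -(markov_init HX b); congr (P _); apply/seteqP; split => w /=.
    by rewrite mul0r => -[].
  by rewrite mul0r => ->.
have sh : 0 <= (size s)%:R * h by rewrite mulr_ge0.
have := markov_property HX (past := grid_past s) (s := (size s)%:R * h) (u := h)
  a b sh h_ge0 (fun p => @grid_past_bound s p).
have -> : [set w | (forall p, p \in grid_past s -> X p.1 w = p.2) /\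
    X ((size s)%:R * h) w = a] = [set w | grid_path (size (a :: s)) w = a :: s].
  apply/seteqP; split => w /=; first by case=> /grid_pastP -> ->.
  by case=> -> /grid_pastP.
rewrite IH -EFinM => <-; congr (P _); apply/seteqP; split => w /=.
  have -> : (size s)%:R * h + h = (size s).+1%:R * h by rewrite -natr1 mulrDl mul1r.
  by case=> -> -> /grid_pastP.
have -> : (size s)%:R * h + h = (size s).+1%:R * h by rewrite -natr1 mulrDl mul1r.
by case=> /grid_pastP -> -> ->.
Qed.

Lemma measurable_grid k (G : seq S -> bool) : measurable [set w | G (grid_path k w)].
Proof.
elim: k G => [|k IH] G /=.
  case: (G [::]); first by rewrite (_ : [set _ | _] = setT) //; apply/seteqP.
  by rewrite (_ : [set _ | _] = set0) //; apply/seteqP; split.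
have -> : [set w | G (X (k%:R * h) w :: grid_path k w)] =
  \big[setU/set0]_b ([set w | X (k%:R * h) w = b] `&` [set w | G (b :: grid_path k w)]).
  apply/seteqP; split => w /=.
    move=> Gw; rewrite -bigcup_seq; exists (X (k%:R * h) w); rewrite //= mem_index_enum //.
  by rewrite -bigcup_seq => -[b _ [/= <-]].
apply: bigsetU_measurable => b _; apply: measurableI.
  by apply: markov_measurable HX _ _ _; rewrite mulr_ge0.
exact: (IH (fun s => G (b :: s))).
Qed.

(** The induction carries an arbitrary event A, so that after splitting according to
    the most recent state the rest of the path can be treated in the same way. *)
Lemma prob_grid_event k (G : seq S -> bool) :
  P [set w | G (grid_path k w)] =
  (word_sum k (fun s => path_law nu (transition L h) s * (G s)%:R))%:E.
Proof.
have key (A : set Omega) (F : seq S -> bool) : measurable A ->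
  fine (P (A `&` [set w | F (grid_path k w)])) =
  word_sum k (fun s => fine (P (A `&` [set w | grid_path k w = s])) * (F s)%:R).
  elim: k A F => [|k IH] A F mA /=.
    rewrite (_ : [set w | [::] = [::]] = setT); last by apply/seteqP.
    case: (F [::]).
      by rewrite (_ : [set _ | _] = setT) ?mulr1 //; apply/seteqP.
    by rewrite (_ : [set _ | _] = set0) ?setI0 ?measure0 ?mulr0 //; apply/seteqP; split.
  have kh : 0 <= k%:R * h by rewrite mulr_ge0.
  have mF : measurable (A `&` [set w | F (X (k%:R * h) w :: grid_path k w)]).
    by apply: measurableI => //; apply: (measurable_grid k.+1 F).
  rewrite (prob_split mF kh); apply: eq_bigr => b _.
  have mAb : measurable (A `&` [set w | X (k%:R * h) w = b]).
    by apply: measurableI => //; apply: markov_measurable HX _ _ _.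
  transitivity (fine (P ((A `&` [set w | X (k%:R * h) w = b]) `&`
     [set w | F (b :: grid_path k w)]))).
    congr (fine (P _)); apply/seteqP; split => w /=.
      by case=> -[Aw Fw] Xw; rewrite -Xw.
    by case=> -[Aw <-] Fw.
  rewrite (IH _ (fun s => F (b :: s)) mAb); apply: eq_word_sum => s sk.
  congr (fine (P _) * _); apply/seteqP; split => w /=.
    by case=> -[Aw ->] ->.
  by case=> Aw [-> ->].
rewrite prob_fin; last exact: measurable_grid.
congr EFin; rewrite -[X in P X]setTI key //.
apply: eq_word_sum => s sk; rewrite setTI -sk path_lawE //.
Qed.

End ChainLaw.

(** * From Riemann sums to the time integral *)

Section TimeIntegral.
Variables (R : realType) (f : R -> R) (t C : R).
Hypothesis t_gt0 : 0 < t.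
Hypothesis f_bound : forall s, `|f s| <= C.
Hypothesis f_right : forall s, 0 <= s -> \forall u \near s^'+, f u = f s.

(** Values are taken at right endpoints: the functions of the paths are only
    right-continuous, and right endpoints approach s from the right. *)
Definition step_fun (M : nat) (s : R) : R :=
  \sum_(k < M) f (k.+1%:R * (t / M%:R)) *
     \1_(`[k%:R * (t / M%:R), k.+1%:R * (t / M%:R)[%classic) s.

Lemma step_funE M s : (0 < M)%N -> 0 <= s < t ->
  exists2 k : nat, s < k.+1%:R * (t / M%:R) <= s + t / M%:R &
    step_fun M s = f (k.+1%:R * (t / M%:R)).
Proof.
move=> M0 /andP[s0 st]; set h := t / M%:R.
have M0R : 0 < M%:R :> R by rewrite ltr0n.
have h0 : 0 < h by rewrite divr_gt0.
have sh0 : 0 <= s / h by rewrite divr_ge0 // ltW.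
pose k := Num.truncn (s / h).
have /andP[k1 k2] := truncn_itv sh0.
have k1' : k%:R * h <= s by rewrite -ler_pdivlMr.
have k2' : s < k.+1%:R * h by rewrite -ltr_pdivrMr.
have kM : (k < M)%N.
  rewrite -(ltr_nat R); apply: le_lt_trans k1 _.
  by rewrite ltr_pdivrMr // /h mulrC divfK ?gt_eqF.
exists k; first by rewrite k2' -natr1 mulrDl mul1r lerD2r.
rewrite /step_fun (bigD1 (Ordinal kM)) //= -/h indicE mem_set ?mulr1; last first.
  by rewrite /= in_itv /= k1' k2'.
rewrite big1 ?addr0 // => i ik; rewrite indicE memNset ?mulr0 //= in_itv /= => /andP[i1 i2].
move/eqP: ik; apply; apply/val_inj => /=; apply/eqP; rewrite eqn_leq.
rewrite -ltnS -(ltr_nat R) -(ltr_pM2r h0) (le_lt_trans i1 k2') /=.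
by rewrite -ltnS -(ltr_nat R) -(ltr_pM2r h0) (le_lt_trans k1' i2).
Qed.

(** The function is constant just after [s], so the sequence is eventually constant. *)
Lemma step_fun_cvg s : 0 <= s < t -> (fun M => step_fun M s) @ \oo --> f s.
Proof.
move=> st; have [s0 s1] := andP st.
have := f_right s0; rewrite near_withinE => /nbhs_ballP[e /= e0 He].
apply: cvg_near_cst.
exists (Num.truncn (t / e)).+1 => // M /= MM.
have M0 : (0 < M)%N by apply: leq_trans MM.
have M0R : 0 < M%:R :> R by rewrite ltr0n.
have [k /andP[k1 k2] ->] := step_funE M0 st.
apply: He; last exact: k1.
have hM : t / M%:R < e.
  rewrite ltr_pdivrMr // mulrC -ltr_pdivrMr //.
  by apply: lt_le_trans (truncnS_gt _) _; rewrite ler_nat.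
by rewrite /ball /= ltr0_norm ?subr_lt0 //; lra.
Qed.

Lemma measurable_step_fun M D : measurable_fun D (step_fun M).
Proof.
rewrite /step_fun; apply: measurable_sum => k.
by apply: measurable_funM => //; apply: measurable_indic; exact: measurable_itv.
Qed.

(** The integrand need not be Riemann integrable a priori; the Riemann sums are the
    Lebesgue integrals of the step functions, and dominated convergence applies. *)
Lemma riemann_cvg :
  (fun M => t / M%:R * \sum_(k < M) f (k.+1%:R * (t / M%:R))) @ \oo -->
  \int[lebesgue_measure]_(s in `[0, t]) f s.
Proof.
set D := `[0, t[%classic.
have mD : measurable D by exact: measurable_itv.
have inD s : D s -> 0 <= s < t by rewrite /D /= in_itv.
have muD : lebesgue_measure D = t%:E.
  by rewrite /D lebesgue_measure_itv /= lte_fin t_gt0 oppr0 adde0.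
have mf : measurable_fun D f.
  apply: (@measurable_fun_cvg _ _ _ D step_fun) => [m|s /inD].
    exact: measurable_step_fun.
  exact: step_fun_cvg.
have cint (c : R) : lebesgue_measure.-integrable D (EFin \o cst c).
  apply/integrableP; split; first exact/measurable_EFinP.
  rewrite (_ : (\int[lebesgue_measure]_(x in D) _)%E =
    (\int[lebesgue_measure]_(x in D) cst `|c|%:E x)%E); last exact: eq_integral.
  by rewrite integral_cst // [X in (_ * X)%E](_ : _ = t%:E) // -EFinM ltry.
have sb M s : D s -> `|step_fun M s| <= C.
  move=> /inD st; case: M => [|M].
    rewrite /step_fun big_ord0 normr0; exact: le_trans (f_bound 0).
  have [k _ ->] := @step_funE M.+1 s isT st; exact: f_bound.
have m1 n : measurable_fun D (EFin \o step_fun n).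
  by apply/measurable_EFinP; exact: measurable_step_fun.
have m2 : measurable_fun D (EFin \o f) by exact/measurable_EFinP.
case: (@dominated_convergence _ _ R lebesgue_measure D mD
  (fun M => EFin \o step_fun M) (EFin \o f) (EFin \o cst C)) => [|||||If _ cv] //.
  apply: aeW => s /inD st; apply: cvg_EFin; first exact: nearW.
  exact: step_fun_cvg.
  by apply: aeW => s n Ds /=; rewrite lee_fin; exact: sb.
rewrite -Rintegral_itv_bndo_bndc //.
have fin : (\int[lebesgue_measure]_(x in D) (EFin \o f) x)%E \is a fin_num.
  exact: integrable_fin_num.
have intE M : (\int[lebesgue_measure]_(x in D) (EFin \o step_fun M.+1) x)%E =
    (t / M.+1%:R * \sum_(k < M.+1) f (k.+1%:R * (t / M.+1%:R)))%:E.
  set h := t / M.+1%:R.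
  have h0 : 0 < h by rewrite divr_gt0.
  have iI (k : 'I_M.+1) : lebesgue_measure.-integrable D
      (fun x => (\1_(`[k%:R * h, k.+1%:R * h[%classic) x)%:E).
    by apply: (integrableS measurableT) => //; exact: integrable_indic_itv.
  transitivity (\int[lebesgue_measure]_(x in D)
     (\sum_(k < M.+1) (f (k.+1%:R * h))%:E *
        (\1_(`[k%:R * h, k.+1%:R * h[%classic) x)%:E))%E.
    apply: eq_integral => x _ /=; rewrite /step_fun -/h -sumEFin.
    by apply: eq_bigr => k _; rewrite EFinM.
  rewrite integral_sum //; last by move=> k; exact: integrableZl.
  rewrite mulr_sumr -sumEFin; apply: eq_bigr => k _.
  rewrite integralZl // integral_indic //.
  have -> : `[k%:R * h, k.+1%:R * h[%classic `&` D = `[k%:R * h, k.+1%:R * h[%classic.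
    apply/seteqP; split => x /=; first by case.
    rewrite /D /= !in_itv /= => /andP[x1 x2]; split; first by rewrite x1.
    rewrite (le_trans _ x1) /=; last by rewrite mulr_ge0 // ltW.
    apply: lt_le_trans x2 _; rewrite /h mulrA ler_pdivrMr // [t * _]mulrC.
    by apply: ler_wpM2r; [exact: ltW|rewrite ler_nat].
  have muI : lebesgue_measure (`[k%:R * h, k.+1%:R * h[%classic : set R) = h%:E.
    rewrite lebesgue_measure_itv /= lte_fin ltr_pM2r // ltr_nat ltnSn.
    by rewrite -EFinB -natr1; congr EFin; ring.
  by rewrite [X in (_ * X)%E](_ : _ = h%:E) // -EFinM mulrC.
rewrite -(fineK fin) in cv.
have /fine_cvg cvf := cv.
apply: cvg_trans cvf; apply: near_eq_cvg; exists 1%N => // -[//|M] _ /=.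
by rewrite intE.
Qed.

End TimeIntegral.

Section ChainTheorem.
Variables (R : realType) (S : finType) (L : (S -> R) -> S -> R) (nu V Rf : S -> R).
Variables (t delta a K g : R).
Variables (disp : measure_display) (Omega : measurableType disp).
Variables (P : probability Omega R) (X : R -> Omega -> S).
Hypothesis Lmat : forall f a, L f a = \sum_b L (fun c => (c == b)%:R) a * f b.
Hypothesis nu_gt0 : forall a, 0 < nu a.
Hypothesis HX : is_markov_chain L nu P X.
Hypothesis t_gt0 : 0 < t.
Hypothesis delta_gt0 : 0 < delta.
Hypothesis a_gt0 : 0 < a.
Hypothesis K_gt0 : 0 < K.
Hypothesis g_gt0 : 0 < g.
Hypothesis Rf_ge0 : forall b, 0 <= Rf b.
Hypothesis form_bound : forall (s : bool) (u : S -> R),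
  \sum_b nu b * u b * L u b + (-1) ^+ s * a * \sum_b nu b * V b * u b ^+ 2
    <= \sum_b nu b * Rf b * u b ^+ 2.
Hypothesis Rf_entropy : forall mu, is_dist mu ->
  \sum_b mu b * Rf b <= K * (entropy nu mu + g).

Lemma init_sum1 : \sum_b nu b = 1.
Proof.
have := prob_split HX measurableT (lexx 0); rewrite probability_setT /= => ->.
by apply: eq_bigr => b _; rewrite setTI (markov_init HX).
Qed.

Let Y M w := t / M%:R * word_add V (grid_path X (t / M%:R) M.+1 w).

Lemma grid_sum_cvg w : (fun M => Y M w) @ \oo -->
  \int[lebesgue_measure]_(s in `[0, t]) V (X s w).
Proof.
have fb s : `|V (X s w)| <= \sum_b `|V b|.
  by rewrite (bigD1 (X s w)) //= lerDl sumr_ge0.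
have fr s : 0 <= s -> \forall u \near s^'+, V (X u w) = V (X s w).
  by move=> s0; have := markov_right_cont HX w s0; apply: filterS => u ->.
have := riemann_cvg t_gt0 fb fr; apply: cvg_trans; apply: near_eq_cvg.
apply: nearW => M; rewrite /Y; congr (_ * _).
move: (t / M%:R) => h; elim: M => [|k IH]; first by rewrite big_ord0.
by rewrite big_ord_recr /= IH addrC.
Qed.

(** The Riemann sums converge path by path, so the event for the integral is contained in
    the increasing union of the events that all Riemann sums of order above
    a threshold are large; each of these has probability at most that of one
    grid event, which [grid_bound] controls uniformly in M. *)
Lemma chain_time_integral_tail :
  (P [set w | (delta < `| \int[lebesgue_measure]_(s in `[0%R, t]) V (X s w) |)%R] <=
  (2 * expR 1 * expR (- (a * delta / 2)) +
  4 * t * K * expR (2 * K * t) / delta * (g / a))%:E)%E.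
Proof.
set B := (X in (_ <= X%:E)%E).
pose I w := \int[lebesgue_measure]_(s in `[0, t]) V (X s w).
have [M0 HM0] := grid_bound Lmat nu_gt0 init_sum1 (transition_ge0 nu_gt0 HX)
  (transition_sum1 nu_gt0 HX) t_gt0 delta_gt0 a_gt0 K_gt0 g_gt0 Rf_ge0
  form_bound Rf_entropy.
pose E M := [set w | delta < `|Y M w|].
have hge0 M : 0 <= t / M%:R by rewrite divr_ge0 // ltW.
have mE M : measurable (E M).
  exact: (measurable_grid HX (hge0 M) M.+1
    (fun s => delta < `|t / M%:R * word_add V s|)).
have PE M : (M0 < M)%N -> (P (E M) <= B%:E)%E.
  move=> M0M.
  have M1 : (0 < M)%N by apply: leq_ltn_trans M0M.
  have := prob_grid_event HX (hge0 M) M.+1 (fun s => delta < `|t / M%:R * word_add V s|).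
  rewrite -/(E M) => ->; rewrite lee_fin.
  exact: HM0 (ltnW M0M) M1 _ erefl.
have mY M : measurable_fun setT (Y M).
  move=> _ A mA; rewrite setTI.
  rewrite (_ : _ @^-1` _ = [set w |
     (fun s => `[< A (t / M%:R * word_add V s) >]) (grid_path X (t / M%:R) M.+1 w)]).
    exact: (measurable_grid HX (hge0 M) M.+1
      (fun s => `[< A (t / M%:R * word_add V s) >])).
  by apply/seteqP; split => w /=; [move/asboolP|move/asboolP].
have mI : measurable_fun setT I.
  by apply: (measurable_fun_cvg mY) => w _; exact: grid_sum_cvg.
have mA : measurable [set w | delta < `|I w|].
  have := measurableT_comp (@normr_measurable R setT) mI.
  move=> /(_ measurableT `]delta, +oo[%classic (measurable_itv _)).
  rewrite setTI; congr measurable; apply/seteqP.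
  by split => w /=; rewrite in_itv /= andbT.
pose F m := \bigcap_(M in [set M | (M0 + m < M)%N]) E M.
have mF m : measurable (F m) by apply: bigcap_measurable; first exists (M0 + m).+1 => /=.
have sub : [set w | delta < `|I w|] `<=` \bigcup_m F m.
  move=> w /= dw.
  have [m _ Hm] := cvgr_gt _ (cvg_norm (@grid_sum_cvg w)) _ dw.
  exists m => // M /= MM; apply: Hm => /=.
  by apply: leq_trans (ltnW MM); rewrite leq_addl.
have mU : measurable (\bigcup_m F m) by exact: bigcup_measurable.
apply: (@le_trans _ _ (P (\bigcup_m F m))).
  by apply: le_measure; rewrite ?inE.
have cvF : (P \o F) m @[m --> \oo] --> P (\bigcup_m F m).
  apply: nondecreasing_cvg_mu => // m n mn; apply/subsetPset.
  by move=> w Fw M /= MM; apply: Fw => /=; apply: leq_ltn_trans MM; rewrite leq_add2l.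
rewrite -(cvg_lim _ cvF) //; apply: lime_le; first by apply/cvg_ex; eexists; exact: cvF.
apply: nearW => m /=; apply: (@le_trans _ _ (P (E (M0 + m).+1))).
  apply: le_measure; rewrite ?inE //.
  by move=> w Fw; apply: Fw => /=; exact: ltnSn.
by apply: PE; rewrite ltnS leq_addr.
Qed.

End ChainTheorem.

(** * The choice of the box sides *)

Section Scales.
Variables (d q : nat).
Hypothesis d13 : (1 <= d <= 3)%N.
Hypothesis q_gt0 : (0 < q)%N.

(** With these exponents l_0 (l_0 .. l_(k-1)) = l_k, since 2^c plus the sum of
    2^c, .., 2^(c+k-1) is 2^(c+k). All the ratios l_k / (l_0 .. l_(k-1)) coincide, and the
    last side that the pattern would produce, l_d, is q^16 in every dimension. *)
Definition scale (k : nat) : nat := q ^ (2 ^ (4 - d + k)).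

Lemma scale_gt0 k : (0 < scale k)%N.
Proof. by rewrite expn_gt0 q_gt0. Qed.

Lemma scale_lprod k : (scale 0 * lprod scale k)%N = scale k.
Proof.
elim: k => [|k IH]; first by rewrite /lprod big_ord0 muln1.
rewrite /lprod big_ord_recr /= mulnA IH /scale -expnD addnn -mul2n -expnS addnS //.
Qed.

Lemma scale_le k : (k < d)%N -> (scale k <= q ^ 8)%N.
Proof.
move=> kd; rewrite /scale leq_pexp2l //.
by rewrite (_ : 8 = 2 ^ 3)%N // leq_exp2l //; lia.
Qed.

Lemma scale_last : scale d = (q ^ 16)%N.
Proof. by rewrite /scale subnK //; lia. Qed.

(** The dimension enters here: the volume of the box is q^8, q^12, q^14 for d = 1, 2, 3, and
    the square root of the volume of the torus is of order q^(9/2), q^9, q^(27/2). The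
    same scheme in dimension 4 would compare q^15 with q^18. *)
Lemma volume_bound N : (N <= (2 * q) ^ 9)%N ->
  (N ^ d * q <= 2 ^ (9 * d) * lprod scale d ^ 2)%N.
Proof.
move=> Nq; have m16 := scale_lprod d; rewrite scale_last in m16.
have q0 k : (0 < q ^ k)%N by rewrite expn_gt0 q_gt0.
have st : (N ^ d * q <= (2 * q) ^ (9 * d) * q)%N.
  by rewrite leq_mul2r expnM leq_exp2r ?Nq ?orbT //; case/andP: d13.
apply: leq_trans st _.
have [e [s0 e16 de]] : exists e, [/\ (2 ^ (4 - d + 0) = 16 - e)%N, (e <= 16)%N &
    (9 * d + 1 <= 2 * e)%N].
  have d123 : d = 1%N \/ d = 2%N \/ d = 3%N by lia.
  by case: d123 => [->|[->|->]]; [exists 8%N|exists 12%N|exists 14%N].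
have me : lprod scale d = (q ^ e)%N.
  apply/eqP; rewrite -(eqn_pmul2l (q0 (16 - e)%N)) -{1}s0 -/(scale 0) m16 -expnD subnK //.
rewrite me expnMn -mulnA -expnSr -expnM leq_mul2l; apply/orP; right.
by rewrite leq_pexp2l //; lia.
Qed.

End Scales.

Lemma ninth_root_floor N : (0 < N)%N -> exists q, (q ^ 9 <= N < q.+1 ^ 9)%N.
Proof.
elim: N => [//|N IH] _; case: N IH => [_|N /(_ isT)[q /andP[q1 q2]]].
  by exists 1%N.
case: (ltnP N.+2 (q.+1 ^ 9)) => h.
  by exists q; rewrite h andbT; apply: leq_trans q1 _.
exists q.+1; rewrite h /=; apply: leq_ltn_trans (_ : q.+1 ^ 9 < q.+2 ^ 9)%N.
  by [].
by rewrite ltn_exp2r.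
Qed.

(** * The tail bound on a fixed torus *)

Lemma local_prodZ (R : realType) d n (rho c : R) phi A (eta : config d n) z :
  local_prod rho (fun x => c * phi x) A eta z = c * local_prod rho phi A eta z.
Proof. by rewrite /local_prod mulrA. Qed.

(** One remainder serves both signs of the observable, because it is quadratic. *)
Lemma local_remainder_sign (R : realType) d n (rho eps : R) l (b : bool)
    (phi : torus d n -> R) A (eta : config d n) :
  local_remainder rho l eps (fun x => (-1) ^+ b * phi x) A eta =
  local_remainder rho l eps phi A eta.
Proof.
have e s z : lincomb s (local_prod rho (fun x => (-1) ^+ b * phi x) A eta) z ^+ 2 =
   lincomb s (local_prod rho phi A eta) z ^+ 2.
  rewrite /lincomb; under eq_bigr do rewrite local_prodZ mulrCA.
  by rewrite -mulr_sumr exprMn sqrr_sign mul1r.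
rewrite /local_remainder /remainder; congr (_ * _ + _ / _ + _ / _).
  by apply: eq_bigr => k _; apply: eq_bigr => z _; apply: e.
by apply: eq_bigr => z _; apply: e.
Qed.

Section FixedSize.
Variables (R : realType) (d : nat).
Hypothesis d13 : (1 <= d <= 3)%N.
Variables (lambda rho : R).
Hypothesis lambda_gt0 : 0 < lambda.
Hypothesis rho01 : 0 < rho < 1.
Hypothesis stationary : reaction_drift d lambda rho = 0.
Variables (delta t : R).
Hypothesis delta_gt0 : 0 < delta.
Hypothesis t_gt0 : 0 < t.
Variable A0 : {fset 'rV[int]_d}.
Hypothesis A0_neq0 : A0 != fset0.
Hypothesis A0_neg : forall z, z \in A0 -> forall j : 'I_d, z 0 j < 0.
Variable r : nat.
Hypothesis r_ge2 : (2 <= r)%N.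
Hypothesis A0_bound : forall z, z \in A0 -> forall j : 'I_d, - r%:Z <= z 0 j.
Variable B : R.
Hypothesis B_gt0 : 0 < B.

(** The Dirichlet form N^2 / 2 is divided equally between the 2 d + 1 families of local
    products to be replaced: the observable, and in each direction the three-body and
    the two-body terms of the reaction. *)
Definition share : R := 1 / (2 * (2 * d%:R + 1)).

Let share_gt0 : 0 < share.
Proof. by rewrite divr_gt0 // mulr_gt0 // addr_gt0 // mulr_gt0 // ltr0n; case/andP: d13. Qed.

Definition total_cst : R := remainder_cst d r share B +
  d%:R * (remainder_cst d r share (lambda / (2 * rho)) + remainder_cst d r share lambda).

Lemma remainder_cst_gt0 (eps C : R) : 0 < eps -> 0 < remainder_cst d r eps C.
Proof.
move=> e0; rewrite /remainder_cst mulr_gt0 ?color_cst_gt0 // ltr_wpDl // addr_ge0 //.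
  apply: divr_ge0; last exact: ltW.
  by apply: mulr_ge0; [exact: mulr_ge0|exact: sqr_ge0].
by apply: mulr_ge0; [|exact: sqr_ge0].
Qed.

Lemma total_cst_gt0 : 0 < total_cst.
Proof.
rewrite /total_cst ltr_pwDl ?remainder_cst_gt0 // mulr_ge0 // addr_ge0 // ltW //;
  exact: remainder_cst_gt0.
Qed.

Variables (n q : nat).
Hypothesis q_large : (2 * r + 4 <= q)%N.
Hypothesis q9 : (q ^ 9 <= n.+1)%N.
Variable phi : torus d n -> R.
Hypothesis phi_bound : forall x, `|phi x| <= B.

Let q_gt0 : (0 < q)%N. Proof. by lia. Qed.
Let l := scale d q.

Let l_gt0 k : (0 < l k)%N. Proof. exact: scale_gt0. Qed.

Let fits (j : 'I_d) : (2 * (l j + r) + 1 < n.+1)%N.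
Proof.
have l8 : (l j <= q ^ 8)%N by apply: scale_le.
apply: leq_trans q9; rewrite expnS.
have q8 : (0 < q ^ 8)%N by rewrite expn_gt0 q_gt0.
move: l8 q8; move: (l j) (q ^ 8)%N q_large => a b c ab b0; nia.
Qed.

Let n_gt0 : (0 < n)%N.
Proof.
have d0 : (0 < d)%N by case/andP: d13.
have := fits (Ordinal d0); lia.
Qed.

Let cost_gt0 : (0 < l 0)%N. Proof. exact: l_gt0. Qed.

Let cost_shear k : (k < d)%N -> (l k <= l 0 * lprod l k)%N.
Proof. by move=> _; rewrite scale_lprod. Qed.

Let cost_box : (l 0 * lprod l d <= n.+1 ^ 2)%N.
Proof.
rewrite scale_lprod scale_last //; apply: (@leq_trans ((q ^ 9) ^ 2)).
  by rewrite -expnM leq_pexp2l.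
by rewrite leq_exp2r.
Qed.

Let A1 (j : 'I_d) : seq 'rV[int]_d := [:: - dir d j; - (dir d j *+ 2)].
Let A2 (j : 'I_d) : seq 'rV[int]_d := [:: - dir d j].

Let dir_neq0 (j : 'I_d) : dir d j != 0.
Proof. by apply/eqP => /(congr1 (fun M : 'rV[int]_d => M 0 j)); rewrite !mxE eqxx. Qed.

Let A1_uniq j : uniq (A1 j).
Proof.
rewrite /= inE andbT eqr_opp mulr2n -subr_eq0 opprD addrA subrr add0r oppr_eq0.
exact: dir_neq0.
Qed.

Let A1_behind j a : a \in A1 j -> a != 0 /\ forall i, - r%:Z <= a 0 i <= 0.
Proof.
have e i : (dir d j) 0 i = (i == j)%:Z by rewrite mxE natz.
rewrite !inE => /orP[/eqP ->|/eqP ->]; split.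
- by rewrite oppr_eq0.
- by move=> i; rewrite mxE e; case: (i == j) => /=; lia.
- rewrite oppr_eq0; apply/eqP => /(congr1 (fun M : 'rV[int]_d => M 0 j)).
  by rewrite mulmxnE e eqxx mxE.
- by move=> i; rewrite mxE mulmxnE e; case: (i == j) => /=; lia.
Qed.

Let A2_behind j a : a \in A2 j -> a != 0 /\ forall i, - r%:Z <= a 0 i <= 0.
Proof. by rewrite inE => h; apply: (A1_behind (j := j)); rewrite inE h. Qed.

Let A0_behind (a : 'rV[int]_d) : a \in (A0 : seq _) -> a != 0 /\ forall i, - r%:Z <= a 0 i <= 0.
Proof.
move=> aA; have d0 : (0 < d)%N by case/andP: d13.
split; last by move=> i; rewrite A0_bound // ltW ?A0_neg.
by apply: contraTneq (A0_neg aA (Ordinal d0)) => ->; rewrite mxE ltxx.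
Qed.

Let A0_seq_neq0 : (A0 : seq _) != [::].
Proof.
case/fset0Pn: A0_neq0 => z zA; apply: contraTneq zA => e.
by rewrite -[_ \in _]/(z \in (A0 : seq _)) e.
Qed.

Let R1 (j : 'I_d) : config d n -> R :=
  local_remainder rho l share (fun=> lambda / (2 * rho)) (A1 j).
Let R2 (j : 'I_d) : config d n -> R := local_remainder rho l share (fun=> lambda) (A2 j).
Let R0 : config d n -> R := local_remainder rho l share phi A0.

Definition total_remainder eta : R := R0 eta + \sum_(j < d) (R1 j eta + R2 j eta).

Let lr_gt0 : 0 < lambda / (2 * rho).
Proof. by have [r0 r1] := andP rho01; rewrite divr_gt0 // mulr_gt0. Qed.

Lemma total_remainder_ge0 eta : 0 <= total_remainder eta.
Proof.
rewrite /total_remainder addr_ge0 ?local_remainder_ge0 // sumr_ge0 // => j _.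
by rewrite addr_ge0 ?local_remainder_ge0.
Qed.

Lemma total_remainder_entropy mu : is_dist mu ->
  \sum_eta mu eta * total_remainder eta <=
  total_cst * (entropy (@bernoulli_product R d n rho) mu + n.+1%:R ^+ d / (lprod l d)%:R).
Proof.
move=> dmu.
have e0 := local_remainder_entropy l_gt0 fits rho01 share_gt0 A0_behind phi_bound B_gt0
  (fset_uniq A0) A0_seq_neq0 cost_gt0 cost_shear cost_box dmu.
have n1 (z : torus d n) : `|lambda / (2 * rho)| <= lambda / (2 * rho).
  by rewrite gtr0_norm.
have n2 (z : torus d n) : `|lambda| <= lambda by rewrite gtr0_norm.
have e1 j := local_remainder_entropy l_gt0 fits rho01 share_gt0 (@A1_behind j) n1 lr_gt0
  (A1_uniq j) isT cost_gt0 cost_shear cost_box dmu.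
have e2 j := local_remainder_entropy l_gt0 fits rho01 share_gt0 (@A2_behind j) n2 lambda_gt0
  (isT : uniq (A2 j)) isT cost_gt0 cost_shear cost_box dmu.
have -> : \sum_eta mu eta * total_remainder eta =
  \sum_eta mu eta * R0 eta + \sum_(j < d) (\sum_eta mu eta * R1 j eta + \sum_eta mu eta * R2 j eta).
  under [X in _ = _ + X]eq_bigr do rewrite -big_split /=.
  rewrite exchange_big /= -big_split /=; apply: eq_bigr => eta _.
  rewrite /total_remainder mulrDr mulr_sumr; congr (_ + _).
  by apply: eq_bigr => j _; rewrite mulrDr.
set Hg := (_ + _ / _) in e0 e1 e2 *.
rewrite /total_cst mulrDl; apply: lerD; first exact: e0.
rewrite -mulrA mulr_natl -[X in _ *+ X](card_ord d) -sumr_const.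
by apply: ler_sum => j _; rewrite mulrDl; apply: lerD; [exact: e1|exact: e2].
Qed.

Let a : R := n.+1%:R `^ (d%:R / 2).

Definition observable (eta : config d n) : R := \sum_(x : torus d n)
  n.+1%:R `^ (- (d%:R / 2)) * phi x * centered_prod rho A0 eta x * centered rho eta x.

Let a_gt0 : 0 < a. Proof. by rewrite powR_gt0. Qed.

Lemma observableE eta :
  a * observable eta = \sum_z local_prod rho phi A0 eta z * centered rho eta z.
Proof.
rewrite /observable mulr_sumr; apply: eq_bigr => x _; rewrite !mulrA powRN -/a.
by rewrite divff ?gt_eqF // mul1r.
Qed.

(** The replacement of all families consumes the whole Dirichlet form of the exchanges. *)
Lemma form_inequality (b : bool) (g : config d n -> R) :
  \sum_c bernoulli_product rho c * g c * generator lambda g c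
   + (-1) ^+ b * a * (\sum_c bernoulli_product rho c * observable c * g c ^+ 2) <=
  \sum_c bernoulli_product rho c * total_remainder c * g c ^+ 2.
Proof.
have -> : \sum_c bernoulli_product rho c * g c * generator lambda g c =
  expect rho (fun eta => g eta * generator lambda g eta).
  by apply: eq_bigr => c _; rewrite mulrA.
have -> : \sum_c bernoulli_product rho c * total_remainder c * g c ^+ 2 =
  expect rho (fun eta => total_remainder eta * g eta ^+ 2).
  by apply: eq_bigr => c _; rewrite mulrA.
pose ph z := (-1) ^+ b * phi z.
have -> : (-1) ^+ b * a * (\sum_c bernoulli_product rho c * observable c * g c ^+ 2) =
  expect rho (fun eta => (\sum_z local_prod rho ph A0 eta z * centered rho eta z) * g eta ^+ 2).
  rewrite mulr_sumr; apply: eq_bigr => c _.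
  have -> : \sum_z local_prod rho ph A0 c z * centered rho c z =
     (-1) ^+ b * \sum_z local_prod rho phi A0 c z * centered rho c z.
    rewrite mulr_sumr; apply: eq_bigr => z _.
    by rewrite (local_prodZ rho ((-1) ^+ b) phi A0 c z) -mulrA.
  by rewrite -observableE (_ : bern rho c = bernoulli_product rho c) //; ring.
have f0 := local_form_bound l_gt0 fits rho01 share_gt0 ph A0_behind g.
have f1 j := local_form_bound l_gt0 fits rho01 share_gt0
  (fun=> lambda / (2 * rho)) (@A1_behind j) g.
have f2 j := local_form_bound l_gt0 fits rho01 share_gt0
  (fun=> lambda) (@A2_behind j) g.
have gf := generator_form lambda_gt0 rho01 stationary n_gt0 g.
pose D := \sum_(k < d) dirichlet rho k g.
have fE : expect rho (fun eta => (\sum_x flip_defect lambda rho eta x / 2) * g eta ^+ 2) =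
  \sum_(j < d) (expect rho (fun eta => (\sum_z local_prod rho (fun=> lambda / (2 * rho)) (A1 j) eta z
        * centered rho eta z) * g eta ^+ 2) +
    expect rho (fun eta => (\sum_z local_prod rho (fun=> lambda) (A2 j) eta z
        * centered rho eta z) * g eta ^+ 2)).
  under eq_bigr do rewrite -expectD.
  rewrite -expect_sum; apply: eq_expect => eta; rewrite flip_defect_local // mulr_suml.
  by apply: eq_bigr => j _; rewrite mulrDl.
have tE : expect rho (fun eta => total_remainder eta * g eta ^+ 2) =
  expect rho (fun eta => R0 eta * g eta ^+ 2) +
  \sum_(j < d) (expect rho (fun eta => R1 j eta * g eta ^+ 2) +
                expect rho (fun eta => R2 j eta * g eta ^+ 2)).
  under eq_bigr do rewrite -expectD.
  rewrite -expect_sum -expectD; apply: eq_expect => eta; rewrite /total_remainder mulrDl.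
  by rewrite mulr_suml; congr (_ + _); apply: eq_bigr => j _; rewrite mulrDl.
have r0 : expect rho (fun eta => local_remainder rho l share ph A0 eta * g eta ^+ 2) =
  expect rho (fun eta => R0 eta * g eta ^+ 2).
  by apply: eq_expect => eta; rewrite local_remainder_sign.
rewrite r0 -/D in f0; rewrite fE -/D in gf; rewrite tE.
have fs : \sum_(j < d) (expect rho (fun eta => (\sum_z local_prod rho (fun=> lambda / (2 * rho))
      (A1 j) eta z * centered rho eta z) * g eta ^+ 2) +
    expect rho (fun eta => (\sum_z local_prod rho (fun=> lambda) (A2 j) eta z
        * centered rho eta z) * g eta ^+ 2)) <=
  d%:R * (2 * (share * n.+1%:R ^+ 2 * D)) +
  \sum_(j < d) (expect rho (fun eta => R1 j eta * g eta ^+ 2) +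
                expect rho (fun eta => R2 j eta * g eta ^+ 2)).
  have -> : d%:R * (2 * (share * n.+1%:R ^+ 2 * D)) =
     \sum_(j < d) 2 * (share * n.+1%:R ^+ 2 * D).
    by rewrite sumr_const card_ord mulr_natl.
  rewrite -big_split /=; apply: ler_sum => j _.
  have := f1 j; have := f2 j; rewrite -/D -/(R1 j) -/(R2 j); lra.
have sh : share * n.+1%:R ^+ 2 * D + d%:R * (2 * (share * n.+1%:R ^+ 2 * D)) =
   n.+1%:R ^+ 2 / 2 * D.
  rewrite /share; field.
  by rewrite gt_eqF // addr_gt0 // mulr_gt0 // ltr0n; case/andP: d13.
lra.
Qed.

Variables (disp : measure_display) (Omega : measurableType disp).
Variables (P : probability Omega R) (X : R -> Omega -> config d n).
Hypothesis HX : is_markov_chain (@generator R d n lambda) (@bernoulli_product R d n rho) P X.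

Lemma fixed_size_tail :
  (P [set w | (delta < `|\int[lebesgue_measure]_(s in `[0%R, t]) observable (X s w)|)%R] <=
  (2 * expR 1 * expR (- (a * delta / 2)) +
   4 * t * total_cst * expR (2 * total_cst * t) / delta *
     (n.+1%:R ^+ d / (lprod l d)%:R / a))%:E)%E.
Proof.
have gap0 : 0 < n.+1%:R ^+ d / (lprod l d)%:R :> R.
  by rewrite divr_gt0 ?exprn_gt0 // ltr0n lprod_gt0.
exact: (chain_time_integral_tail (@generator_matrix R d n lambda) (bern_gt0 rho01) HX
  t_gt0 delta_gt0 a_gt0 total_cst_gt0 gap0 total_remainder_ge0 form_inequality
  total_remainder_entropy).
Qed.

End FixedSize.

(** * The limit *)

Lemma smooth_bounded (R : realType) (d : nat) (phi : 'rV[R]_d -> R) : smooth_torus phi ->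
  exists2 B : R, 0 < B & forall n (x : torus d n), `|phi (macro_point R x)| <= B.
Proof.
case=> /(_ 0%N) /= cphi _.
have cA : compact [set v : 'rV[R]_d | forall i, `[0, 1]%classic (v ord0 i)].
  exact: (@rV_compact R d (fun=> `[0, 1]%classic) (fun=> @segment_compact R 0 1)).
have := continuous_compact (continuous_subspaceT cphi) cA.
move=> /compact_bounded [M [_ HM]].
exists (`|M| + 1); first by rewrite ltr_pwDr.
move=> n x; apply: (HM (`|M| + 1)); first by apply: le_lt_trans (ler_norm M) _; rewrite ltrDl.
exists (macro_point R x) => // i /=; rewrite in_itv /= mxE divr_ge0 //=.
by rewrite ler_pdivrMr ?ltr0n // mul1r ler_nat ltnW // ltn_ord.
Qed.

Lemma fset_bound (d : nat) (A : {fset 'rV[int]_d}) : exists r : nat,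
  forall z, z \in A -> forall j : 'I_d, - r%:Z <= z 0 j.
Proof.
exists (\sum_(z <- A) \sum_j `|z 0%R j|)%N => z zA j.
have h : (`|z 0%R j| <= \sum_(y <- A) \sum_i `|y 0%R i|)%N.
  rewrite (big_rem z) //= (bigD1 j) //= -addnA; exact: leq_addr.
move: h; move: (z 0 j) (\sum_(_ <- _) _)%N => x m; lia.
Qed.

(** With a = N^(d/2), both terms of the tail bound, of orders 1 / a and N^d / (m a), are
    O(q^(-1/2)). *)
Lemma volume_scales (R : realType) (d q N : nat) : (1 <= d <= 3)%N -> (0 < q)%N ->
  (q ^ 9 <= N)%N -> (N <= (2 * q) ^ 9)%N ->
  let a : R := N%:R `^ (d%:R / 2) in
  a^-1 <= (Num.sqrt q%:R)^-1 /\
  N%:R ^+ d / (lprod (scale d q) d)%:R / a <= 2 ^+ 14 / Num.sqrt q%:R.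
Proof.
move=> d13 q0 qN Nq a.
have N0 : (0 < N)%N by apply: leq_trans qN; rewrite expn_gt0 q0.
have NR : 0 < N%:R :> R by rewrite ltr0n.
have a0 : 0 < a by rewrite powR_gt0.
have a2 : a ^+ 2 = N%:R ^+ d.
  rewrite /a -powR_mulrn ?powR_ge0 // -powRrM divfK // powR_mulrn //; exact: ltW.
have qR : 0 < q%:R :> R by rewrite ltr0n.
have s0 : 0 < Num.sqrt (q%:R : R) by rewrite sqrtr_gt0.
have s2 : Num.sqrt (q%:R : R) ^+ 2 = q%:R by rewrite sqr_sqrtr // ltW.
split.
  rewrite lef_pV2 ?posrE // -(ler_pXn2r (n := 2)) ?nnegrE ?(ltW a0) ?(ltW s0) //.
  rewrite s2 a2 -natrX ler_nat; apply: leq_trans (_ : q ^ 9 <= _)%N.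
    by rewrite -{1}(expn1 q) leq_pexp2l.
  apply: leq_trans qN _; rewrite -{1}(expn1 N) leq_pexp2l //; by case/andP: d13.
have m0 : 0 < (lprod (scale d q) d)%:R :> R.
  by rewrite ltr0n lprod_gt0 // => k; apply: scale_gt0.
set m := (lprod _ _)%:R in m0 *.
have vb : N%:R ^+ d * q%:R <= 2 ^+ 28 * m ^+ 2 :> R.
  apply: (@le_trans _ _ (2 ^+ (9 * d) * m ^+ 2)).
    by rewrite -!natrX -!natrM ler_nat; apply: volume_bound.
  rewrite ler_wpM2r ?sqr_ge0 // ler_eXn2l ?ltr1n //; lia.
have p1 : 0 <= N%:R ^+ d / m / a.
  by apply: divr_ge0 (ltW a0); apply: divr_ge0 (ltW m0); apply: exprn_ge0; apply: ltW.
have p2 : 0 <= 2 ^+ 14 / Num.sqrt (q%:R : R) by apply: divr_ge0 (ltW s0); apply: exprn_ge0.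
rewrite -(ler_pXn2r (n := 2)) ?nnegrE //.
rewrite !expr_div_n s2 a2 ler_pdivlMr // mulrAC ler_pdivrMr ?exprn_gt0 //.
have -> : N%:R ^+ d ^+ 2 / m ^+ 2 * q%:R = (N%:R ^+ d * q%:R) * N%:R ^+ d / m ^+ 2 by ring.
rewrite ler_pdivrMr ?exprn_gt0 // -exprM.
have -> : 2 ^+ (14 * 2) * N%:R ^+ d * m ^+ 2 = 2 ^+ 28 * m ^+ 2 * N%:R ^+ d :> R by ring.
by rewrite ler_wpM2r // exprn_ge0 // ltW.
Qed.

Theorem proposition5p1 (R : realType) (d : nat) (hd : (1 <= d <= 3)%N)
    (lambda : R) (hlambda : 0 < lambda)
    (rho : R) (hrho : 0 < rho < 1) (hF : reaction_drift d lambda rho = 0)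
    (delta t : R) (hdelta : 0 < delta) (ht : 0 < t)
    (A0 : {fset 'rV[int]_d}) (hA0 : A0 != fset0)
    (hneg : forall z, z \in A0 -> forall j : 'I_d, z 0 j < 0)
    (phi : 'rV[R]_d -> R) (hphi : smooth_torus phi)
    (disp : nat -> measure_display)
    (Omega : forall n : nat, measurableType (disp n))
    (P : forall n : nat, probability (Omega n) R)
    (eta : forall n : nat, R -> Omega n -> config d n)
    (heta : forall n : nat,
       is_markov_chain (@generator R d n lambda) (@bernoulli_product R d n rho)
                       (P n) (eta n)) :
  (fun n : nat =>
     P n [set w : Omega n |
       delta < `| \int[lebesgue_measure]_(s in `[0, t])
                    (\sum_(x : torus d n)
                       (n.+1)%:R `^ (- (d%:R / 2)) * phi (macro_point R x)
                       * centered_prod rho A0 (eta n s w) x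
                       * centered rho (eta n s w) x) |])
    @ \oo --> 0%E.
Proof.
have [B B0 HB] := smooth_bounded hphi.
have [r0 Hr0] := fset_bound A0.
(* the three-body terms of the reaction have range 2 once recentered *)
pose r := (r0 + 2)%N.
have r2 : (2 <= r)%N by rewrite leq_addl.
have Hr z : z \in A0 -> forall j : 'I_d, - r%:Z <= z 0 j.
  move=> zA j; apply: le_trans (Hr0 z zA j); rewrite /r; lia.
pose K := total_cst d lambda rho r B.
have K0 : 0 < K by apply: total_cst_gt0.
pose C : R := 4 * expR 1 / delta + 4 * t * K * expR (2 * K * t) / delta * 2 ^+ 14.
have C0 : 0 < C.
  rewrite /C ltr_pwDl ?divr_gt0 ?mulr_gt0 ?expR_gt0 //.
  by rewrite mulr_ge0 ?exprn_ge0 // divr_ge0 ?(ltW hdelta) // !mulr_ge0 ?expR_ge0 // ltW.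
pose p n := P n [set w : Omega n |
       delta < `| \int[lebesgue_measure]_(s in `[0, t])
                    observable rho A0 (fun x : torus d n => phi (macro_point R x)) (eta n s w) |].
have tail n q : (2 * r + 4 <= q)%N -> (q ^ 9 <= n.+1)%N -> (n.+1 < q.+1 ^ 9)%N ->
    (p n <= (C / Num.sqrt q%:R)%:E)%E.
  move=> rq qn nq; have q0 : (0 < q)%N by apply: leq_trans rq; rewrite addn_gt0 orbT.
  have nq2 : (n.+1 <= (2 * q) ^ 9)%N.
    apply: leq_trans (ltnW nq) _; rewrite leq_exp2r // mul2n -addnn -addn1 leq_add2l //.
  have := fixed_size_tail hd hlambda hrho hF hdelta ht hA0 hneg r2 Hr B0 rq qn
    (HB n) (heta n).
  move=> /le_trans; apply; rewrite lee_fin.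
  have [v1 v2] := volume_scales R hd q0 qn nq2.
  set a := _ `^ _ in v1 v2 *.
  have a0 : 0 < a by rewrite powR_gt0.
  have ad : 0 < a * delta / 2 by rewrite !mulr_gt0.
  have e1 : expR (- (a * delta / 2)) <= 2 / delta * a^-1.
    rewrite expRN; have -> : 2 / delta * a^-1 = (a * delta / 2)^-1.
      by field; rewrite !gt_eqF.
    rewrite lef_pV2 ?posrE ?expR_gt0 //; have := expR_ge1Dx (a * delta / 2); lra.
  rewrite (_ : C / Num.sqrt q%:R = 4 * expR 1 / delta / Num.sqrt q%:R +
    4 * t * K * expR (2 * K * t) / delta * 2 ^+ 14 / Num.sqrt q%:R); last by rewrite -mulrDl.
  apply: lerD.
    have -> : 4 * expR 1 / delta / Num.sqrt q%:R =
       2 * expR 1 * (2 / delta * (Num.sqrt q%:R)^-1) by ring.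
    apply: ler_wpM2l; first by rewrite mulr_ge0 ?expR_ge0.
    apply: le_trans e1 _; apply: ler_wpM2l => //; by rewrite divr_ge0 // ltW.
  rewrite -[leRHS]mulrA; apply: ler_wpM2l => //.
  by rewrite divr_ge0 ?(ltW hdelta) // !mulr_ge0 ?expR_ge0 // ltW.
(* for large n the ninth root q of n.+1 is large as well *)
have mono Q : exists n0, forall n, (n0 <= n)%N -> exists q, [/\ (Q <= q)%N,
    (q ^ 9 <= n.+1)%N & (n.+1 < q.+1 ^ 9)%N].
  exists (Q ^ 9)%N => n Qn; have [q /andP[q1 q2]] := ninth_root_floor (ltn0Sn n).
  exists q; split=> //; rewrite -ltnS -(@ltn_exp2r Q q.+1 9) //.
  by apply: leq_ltn_trans q2; apply: leq_trans Qn _; exact: leqnSn.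
rewrite -[X in X @ \oo]/p.
have pos n : (0 <= p n)%E by apply: measure_ge0.
apply/fine_cvgP; split.
  have [n0 Hn0] := mono (2 * r + 4)%N.
  exists n0 => // n /= /Hn0[q [rq q1 q2]].
  by rewrite ge0_fin_numE //; apply: le_lt_trans (tail n q rq q1 q2) (ltry _).
apply/cvgrPdist_le => e e0.
pose Q := (2 * r + 4 + (Num.truncn ((C / e) ^+ 2)).+1)%N.
have [n0 Hn0] := mono Q; exists n0 => // n /= /Hn0[q [Qq q1 q2]].
have rq : (2 * r + 4 <= q)%N by apply: leq_trans Qq; rewrite leq_addr.
have := tail n q rq q1 q2.
rewrite sub0r normrN ger0_norm ?fine_ge0 // => tl.
have qe : (C / e) ^+ 2 <= q%:R.
  apply/ltW/(lt_le_trans (truncnS_gt _)); rewrite ler_nat.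
  by apply: leq_trans Qq; rewrite leq_addl.
have qR : 0 < q%:R :> R by rewrite ltr0n; apply: leq_trans rq; rewrite addn_gt0 orbT.
have s0 : 0 < Num.sqrt (q%:R : R) by rewrite sqrtr_gt0.
have Ce : C / Num.sqrt q%:R <= e.
  rewrite ler_pdivrMr // mulrC -ler_pdivrMr //.
  rewrite -[leLHS]ger0_norm; last by rewrite divr_ge0 // ltW.
  by rewrite -sqrtr_sqr ler_wsqrtr.
rewrite -lee_fin fineK; first by apply: le_trans tl _; rewrite lee_fin.
by rewrite ge0_fin_numE //; apply: le_lt_trans tl (ltry _).
Qed.
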